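(* Let $n\ge 0$ be an integer, and let $\hat\Gamma_n$ be the Bendersky Gamma function. (1) For $w\in\mathbb{C}$ with $\Re w>0$, $\log\hat\Gamma_n(w)$ is an exponential period over the field $\mathbb{Q}(t,e^{-t},w,e^{-wt})$. (2) If $w\ge 1$ is an integer, then $\log\hat\Gamma_n(w)$ is an exponential period over the field $\mathbb{Q}(t,e^{-t})$. (3) If $w=p/q\in\mathbb{Q}$ with $w>0$, $\gcd(p,q)=1$ and $q\ge 1$, then $\log\hat\Gamma_n(p/q)$ is an exponential period over the field $\mathbb{Q}(t,e^{-t/q})$.
   Context: The Bendersky Gamma functions $\hat\Gamma_n$, $n\ge0$, are holomorphic and zero-free on $\Re w>0$, satisfy $\hat\Gamma_n(w+1)=w^{w^n}\hat\Gamma_n(w)$ and $\hat\Gamma_n(1)=1$ ($\hat\Gamma_0$ is Euler's Gamma function), and $\log\hat\Gamma_n$ is the holomorphic logarithm on $\Re w>0$ vanishing at $w=1$. They are determined by the known formula $\log\hat\Gamma_n(w)=\zeta_H'(-n,w)-\zeta'(-n)$, where $\zeta_H(s,w)=\sum_{k\ge0}(k+w)^{-s}$ (continued meromorphically in $s$) is the Hurwitz zeta function, $\zeta_H'=\partial\zeta_H/\partial s$, and $\zeta$ is the Riemann zeta function. The fields are fields of meromorphic functions of the variable $t$ generated over $\mathbb{Q}$ by the listed functions ($w$ being a constant). A complex number is an exponential period over a field $\mathbb{F}$ of meromorphic functions of $t$ if it equals a convergent integral $\int_0^{+\infty}f(t)\,dt$ with $f\in\mathbb{F}$. *)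

(* Defs.v *)
(* Stdlib real numbers with Coquelicot's complex analysis. *)
From Stdlib Require Import Reals ZArith QArith Qreals List ClassicalEpsilon.
From Coquelicot Require Export Coquelicot.
Open Scope R_scope.

Definition Cexp (z : C) : C :=
  (exp (Re z) * cos (Im z), exp (Re z) * sin (Im z)).

(* The principal logarithm on the half-plane [0 < Re z], the only place where
   it is used; elsewhere the value is meaningless. *)
Definition Clog (z : C) : C := (ln (Cmod z), atan (Im z / Re z)).

Definition Cpower (a s : C) : C := Cexp (s * Clog a)%C.

(* [f] is the meromorphic continuation of [s |-> sum_(k >= 0) (k + w)^(-s)],
   whose only pole is at [s = 1]; nothing is required of the value [f 1]. *)
Definition is_hurwitz_zeta (w : C) (f : C -> C) : Prop :=
  (forall s : C, s <> RtoC 1 -> @ex_derive C_AbsRing C_NormedModule f s) /\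
  (forall s : C, 1 < Re s ->
     @is_series C_AbsRing C_NormedModule
       (fun k : nat => Cpower (RtoC (INR k) + w)%C (- s)%C) (f s)).

(* Such a continuation exists for [0 < Re w], and by the identity theorem it is
   unique on [s <> 1]. *)
Definition hurwitz_zeta (s w : C) : C :=
  epsilon (inhabits (fun _ : C => RtoC 0)) (is_hurwitz_zeta w) s.

Definition riemann_zeta (s : C) : C := hurwitz_zeta s (RtoC 1).

(* The holomorphic logarithm of the Bendersky Gamma function on [0 < Re w],
   given by zeta_H'(-n, w) - zeta'(-n); it vanishes at [w = 1], and in general
   it is not [Clog (bendersky_gamma n w)]. *)
Definition log_bendersky_gamma (n : nat) (w : C) : C :=
  (C_derive (fun s => hurwitz_zeta s w) (RtoC (- INR n))
   - C_derive riemann_zeta (RtoC (- INR n)))%C.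

Definition bendersky_gamma (n : nat) (w : C) : C :=
  Cexp (log_bendersky_gamma n w).

(* The field of meromorphic functions of one complex variable generated over
   the rationals by the functions in [gens].  A meromorphic function is
   represented by any total function that agrees with it off a set without
   accumulation points, hence [gen_field_ext]; in particular the values at
   poles are irrelevant.  [gen_field_inv] needs no side condition because
   [/ 0 = 0] in [C], so that it sends a representative of the zero function to
   another one. *)
Inductive gen_field (gens : list (C -> C)) : (C -> C) -> Prop :=
| gen_field_rat (r : Q) : gen_field gens (fun _ => RtoC (Q2R r))
| gen_field_gen (g : C -> C) : In g gens -> gen_field gens g
| gen_field_add (f g : C -> C) : gen_field gens f -> gen_field gens g ->
    gen_field gens (fun t => f t + g t)%C
| gen_field_opp (f : C -> C) : gen_field gens f ->
    gen_field gens (fun t => - f t)%C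
| gen_field_mul (f g : C -> C) : gen_field gens f -> gen_field gens g ->
    gen_field gens (fun t => f t * g t)%C
| gen_field_inv (f : C -> C) : gen_field gens f ->
    gen_field gens (fun t => / f t)%C
| gen_field_ext (f g : C -> C) : gen_field gens f ->
    (forall z : C, locally' z (fun t : C => f t = g t)) ->
    gen_field gens g.

(* The integral over (0, +oo) is improper at both ends: elements of [F] may be
   undefined at [t = 0]. *)
Definition is_exponential_period (F : (C -> C) -> Prop) (c : C) : Prop :=
  exists f : C -> C, F f /\
    @is_RInt_gen C_R_NormedModule (fun t : R => f (RtoC t))
      (at_right 0) (Rbar_locally p_infty) c.

(* Main.v *)
(** The derivative at [s = -n] of the Hurwitz zeta function is compared with one
    convergent integral.  Uniqueness of the continuation (an identity theorem, from Goursat's theorem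
    on rectangles) allows it to be computed from any explicit continuation; we use
    the Euler-Maclaurin one, which gives
    [zeta_H'(-n, w) = lim_K (- sum_(k < K) (w+k)^n log (w+k) + sum_j d_j tau_j(w+K))],
    where [t / (1 - e^(-t)) ~ sum_j d_j t^j] and [tau_j(z)] is the derivative at
    [s = -n] of [(s)_(j-1) z^(1-s-j)], formally of
    [1/Gamma(s) int t^(s-1) t^(j-1) e^(-zt) dt].  Regularizing [t^(j-n-2) e^(-zt)] at
    [t = 0] by subtracting [e^(-t)] times a polynomial [sigma_j] in [t] gives a convergent
    integral, equal to [tau_j(z)] minus a polynomial [q_j(z)] over [Q]: both sides satisfy
    [D_j' = - D_(j+1)] in [z], and Taylor's inequality reduces the claim to
    [int e^(-zt) dt = 1/z].  Hence the integral [Phi(z)] of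
    [c t^(-n-2) (t e^(-zt) / (1 - e^(-t)) - e^(-t) sum_j d_j sigma_j(z, t))] satisfies, with
    [Psi(z) = Phi(z) + sum_j d_j q_j(z)], [Psi(z) - Psi(z+1) = - z^n log z] and
    [Psi(z) - sum_j d_j tau_j(z) -> 0], so that [zeta_H'(-n, w) = Psi(w)].  The integrand
    lies in the field, and the constants [q_j(z)] are integrals of multiples of [e^(-t)]. *)
Require Import Defs.
From Stdlib Require Import Reals ZArith QArith Qreals List Lra Lia ClassicalEpsilon.
From Coquelicot Require Import Coquelicot.
Import ListNotations.
Open Scope R_scope.

(** * Complex exponential, logarithm and derivatives along real paths *)

(** The obstacle is that the Mellin integral of [zeta_H(s, w)] diverges at [s = -n], so its
    derivative cannot be read off under the integral sign. The regularized integral is instead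
    formed directly at [s = -n] and identified by its difference equation in [z] together with its
    behaviour along [w + K]. The variables [s] and [z] play different roles. In [s] full complex
    differentiability is used, because it characterizes the continuation. In [z] only derivatives
    along real segments occur: the functions of [z] come in families with [g_j' = - g_(j+1)], and
    such a chain is what both the Euler-Maclaurin formula and Taylor's inequality work with. The
    constant [c] is [(-1)^n n!], the derivative of [1/Gamma] at [-n]. The regularization is a Taylor
    expansion in [z] at [z = 1], for two reasons: the only exponential it introduces is [e^(-t)],
    and [log 1 = 0] makes the Taylor coefficients of [tau_j] rational. *)

Notation Rder f x l := (@is_derive R_AbsRing C_R_NormedModule f x l).
Notation Cder f z l := (@is_derive C_AbsRing C_NormedModule f z l).
Notation is_CInt f a b l := (@is_RInt C_R_NormedModule f a b l).
Notation ex_CInt f a b := (@ex_RInt C_R_NormedModule f a b).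
Notation CInt f a b := (@RInt C_R_CompleteNormedModule f a b).
Notation Rcont f x := (@continuous R_UniformSpace C_UniformSpace f x).
Notation Ccont f z := (@continuous C_UniformSpace C_UniformSpace f z).

Lemma Cnorm_R (x : C) : @norm R_AbsRing C_R_NormedModule x = Cmod x.
Proof.
  unfold norm; simpl. unfold prod_norm, Cmod.
  unfold norm; simpl. unfold abs; simpl.
  f_equal. rewrite !Rmult_1_r. f_equal; rewrite <- Rabs_mult; apply Rabs_pos_eq; nra.
Qed.

Lemma Cexp_plus (a b : C) : Cexp (a + b)%C = (Cexp a * Cexp b)%C.
Proof.
  destruct a as [a1 a2], b as [b1 b2]; unfold Cexp, Cmult; simpl.
  rewrite exp_plus, cos_plus, sin_plus. f_equal; ring.
Qed.

Lemma Cexp_0 : Cexp 0 = 1.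
Proof. unfold Cexp; simpl. rewrite exp_0, cos_0, sin_0. unfold RtoC. f_equal; ring. Qed.

Lemma Cmod_Cexp (z : C) : Cmod (Cexp z) = exp (Re z).
Proof.
  destruct z as [a b]; unfold Cmod, Cexp; simpl.
  replace (_ + _) with (Rsqr (exp a)).
  - rewrite sqrt_Rsqr; [reflexivity | left; apply exp_pos].
  - generalize (sin2_cos2 b); unfold Rsqr; intro H.
    transitivity (exp a * exp a * (sin b * sin b + cos b * cos b)); [rewrite H; ring | ring].
Qed.

Lemma Cexp_neq_0 (z : C) : Cexp z <> 0.
Proof.
  apply Cmod_gt_0. rewrite Cmod_Cexp. apply exp_pos.
Qed.

Lemma Cexp_opp (z : C) : Cexp (- z)%C = (/ Cexp z)%C.
Proof.
  assert (H : (Cexp z * Cexp (- z) = 1)%C).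
  { rewrite <- Cexp_plus. replace (z + - z)%C with (RtoC 0) by ring. apply Cexp_0. }
  transitivity (/ Cexp z * (Cexp z * Cexp (- z)))%C.
  - field. apply Cexp_neq_0.
  - rewrite H. ring.
Qed.

Lemma Cexp_RtoC (x : R) : Cexp (RtoC x) = RtoC (exp x).
Proof. unfold Cexp, RtoC; simpl. rewrite cos_0, sin_0. f_equal; ring. Qed.

Lemma Cexp_pow (z : C) (n : nat) : Cexp (INR n * z)%C = (Cexp z ^ n)%C.
Proof.
  induction n as [|n IH].
  - simpl. rewrite Cmult_0_l. apply Cexp_0.
  - rewrite S_INR, RtoC_plus. simpl. rewrite <- IH.
    replace ((INR n + 1) * z)%C with (z + INR n * z)%C by ring. apply Cexp_plus.
Qed.

Lemma Cexp_Clog (z : C) : 0 < Re z -> Cexp (Clog z) = z.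
Proof.
  destruct z as [a b]; simpl; intro Ha.
  unfold Cexp, Clog; simpl.
  assert (Hm : 0 < Cmod (a, b)).
  { apply Cmod_gt_0. intro H. injection H. lra. }
  rewrite exp_ln by exact Hm.
  rewrite cos_atan, sin_atan.
  assert (E : Cmod (a, b) = a * sqrt (1 + (b / a)²)).
  { unfold Cmod; simpl.
    transitivity (sqrt (a²) * sqrt (1 + (b / a)²)); [|rewrite sqrt_Rsqr by lra; reflexivity].
    rewrite <- sqrt_mult; [f_equal; unfold Rsqr; field; lra | apply Rle_0_sqr |].
    generalize (Rle_0_sqr (b / a)); lra. }
  rewrite E.
  assert (0 < sqrt (1 + (b / a)²)).
  { apply sqrt_lt_R0. generalize (Rle_0_sqr (b / a)); lra. }
  f_equal; field; repeat split; lra.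
Qed.

Lemma Re_Clog (z : C) : Re (Clog z) = ln (Cmod z).
Proof. reflexivity. Qed.

Lemma Clog_1 : Clog 1 = 0.
Proof.
  unfold Clog. rewrite Cmod_1, ln_1. simpl.
  replace (0 / 1) with 0 by field. rewrite atan_0. reflexivity.
Qed.

(** The arctangent is below [PI / 2], and [PI <= 4] replaces this by a numeral. *)
Lemma Cmod_Im_Clog (z : C) : Rabs (Im (Clog z)) <= 2.
Proof.
  simpl. generalize (atan_bound (Im z / Re z)) PI_4. intros.
  apply Rabs_le. lra.
Qed.

Lemma Re_le_Cmod (z : C) : Re z <= Cmod z.
Proof. generalize (re_le_Cmod z). intro. apply Rle_trans with (Rabs (Re z)); [apply Rle_abs | assumption]. Qed.

Lemma C_neq_0_of_Re (z : C) : 0 < Re z -> z <> 0.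
Proof. intros H E. rewrite E in H. simpl in H. lra. Qed.

Lemma Cmod_le_abs (z : C) : Cmod z <= Rabs (Re z) + Rabs (Im z).
Proof.
  replace z with ((Re z, 0) + (0, Im z))%C at 1 by (destruct z; unfold Cplus; simpl; f_equal; ring).
  eapply Rle_trans; [apply Cmod_triangle|].
  unfold Cmod; simpl. apply Rplus_le_compat; right.
  - rewrite <- sqrt_Rsqr_abs. f_equal. unfold Rsqr; ring.
  - rewrite <- sqrt_Rsqr_abs. f_equal. unfold Rsqr; ring.
Qed.

Lemma Cmod_minus_sym (a b : C) : Cmod (a - b) = Cmod (b - a).
Proof. rewrite <- Cmod_opp. f_equal. ring. Qed.

Lemma Cmod_minus_le (a b : C) : Cmod (a - b) <= Cmod a + Cmod b.
Proof. unfold Cminus. eapply Rle_trans; [apply Cmod_triangle|]. rewrite Cmod_opp. lra. Qed.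

Lemma Rder_pair (f : R -> C) (x : R) (l : C) :
  is_derive (fun t => fst (f t)) x (fst l) ->
  is_derive (fun t => snd (f t)) x (snd l) -> Rder f x l.
Proof.
  intros [L1 H1] [L2 H2].
  split; [apply is_linear_scal_l|].
  intros y Hy. specialize (H1 y Hy). specialize (H2 y Hy).
  intros eps.
  assert (He : 0 < eps / 2) by (generalize (cond_pos eps); lra).
  specialize (H1 (mkposreal _ He)). specialize (H2 (mkposreal _ He)).
  generalize (filter_and _ _ H1 H2). apply filter_imp.
  intros t [Ha Hb].
  rewrite Cnorm_R. eapply Rle_trans; [apply Cmod_le_abs|].
  simpl in Ha, Hb.
  unfold norm in Ha, Hb |- *; simpl in Ha, Hb |- *.
  unfold abs in Ha, Hb |- *; simpl in Ha, Hb |- *.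
  unfold minus, plus, opp, scal in *; simpl in *.
  unfold mult in *; simpl in *.
  lra.
Qed.

Lemma Rder_fst (f : R -> C) (x : R) (l : C) :
  Rder f x l -> is_derive (fun t => fst (f t)) x (fst l).
Proof.
  intros [L H]. split; [apply is_linear_scal_l|].
  intros y Hy eps. specialize (H y Hy eps). revert H. apply filter_imp.
  intros t Ht. eapply Rle_trans; [|exact Ht]. rewrite Cnorm_R.
  eapply Rle_trans; [|apply re_le_Cmod]. apply Req_le. reflexivity.
Qed.

Lemma Rabs_Im_le_Cmod (z : C) : Rabs (Im z) <= Cmod z.
Proof. eapply Rle_trans; [|apply Rmax_Cmod]. apply Rmax_r. Qed.

Lemma Rder_snd (f : R -> C) (x : R) (l : C) :
  Rder f x l -> is_derive (fun t => snd (f t)) x (snd l).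
Proof.
  intros [L H]. split; [apply is_linear_scal_l|].
  intros y Hy eps. specialize (H y Hy eps). revert H. apply filter_imp.
  intros t Ht. eapply Rle_trans; [|exact Ht]. rewrite Cnorm_R.
  eapply Rle_trans; [|apply Rabs_Im_le_Cmod]. apply Req_le. reflexivity.
Qed.

Lemma Rder_ext_val (f : R -> C) (x : R) (l l' : C) : l = l' -> Rder f x l -> Rder f x l'.
Proof. intros ->. exact (fun H => H). Qed.

Lemma Rder_ext (f g : R -> C) (x : R) (l : C) : (forall t, f t = g t) -> Rder f x l -> Rder g x l.
Proof. apply (is_derive_ext (K := R_AbsRing) (V := C_R_NormedModule)). Qed.

Lemma Rder_const (c : C) (x : R) : Rder (fun _ => c) x (RtoC 0).
Proof. apply Rder_pair; simpl; apply is_derive_Reals, derivable_pt_lim_const. Qed.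

Lemma Rder_RtoC (f : R -> R) (x l : R) : is_derive f x l -> Rder (fun t => RtoC (f t)) x (RtoC l).
Proof.
  intro H. apply Rder_pair; simpl; [exact H|].
  apply is_derive_Reals, derivable_pt_lim_const.
Qed.

Lemma Rder_id (x : R) : Rder (fun t => RtoC t) x (RtoC 1).
Proof. apply Rder_RtoC. apply is_derive_Reals, derivable_pt_lim_id. Qed.

Lemma Rder_plus (f g : R -> C) (x : R) (l m : C) :
  Rder f x l -> Rder g x m -> Rder (fun t => f t + g t)%C x (l + m)%C.
Proof. intros H1 H2. apply (is_derive_plus f g x l m H1 H2). Qed.

Lemma Rder_opp (f : R -> C) (x : R) (l : C) :
  Rder f x l -> Rder (fun t => - f t)%C x (- l)%C.
Proof. intros H1. apply (is_derive_opp f x l H1). Qed.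

Lemma Rder_minus (f g : R -> C) (x : R) (l m : C) :
  Rder f x l -> Rder g x m -> Rder (fun t => f t - g t)%C x (l - m)%C.
Proof. intros H1 H2. apply (is_derive_minus f g x l m H1 H2). Qed.

Lemma Rder_mult (f g : R -> C) (x : R) (l m : C) :
  Rder f x l -> Rder g x m -> Rder (fun t => f t * g t)%C x (l * g x + f x * m)%C.
Proof.
  intros H1 H2.
  assert (A1 := Rder_fst _ _ _ H1). assert (A2 := Rder_snd _ _ _ H1).
  assert (B1 := Rder_fst _ _ _ H2). assert (B2 := Rder_snd _ _ _ H2).
  apply Rder_pair; simpl.
  - replace (fst l * fst (g x) - snd l * snd (g x) + (fst (f x) * fst m - snd (f x) * snd m))
      with ((fst l * fst (g x) + fst (f x) * fst m) - (snd l * snd (g x) + snd (f x) * snd m)) by ring.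
    apply (is_derive_minus (fun t => fst (f t) * fst (g t)) (fun t => snd (f t) * snd (g t)));
    apply Derive.is_derive_mult; assumption.
  - replace (fst l * snd (g x) + snd l * fst (g x) + (fst (f x) * snd m + snd (f x) * fst m))
      with ((fst l * snd (g x) + fst (f x) * snd m) + (snd l * fst (g x) + snd (f x) * fst m)) by ring.
    apply (is_derive_plus (fun t => fst (f t) * snd (g t)) (fun t => snd (f t) * fst (g t)));
    apply Derive.is_derive_mult; assumption.
Qed.

Lemma Rder_scal_l (c : C) (f : R -> C) (x : R) (l : C) :
  Rder f x l -> Rder (fun t => c * f t)%C x (c * l)%C.
Proof.
  intro H. eapply Rder_ext_val; [|apply (Rder_mult _ _ _ _ _ (Rder_const c x) H)].
  ring.
Qed.

Lemma Rder_affine (a v : C) (x : R) : Rder (fun t => a + t * v)%C x v.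
Proof.
  eapply Rder_ext_val; [|apply Rder_plus; [apply Rder_const | apply Rder_mult; [apply Rder_id | apply Rder_const]]].
  cbv beta. ring.
Qed.

Lemma Rder_Cexp (f : R -> C) (x : R) (l : C) :
  Rder f x l -> Rder (fun t => Cexp (f t)) x (l * Cexp (f x))%C.
Proof.
  intro H. assert (A1 := Rder_fst _ _ _ H). assert (A2 := Rder_snd _ _ _ H).
  apply Rder_pair; simpl.
  - eapply is_derive_ext; [intro; reflexivity|].
    replace (fst l * (exp (Re (f x)) * cos (Im (f x))) - snd l * (exp (Re (f x)) * sin (Im (f x))))
     with ((fst l * exp (fst (f x))) * cos (snd (f x)) + exp (fst (f x)) * (snd l * - sin (snd (f x))))
     by (unfold Re, Im; ring).
    apply (Derive.is_derive_mult (fun t => exp (fst (f t))) (fun t => cos (snd (f t)))).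
    + apply (is_derive_comp exp (fun t => fst (f t))); [apply is_derive_Reals, derivable_pt_lim_exp | exact A1].
    + apply (is_derive_comp cos (fun t => snd (f t))); [apply is_derive_Reals, derivable_pt_lim_cos | exact A2].
  - replace (fst l * (exp (Re (f x)) * sin (Im (f x))) + snd l * (exp (Re (f x)) * cos (Im (f x))))
     with ((fst l * exp (fst (f x))) * sin (snd (f x)) + exp (fst (f x)) * (snd l * cos (snd (f x))))
     by (unfold Re, Im; ring).
    apply (Derive.is_derive_mult (fun t => exp (fst (f t))) (fun t => sin (snd (f t)))).
    + apply (is_derive_comp exp (fun t => fst (f t))); [apply is_derive_Reals, derivable_pt_lim_exp | exact A1].
    + apply (is_derive_comp sin (fun t => snd (f t))); [apply is_derive_Reals, derivable_pt_lim_sin | exact A2].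
Qed.

Lemma Rder_Clog (f : R -> C) (x : R) (l : C) :
  0 < Re (f x) -> Rder f x l -> Rder (fun t => Clog (f t)) x (l / f x)%C.
Proof.
  intros Hp H. assert (A1 := Rder_fst _ _ _ H). assert (A2 := Rder_snd _ _ _ H).
  unfold Re in Hp.
  destruct (f x) as [a b] eqn:E. simpl in Hp. destruct l as [l1 l2]; simpl in A1, A2.
  assert (Hs : 0 < a * a + b * b) by nra.
  assert (Hs2 : 0 < sqrt (a * a + b * b)) by (apply sqrt_lt_R0; exact Hs).
  assert (Hq : sqrt (a * a + b * b) * sqrt (a * a + b * b) = a * a + b * b) by (apply sqrt_sqrt; lra).
  apply Rder_pair.
  - unfold Clog, Cmod. cbn [fst].
    eapply is_derive_ext with (f := fun t => ln (sqrt (fst (f t) * fst (f t) + snd (f t) * snd (f t)))).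
    { intro t; simpl. do 2 f_equal. ring. }
    evar_last.
    + apply (is_derive_comp ln (fun t => sqrt (fst (f t) * fst (f t) + snd (f t) * snd (f t)))).
      * apply is_derive_Reals, derivable_pt_lim_ln. rewrite E; exact Hs2.
      * apply (is_derive_comp sqrt (fun t => fst (f t) * fst (f t) + snd (f t) * snd (f t))).
        { apply is_derive_Reals, derivable_pt_lim_sqrt. rewrite E; exact Hs. }
        apply (is_derive_plus (fun t => fst (f t) * fst (f t)) (fun t => snd (f t) * snd (f t)));
        apply Derive.is_derive_mult; eassumption.
    + rewrite E. unfold scal, plus; simpl. unfold mult; simpl.
      unfold Cdiv, Cinv, Cmult; simpl.
      set (r := sqrt (a * a + b * b)) in *.
      replace (a * (a * 1) + b * (b * 1)) with (r * r) by lra.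
      rewrite !E; simpl; field. lra.
  - unfold Clog. cbn [snd].
    evar_last.
    + apply (is_derive_comp atan (fun t => Im (f t) / Re (f t))).
      * apply is_derive_Reals, derivable_pt_lim_atan.
      * apply (is_derive_div (fun t => Im (f t)) (fun t => Re (f t))); [exact A2 | exact A1 |].
        rewrite E; simpl; lra.
    + rewrite E. unfold scal; simpl. unfold mult; simpl.
      unfold Cdiv, Cinv, Cmult, Rsqr; simpl. field.
      repeat split; nra.
Qed.

Lemma Rder_continuous (f : R -> C) (x : R) (l : C) : Rder f x l -> Rcont f x.
Proof.
  intro H. apply (ex_derive_continuous (K := R_AbsRing) (V := C_R_NormedModule) f x).
  exists l; exact H.
Qed.

(* The mean value theorem applied to the projection of [f] on [f b - f a]. *)
Lemma Rder_mvt (f df : R -> C) (a b M : R) : a <= b ->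
  (forall x, a <= x <= b -> Rder f x (df x)) ->
  (forall x, a <= x <= b -> Cmod (df x) <= M) ->
  Cmod (f b - f a) <= M * (b - a).
Proof.
  intros Hab Hd HM.
  set (c := (f b - f a)%C).
  destruct (Req_dec (Cmod c) 0) as [E|E].
  { rewrite E. assert (0 <= M) by (eapply Rle_trans; [apply Cmod_ge_0 | apply (HM a); lra]). nra. }
  assert (Hc : 0 < Cmod c) by (generalize (Cmod_ge_0 c); lra).
  (* This local name stands for the real scalar product of [c] with [f]; its increment over [[a, b]]
     is [|c|^2]. *)
  set (period_integrand := fun x => fst (Cconj c * f x)%C).
  destruct (MVT_gen period_integrand a b (fun x => fst (Cconj c * df x)%C)) as [xi [Hx Hv]].
  - intros x Hx. rewrite Rmin_left, Rmax_right in Hx by lra.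
    apply (Rder_fst (fun x => Cconj c * f x)%C x (Cconj c * df x)%C). apply Rder_scal_l, Hd. lra.
  - intros x Hx. rewrite Rmin_left, Rmax_right in Hx by lra.
    apply continuity_pt_filterlim.
    apply (ex_derive_continuous period_integrand). exists (fst (Cconj c * df x)%C).
    apply (Rder_fst (fun x => Cconj c * f x)%C x (Cconj c * df x)%C). apply Rder_scal_l, Hd. lra.
  - rewrite Rmin_left, Rmax_right in Hx by lra.
    assert (E2 : period_integrand b - period_integrand a = Cmod c * Cmod c).
    { unfold period_integrand. transitivity (Cmod c ^ 2); [|ring]. rewrite Cmod2_alt.
      unfold c; simpl. unfold Re, Im; simpl. ring. }
    rewrite E2 in Hv.
    assert (H3 : fst (Cconj c * df xi)%C <= Cmod c * M).
    { eapply Rle_trans; [apply (Re_le_Cmod (Cconj c * df xi)%C)|].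
      rewrite Cmod_mult, Cmod_conj. apply Rmult_le_compat_l; [lra | apply HM; lra]. }
    apply Rmult_le_reg_l with (Cmod c); [exact Hc|].
    rewrite Hv. nra.
Qed.

Lemma exp_mono (x y : R) : x <= y -> exp x <= exp y.
Proof. intros [H | ->]; [left; apply exp_increasing, H | right; reflexivity]. Qed.

Lemma exp_Re_scal_le (y : C) (x : R) : 0 <= x <= 1 -> exp (Re (x * y)%C) <= exp (Cmod y).
Proof.
  intros Hx. apply exp_mono. eapply Rle_trans; [apply Re_le_Cmod|].
  rewrite Cmod_mult, Cmod_R, Rabs_pos_eq by lra. generalize (Cmod_ge_0 y); nra.
Qed.

Lemma Cexp_bound1 (y : C) : Cmod (Cexp y - 1) <= Cmod y * exp (Cmod y).
Proof.
  (* The summand [0] gives the exponent the shape of [Rder_affine]. *)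
  assert (H := Rder_mvt (fun x => Cexp (0 + x * y)) (fun x => y * Cexp (0 + x * y))%C 0 1
     (Cmod y * exp (Cmod y))).
  cbv beta in H. rewrite !Cplus_0_l, Cmult_1_l, Cmult_0_l, Cexp_0 in H.
  eapply Rle_trans; [apply H|]; try lra.
  - intros x _. apply Rder_Cexp, Rder_affine.
  - intros x Hx. rewrite Cmod_mult, Cmod_Cexp, Cplus_0_l.
    apply Rmult_le_compat_l; [apply Cmod_ge_0 | apply exp_Re_scal_le; exact Hx].
Qed.

(** The mean value inequality a second time: the derivative [y * (Cexp (x * y) - 1)] is bounded by
    [Cexp_bound1]. *)
Lemma Cexp_bound2 (y : C) : Cmod (Cexp y - 1 - y) <= Cmod y * Cmod y * exp (Cmod y).
Proof.
  assert (H := Rder_mvt (fun x => Cexp (0 + x * y) - (0 + x * y))%C (fun x => y * Cexp (0 + x * y) - y)%C 0 1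
     (Cmod y * Cmod y * exp (Cmod y))).
  cbv beta in H. rewrite !Cplus_0_l, Cmult_1_l, Cmult_0_l, Cexp_0 in H.
  replace (Cexp y - 1 - y)%C with (Cexp y - y - (1 - 0))%C by ring.
  eapply Rle_trans; [apply H|]; try lra.
  - intros x _. apply Rder_minus; [apply Rder_Cexp, Rder_affine | apply Rder_affine].
  - intros x Hx. rewrite Cplus_0_l.
    replace (y * Cexp (x * y) - y)%C with (y * (Cexp (x * y) - 1))%C by ring.
    rewrite Cmod_mult, Rmult_assoc.
    apply Rmult_le_compat_l; [apply Cmod_ge_0|].
    eapply Rle_trans; [apply Cexp_bound1|].
    rewrite Cmod_mult, Cmod_R, Rabs_pos_eq by lra.
    assert (exp (x * Cmod y) <= exp (Cmod y)) by (apply exp_mono; generalize (Cmod_ge_0 y); nra).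
    generalize (Cmod_ge_0 y) (exp_pos (x * Cmod y)); intros.
    apply Rmult_le_compat; nra.
Qed.

Lemma Cder_eps (f : C -> C) (z l : C) :
  Cder f z l <->
  (forall eps, 0 < eps -> exists del, 0 < del /\ forall h, Cmod h < del ->
     Cmod (f (z + h) - f z - h * l)%C <= eps * Cmod h).
Proof.
  split.
  - intros [L H] eps He.
    specialize (H z (fun P HP => HP) (mkposreal _ He)).
    destruct H as [d Hd]. exists d; split; [apply cond_pos|].
    intros h Hh. specialize (Hd (z + h)%C).
    assert (Hb : @ball (AbsRing_UniformSpace C_AbsRing) z d (z + h)%C).
    { change (Cmod (z + h - z)%C < d). replace (z + h - z)%C with h by ring. exact Hh. }
    specialize (Hd Hb).
    change (Cmod (f (z + h) - f z - (z + h - z) * l)%C <= eps * Cmod (z + h - z)%C) in Hd.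
    replace (z + h - z)%C with h in Hd by ring. exact Hd.
  - intro H. split; [apply is_linear_scal_l|].
    intros y Hy eps.
    assert (y = z) as ->.
    { symmetry. exact (is_filter_lim_locally_unique (K:=C_AbsRing) (V:=AbsRing_NormedModule C_AbsRing) z y Hy). }
    destruct (H eps (cond_pos eps)) as [d [Hd Hh]].
    exists (mkposreal _ Hd). intros x0 Hx. set (x := x0 : C) in *.
    change (Cmod (x - z)%C < d) in Hx. specialize (Hh _ Hx).
    replace (z + (x - z))%C with x in Hh by ring. exact Hh.
Qed.

(* A second-order expansion is the form in which derivatives pass to sums of series. *)
Lemma Cder_of_quadratic (f : C -> C) (z l : C) (K r : R) : 0 < r ->
  (forall h, Cmod h <= r -> Cmod (f (z + h) - f z - h * l)%C <= K * (Cmod h * Cmod h)) ->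
  Cder f z l.
Proof.
  intros Hr H. apply Cder_eps. intros eps He.
  set (K' := Rmax K 1).
  assert (HK : 1 <= K') by apply Rmax_r. assert (HK2 : K <= K') by apply Rmax_l.
  exists (Rmin r (eps / K')). split.
  { apply Rmin_pos; [exact Hr | apply Rdiv_lt_0_compat; lra]. }
  intros h Hh.
  assert (H1 : Cmod h < r) by (eapply Rlt_le_trans; [exact Hh | apply Rmin_l]).
  assert (H2 : Cmod h < eps / K') by (eapply Rlt_le_trans; [exact Hh | apply Rmin_r]).
  eapply Rle_trans; [apply H; lra|].
  assert (Cmod h * K' <= eps).
  { replace eps with (eps / K' * K') by (field; lra). apply Rmult_le_compat_r; lra. }
  generalize (Cmod_ge_0 h). intro. nra.
Qed.

(** * Complex derivatives and boundary integrals of rectangles *)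

(** [C] is a normed module over itself under two names with the same norm. The product rule and the
    inner function of the chain rule use [AbsRing_NormedModule]. *)
Lemma Cder_AbsRing (f : C -> C) (z l : C) :
  Cder f z l <-> @is_derive C_AbsRing (AbsRing_NormedModule C_AbsRing) f z l.
Proof.
  split; intros [L H]; (split; [apply is_linear_scal_l|]); intros y Hy eps; exact (H y Hy eps).
Qed.

Lemma Cder_const (c z : C) : Cder (fun _ => c) z (RtoC 0).
Proof. apply (is_derive_const (K:=C_AbsRing) (V:=C_NormedModule) c z). Qed.

Lemma Cder_id (z : C) : Cder (fun x => x) z (RtoC 1).
Proof.
  apply Cder_of_quadratic with (K := 0) (r := 1); [lra|]. intros h _.
  replace (z + h - z - h * 1)%C with (RtoC 0) by ring. rewrite Cmod_0. lra.
Qed.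

Lemma Cder_plus (f g : C -> C) (z l m : C) :
  Cder f z l -> Cder g z m -> Cder (fun t => f t + g t)%C z (l + m)%C.
Proof. intros H1 H2. apply (is_derive_plus (K:=C_AbsRing) (V:=C_NormedModule) f g z l m H1 H2). Qed.

Lemma Cder_opp (f : C -> C) (z l : C) : Cder f z l -> Cder (fun t => - f t)%C z (- l)%C.
Proof. intros H1. apply (is_derive_opp (K:=C_AbsRing) (V:=C_NormedModule) f z l H1). Qed.

Lemma Cder_minus (f g : C -> C) (z l m : C) :
  Cder f z l -> Cder g z m -> Cder (fun t => f t - g t)%C z (l - m)%C.
Proof. intros H1 H2. apply (is_derive_minus (K:=C_AbsRing) (V:=C_NormedModule) f g z l m H1 H2). Qed.

Lemma Cder_mult (f g : C -> C) (z l m : C) :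
  Cder f z l -> Cder g z m -> Cder (fun t => f t * g t)%C z (l * g z + f z * m)%C.
Proof.
  intros H1%Cder_AbsRing H2%Cder_AbsRing. apply Cder_AbsRing.
  apply (is_derive_mult (K:=C_AbsRing) f g z l m H1 H2). intros n k. apply (Cmult_comm n k).
Qed.

Lemma Cder_ext_val (f : C -> C) (z l l' : C) : l = l' -> Cder f z l -> Cder f z l'.
Proof. intros ->. exact (fun H => H). Qed.

Lemma Cder_comp (f g : C -> C) (z l m : C) :
  Cder f (g z) l -> Cder g z m -> Cder (fun t => f (g t)) z (m * l)%C.
Proof.
  intros H1 H2%Cder_AbsRing.
  apply (is_derive_comp (K:=C_AbsRing) (V:=C_NormedModule) f g z l m H1 H2).
Qed.

Lemma Cder_Cexp (z : C) : Cder Cexp z (Cexp z).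
Proof.
  apply Cder_of_quadratic with (K := Cmod (Cexp z) * exp 1) (r := 1); [lra|].
  intros h Hh. rewrite Cexp_plus.
  replace (Cexp z * Cexp h - Cexp z - h * Cexp z)%C with (Cexp z * (Cexp h - 1 - h))%C by ring.
  rewrite Cmod_mult, Rmult_assoc. apply Rmult_le_compat_l; [apply Cmod_ge_0|].
  eapply Rle_trans; [apply Cexp_bound2|]. rewrite Rmult_comm.
  apply Rmult_le_compat_r; [generalize (Cmod_ge_0 h); nra | apply exp_mono, Hh].
Qed.

Lemma Cder_inv (z : C) : z <> 0 -> Cder (fun t => / t)%C z (- / (z * z))%C.
Proof.
  intro Hz. assert (Hm : 0 < Cmod z) by (apply Cmod_gt_0; exact Hz).
  apply Cder_of_quadratic with (K := 2 / (Cmod z * Cmod z * Cmod z)) (r := Cmod z / 2); [lra|].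
  intros h Hh.
  assert (Hzh : Cmod z / 2 <= Cmod (z + h)).
  { generalize (Cmod_triangle (z + h) (- h)). rewrite Cmod_opp.
    replace (z + h + - h)%C with z by ring. lra. }
  assert (Hn : (z + h)%C <> 0) by (apply Cmod_gt_0; lra).
  replace (/ (z + h) - / z - h * - / (z * z))%C with (h * h * (/ (z * z) * / (z + h)))%C by (field; auto).
  assert (Hzz : (z * z)%C <> 0) by (apply Cmult_neq_0; exact Hz).
  rewrite !Cmod_mult, !Cmod_inv, Cmod_mult by assumption.
  rewrite Rmult_comm. apply Rmult_le_compat_r; [generalize (Cmod_ge_0 h); nra|].
  replace (2 / (Cmod z * Cmod z * Cmod z)) with (/ (Cmod z * Cmod z) * / (Cmod z / 2)) by (field; lra).
  apply Rmult_le_compat_l.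
  - left. apply Rinv_0_lt_compat. nra.
  - apply Rinv_le_contravar; lra.
Qed.

Lemma Cder_div (f g : C -> C) (z l m : C) : g z <> 0 -> Cder f z l -> Cder g z m ->
  exists k, Cder (fun t => f t / g t)%C z k.
Proof.
  intros Hg Hf Hd. eexists. apply Cder_mult; [exact Hf|].
  apply (Cder_comp (fun t => / t)%C g); [apply Cder_inv, Hg | exact Hd].
Qed.

Lemma Ccont_eps (f : C -> C) (z : C) :
  (forall eps, 0 < eps -> exists del, 0 < del /\ forall h, Cmod h < del -> Cmod (f (z + h) - f z)%C < eps) ->
  Ccont f z.
Proof.
  intro H. apply filterlim_locally. intro eps.
  destruct (H eps (cond_pos eps)) as [d [Hd Hh]].
  (* Balls of [C_UniformSpace] are squares; half the radius keeps the modulus below [d]. *)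
  assert (Hd2 : 0 < d / 2) by lra.
  exists (mkposreal _ Hd2). intros y0 Hy. set (y := y0 : C) in *.
  apply C_NormedModule_mixin_compat1.
  assert (Hy2 : Cmod (y - z)%C < d).
  { eapply Rle_lt_trans; [apply Cmod_le_abs|]. destruct Hy as [H1 H2].
    unfold ball in H1, H2; simpl in H1, H2. unfold AbsRing_ball, abs, minus, plus, opp in H1, H2; simpl in H1, H2.
    unfold Re, Im; simpl. lra. }
  specialize (Hh _ Hy2). replace (z + (y - z))%C with y in Hh by ring. exact Hh.
Qed.

Lemma Cder_cont (f : C -> C) (z l : C) : Cder f z l -> Ccont f z.
Proof.
  intro H. apply Ccont_eps. intros eps He.
  destruct (proj1 (Cder_eps f z l) H 1 Rlt_0_1) as [d [Hd Hh]].
  set (K := 2 + Cmod l). assert (HK : 2 <= K) by (unfold K; generalize (Cmod_ge_0 l); lra).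
  exists (Rmin d (eps / K)). split; [apply Rmin_pos; [exact Hd | apply Rdiv_lt_0_compat; lra]|].
  intros h H1.
  assert (H2 : Cmod h < d) by (eapply Rlt_le_trans; [exact H1 | apply Rmin_l]).
  assert (H3 : Cmod h < eps / K) by (eapply Rlt_le_trans; [exact H1 | apply Rmin_r]).
  replace (f (z + h)%C - f z)%C with ((f (z + h)%C - f z - h * l) + h * l)%C by ring.
  eapply Rle_lt_trans; [apply Cmod_triangle|]. rewrite Cmod_mult.
  specialize (Hh h H2).
  assert (Cmod h * K < eps).
  { replace eps with (eps / K * K) by (field; lra). apply Rmult_lt_compat_r; lra. }
  unfold K in *. generalize (Cmod_ge_0 h); nra.
Qed.

Lemma Rcont_hor (f : C -> C) (x y : R) : Ccont f (x, y) -> Rcont (fun t => f (t, y)) x.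
Proof.
  intro H. apply (continuous_comp (fun t : R => (t, y) : C) f x); [|exact H].
  apply (Rder_continuous _ _ (RtoC 1)). apply Rder_pair; simpl.
  - apply is_derive_Reals, derivable_pt_lim_id.
  - apply is_derive_Reals, derivable_pt_lim_const.
Qed.

Lemma Rcont_ver (f : C -> C) (x y : R) : Ccont f (x, y) -> Rcont (fun t => f (x, t)) y.
Proof.
  intro H. apply (continuous_comp (fun t : R => (x, t) : C) f y); [|exact H].
  apply (Rder_continuous _ _ Ci). apply Rder_pair; simpl.
  - apply is_derive_Reals, derivable_pt_lim_const.
  - apply is_derive_Reals, derivable_pt_lim_id.
Qed.

(** * Integrals of complex-valued functions and contour integrals *)

Lemma ex_CInt_cont (f : R -> C) (a b : R) : a <= b ->
  (forall x, a <= x <= b -> Rcont f x) -> ex_CInt f a b.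
Proof.
  intros Hab H. apply (ex_RInt_continuous (V := C_R_CompleteNormedModule)).
  rewrite Rmin_left, Rmax_right by exact Hab. exact H.
Qed.

Lemma CInt_correct (f : R -> C) (a b : R) : ex_CInt f a b -> is_CInt f a b (CInt f a b).
Proof. intro H. apply (RInt_correct (V := C_R_CompleteNormedModule) f a b H). Qed.

Lemma CInt_unique (f : R -> C) (a b : R) (l : C) : is_CInt f a b l -> CInt f a b = l.
Proof. intro H. apply (is_RInt_unique (V := C_R_CompleteNormedModule) f a b l H). Qed.

Lemma CInt_Chasles (f : R -> C) (a b c : R) : a <= b <= c -> ex_CInt f a c ->
  CInt f a c = (CInt f a b + CInt f b c)%C.
Proof.
  intros Hb H. symmetry.
  apply (RInt_Chasles (V := C_R_CompleteNormedModule) f a b c).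
  - apply (ex_RInt_Chasles_1 (V := C_R_CompleteNormedModule) f a b c Hb H).
  - apply (ex_RInt_Chasles_2 (V := C_R_CompleteNormedModule) f a b c Hb H).
Qed.

Lemma CInt_bound (f : R -> C) (a b M : R) : a <= b -> ex_CInt f a b ->
  (forall x, a <= x <= b -> Cmod (f x) <= M) -> Cmod (CInt f a b) <= (b - a) * M.
Proof.
  intros Hab He HM. rewrite <- Cnorm_R.
  apply (norm_RInt_le_const (V := C_R_NormedModule) f a b); [exact Hab | | apply CInt_correct, He].
  intros x Hx. rewrite Cnorm_R. apply HM, Hx.
Qed.

Lemma CInt_minus (f g : R -> C) (a b : R) : ex_CInt f a b -> ex_CInt g a b ->
  CInt (fun x => f x - g x)%C a b = (CInt f a b - CInt g a b)%C.
Proof.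
  intros Hf Hg. apply CInt_unique.
  apply (is_RInt_minus (V := C_R_NormedModule) f g a b); apply CInt_correct; assumption.
Qed.

Lemma is_CInt_ext (f g : R -> C) (a b : R) (l : C) : a <= b ->
  (forall x, a < x < b -> f x = g x) -> is_CInt f a b l -> is_CInt g a b l.
Proof.
  intros Hab H. apply is_RInt_ext. rewrite Rmin_left, Rmax_right by exact Hab. exact H.
Qed.

(** The integral is taken in the real module structure of [C], so a complex factor is distributed
    over the two components. *)
Lemma is_CInt_scal (c : C) (f : R -> C) (a b : R) (l : C) :
  is_CInt f a b l -> is_CInt (fun x => c * f x)%C a b (c * l)%C.
Proof.
  intro H.
  assert (H1 := is_RInt_fct_extend_fst (U := R_NormedModule) (V := R_NormedModule) f a b l H).
  assert (H2 := is_RInt_fct_extend_snd (U := R_NormedModule) (V := R_NormedModule) f a b l H).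
  apply (is_RInt_fct_extend_pair (U := R_NormedModule) (V := R_NormedModule)); simpl.
  - apply (is_RInt_minus (V := R_NormedModule)).
    + apply (is_RInt_scal (V := R_NormedModule) (fun t => fst (f t)) a b (fst c)), H1.
    + apply (is_RInt_scal (V := R_NormedModule) (fun t => snd (f t)) a b (snd c)), H2.
  - apply (is_RInt_plus (V := R_NormedModule)).
    + apply (is_RInt_scal (V := R_NormedModule) (fun t => snd (f t)) a b (fst c)), H2.
    + apply (is_RInt_scal (V := R_NormedModule) (fun t => fst (f t)) a b (snd c)), H1.
Qed.

Lemma CInt_scal (c : C) (f : R -> C) (a b : R) : ex_CInt f a b ->
  CInt (fun x => c * f x)%C a b = (c * CInt f a b)%C.
Proof. intro H. apply CInt_unique, is_CInt_scal, CInt_correct, H. Qed.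

(** The contour integral of [f dz], counterclockwise around [[a, b] x [c, d]]; the factor [Ci] comes
    from [dz = i dy] on the vertical sides. *)
Definition bdry (f : C -> C) (a b c d : R) : C :=
  (CInt (fun x => f (x, c)) a b + Ci * CInt (fun y => f (b, y)) c d
   - CInt (fun x => f (x, d)) a b - Ci * CInt (fun y => f (a, y)) c d)%C.

Definition ex_bdry (f : C -> C) (a b c d : R) : Prop :=
  ex_CInt (fun x => f (x, c)) a b /\ ex_CInt (fun y => f (b, y)) c d /\
  ex_CInt (fun x => f (x, d)) a b /\ ex_CInt (fun y => f (a, y)) c d.

Definition on_bdry (a b c d : R) (z : C) : Prop :=
  a <= Re z <= b /\ c <= Im z <= d /\ (Re z = a \/ Re z = b \/ Im z = c \/ Im z = d).

Definition in_rect (a b c d : R) (z : C) : Prop := a <= Re z <= b /\ c <= Im z <= d.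

Lemma ex_bdry_cont (f : C -> C) (a b c d : R) : a <= b -> c <= d ->
  (forall z, on_bdry a b c d z -> Ccont f z) -> ex_bdry f a b c d.
Proof.
  intros Hab Hcd H. repeat split; apply ex_CInt_cont; try assumption;
  intros x Hx; (apply Rcont_hor || apply Rcont_ver); apply H; unfold on_bdry; simpl; lra.
Qed.

Lemma bdry_bound (f : C -> C) (a b c d M : R) : a <= b -> c <= d -> ex_bdry f a b c d ->
  (forall z, on_bdry a b c d z -> Cmod (f z) <= M) ->
  Cmod (bdry f a b c d) <= 2 * (b - a + (d - c)) * M.
Proof.
  intros Hab Hcd (E1 & E2 & E3 & E4) HM. unfold bdry.
  assert (B1 : Cmod (CInt (fun x => f (x, c)) a b) <= (b - a) * M).
  { apply CInt_bound; try assumption. intros x Hx. apply HM. unfold on_bdry; simpl; lra. }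
  assert (B2 : Cmod (CInt (fun y => f (b, y)) c d) <= (d - c) * M).
  { apply CInt_bound; try assumption. intros x Hx. apply HM. unfold on_bdry; simpl; lra. }
  assert (B3 : Cmod (CInt (fun x => f (x, d)) a b) <= (b - a) * M).
  { apply CInt_bound; try assumption. intros x Hx. apply HM. unfold on_bdry; simpl; lra. }
  assert (B4 : Cmod (CInt (fun y => f (a, y)) c d) <= (d - c) * M).
  { apply CInt_bound; try assumption. intros x Hx. apply HM. unfold on_bdry; simpl; lra. }
  eapply Rle_trans; [apply Cmod_minus_le|]. rewrite Cmod_mult, Cmod_Ci.
  eapply Rle_trans; [apply Rplus_le_compat_r, Cmod_minus_le|].
  eapply Rle_trans; [apply Rplus_le_compat_r, Rplus_le_compat_r, Cmod_triangle|].
  rewrite Cmod_mult, Cmod_Ci. lra.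
Qed.

Lemma bdry_split_h (f : C -> C) (a m b c d : R) : a <= m <= b -> ex_bdry f a b c d ->
  bdry f a b c d = (bdry f a m c d + bdry f m b c d)%C.
Proof.
  intros Hm (E1 & E2 & E3 & E4). unfold bdry.
  rewrite (CInt_Chasles (fun x => f (x, c)) a m b Hm E1).
  rewrite (CInt_Chasles (fun x => f (x, d)) a m b Hm E3). ring.
Qed.

Lemma bdry_split_v (f : C -> C) (a b c m d : R) : c <= m <= d -> ex_bdry f a b c d ->
  bdry f a b c d = (bdry f a b c m + bdry f a b m d)%C.
Proof.
  intros Hm (E1 & E2 & E3 & E4). unfold bdry.
  rewrite (CInt_Chasles (fun x => f (b, x)) c m d Hm E2).
  rewrite (CInt_Chasles (fun x => f (a, x)) c m d Hm E4). ring.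
Qed.

Lemma bdry_minus (f g : C -> C) (a b c d : R) : ex_bdry f a b c d -> ex_bdry g a b c d ->
  bdry (fun z => f z - g z)%C a b c d = (bdry f a b c d - bdry g a b c d)%C.
Proof.
  intros (E1 & E2 & E3 & E4) (F1 & F2 & F3 & F4). unfold bdry.
  rewrite (CInt_minus (fun x => f (x, c)) (fun x => g (x, c))) by assumption.
  rewrite (CInt_minus (fun x => f (x, d)) (fun x => g (x, d))) by assumption.
  rewrite (CInt_minus (fun x => f (a, x)) (fun x => g (a, x))) by assumption.
  rewrite (CInt_minus (fun x => f (b, x)) (fun x => g (b, x))) by assumption.
  ring.
Qed.

Lemma bdry_scal (k : C) (f : C -> C) (a b c d : R) : ex_bdry f a b c d ->
  bdry (fun z => k * f z)%C a b c d = (k * bdry f a b c d)%C.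
Proof.
  intros (E1 & E2 & E3 & E4). unfold bdry.
  rewrite (CInt_scal k (fun x => f (x, c))) by assumption.
  rewrite (CInt_scal k (fun x => f (x, d))) by assumption.
  rewrite (CInt_scal k (fun x => f (a, x))) by assumption.
  rewrite (CInt_scal k (fun x => f (b, x))) by assumption.
  ring.
Qed.

Lemma is_CInt_derive (f df : R -> C) (a b : R) : a <= b ->
  (forall x, a <= x <= b -> Rder f x (df x)) ->
  (forall x, a <= x <= b -> Rcont df x) -> is_CInt df a b (f b - f a)%C.
Proof.
  intros Hab H1 H2.
  apply (is_RInt_derive (V := C_R_CompleteNormedModule) f df a b);
  rewrite Rmin_left, Rmax_right by exact Hab; assumption.
Qed.


(** The primitive [F] turns each side into a difference of corner values, and these cancel around
    the contour. *)
Lemma bdry_affine (al be : C) (a b c d : R) : a <= b -> c <= d ->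
  bdry (fun z => al + be * z)%C a b c d = 0.
Proof.
  intros Hab Hcd.
  set (F := fun z : C => (al * z + be * (z * z) / 2)%C).
  assert (Hh : forall y, CInt (fun x => al + be * (x, y))%C a b = (F (b, y) - F (a, y))%C).
  { intro y. apply CInt_unique. apply (is_CInt_derive (fun x => F (x, y))); [exact Hab | |].
    - intros x _. unfold F.
      assert (D : Rder (fun x => (x, y) : C) x (RtoC 1)).
      { apply Rder_pair; simpl; apply is_derive_Reals; [apply derivable_pt_lim_id | apply derivable_pt_lim_const]. }
      eapply Rder_ext_val; [|apply Rder_plus; [apply Rder_scal_l, D|]].
      2: { apply Rder_mult; [apply Rder_scal_l, Rder_mult; exact D | apply Rder_const]. }
      cbv beta. field.
    - intros x _. apply (Rder_continuous _ x (RtoC 0 + be * RtoC 1)%C).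
      apply Rder_plus; [apply Rder_const|apply Rder_scal_l].
      apply Rder_pair; simpl; apply is_derive_Reals; [apply derivable_pt_lim_id | apply derivable_pt_lim_const]. }
  assert (Hv : forall x, (Ci * CInt (fun y => al + be * (x, y))%C c d = F (x, d) - F (x, c))%C).
  { intro x.
    assert (D : forall y, Rder (fun y => (x, y) : C) y Ci).
    { intro y. apply Rder_pair; simpl; apply is_derive_Reals; [apply derivable_pt_lim_const | apply derivable_pt_lim_id]. }
    assert (Cc : forall y, Rcont (fun y => al + be * (x, y))%C y).
    { intro y. apply (Rder_continuous _ y (RtoC 0 + be * Ci)%C).
      apply Rder_plus; [apply Rder_const|apply Rder_scal_l, D]. }
    rewrite <- CInt_scal by (apply ex_CInt_cont; [exact Hcd | intros; apply Cc]).
    apply CInt_unique. apply (is_CInt_derive (fun y => F (x, y))); [exact Hcd | |].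
    - intros y _. unfold F.
      eapply Rder_ext_val; [|apply Rder_plus; [apply Rder_scal_l, D|]].
      2: { apply Rder_mult; [apply Rder_scal_l, Rder_mult; apply D | apply Rder_const]. }
      cbv beta. field.
    - intros y _. apply (Rder_continuous _ y (Ci * (RtoC 0 + be * Ci))%C).
      apply Rder_scal_l, Rder_plus; [apply Rder_const|apply Rder_scal_l, D]. }
  unfold bdry. rewrite !Hh, !Hv. ring.
Qed.

(** * Goursat's theorem *)

Record rect := Rect { rl : R; rr : R; rb : R; rt : R }.

Definition half_of (Q Q' : rect) : Prop :=
  (rl Q <= rl Q' /\ rr Q' <= rr Q /\ rb Q <= rb Q' /\ rt Q' <= rt Q) /\
  rr Q' - rl Q' = (rr Q - rl Q) / 2 /\ rt Q' - rb Q' = (rt Q - rb Q) / 2.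

Lemma nested_limit (u v : nat -> R) :
  (forall k, u k <= v k) -> (forall k, u k <= u (S k)) -> (forall k, v (S k) <= v k) ->
  exists l, forall k, u k <= l <= v k.
Proof.
  intros H Hu Hv.
  assert (Mu : forall i j, (i <= j)%nat -> u i <= u j).
  { intros i j Hij. induction Hij; [lra|]. generalize (Hu m). lra. }
  assert (Mv : forall i j, (i <= j)%nat -> v j <= v i).
  { intros i j Hij. induction Hij; [lra|]. generalize (Hv m). lra. }
  assert (Huv : forall i j, u i <= v j).
  { intros i j. apply Rle_trans with (u (i + j)%nat); [apply Mu; lia|].
    apply Rle_trans with (v (i + j)%nat); [apply H | apply Mv; lia]. }
  destruct (completeness (fun x => exists k, x = u k)) as [l [Hl1 Hl2]].
  - exists (v O). intros x [k ->]. apply Huv.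
  - exists (u O), O. reflexivity.
  - exists l. intro k. split.
    + apply Hl1. exists k. reflexivity.
    + apply Hl2. intros x [j ->]. apply Huv.
Qed.

Lemma half_pow_small (e c : R) : 0 < e -> exists k, c * (/ 2) ^ k < e.
Proof.
  intros He.
  destruct (pow_lt_1_zero (/ 2) ltac:(rewrite Rabs_pos_eq; lra) (e / (Rabs c + 1))) as [N HN].
  { apply Rdiv_lt_0_compat; [exact He | generalize (Rabs_pos c); lra]. }
  exists N. specialize (HN N (Nat.le_refl _)).
  assert (Hp : 0 < (/ 2) ^ N) by (apply pow_lt; lra).
  rewrite Rabs_pos_eq in HN by lra.
  apply Rle_lt_trans with (Rabs c * (/ 2) ^ N).
  { apply Rmult_le_compat_r; [lra | apply Rle_abs]. }
  assert (HR := Rabs_pos c).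
  assert ((/ 2) ^ N * (Rabs c + 1) < e).
  { replace e with (e / (Rabs c + 1) * (Rabs c + 1)) by (field; lra).
    apply Rmult_lt_compat_r; lra. }
  nra.
Qed.

(* Bisection keeps the aspect ratio, so the halves may be compared with a power of the size. *)
Lemma rect_induction (S : rect -> Prop) (Q0 : rect) : rl Q0 <= rr Q0 -> rb Q0 <= rt Q0 ->
  (forall Q, rl Q <= rr Q -> rb Q <= rt Q -> (forall Q', half_of Q Q' -> S Q') -> S Q) ->
  (forall p q, rl Q0 <= p <= rr Q0 -> rb Q0 <= q <= rt Q0 -> exists del, 0 < del /\
     forall Q, rl Q <= p <= rr Q -> rb Q <= q <= rt Q ->
       rl Q0 <= rl Q -> rr Q <= rr Q0 -> rb Q0 <= rb Q -> rt Q <= rt Q0 ->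
       rr Q - rl Q < del -> rt Q - rb Q < del -> S Q) ->
  S Q0.
Proof.
  intros H1 H2 Hsplit Hloc. apply NNPP. intro Hn.
  set (bad := fun Q => (rl Q <= rr Q /\ rb Q <= rt Q) /\ ~ S Q).
  (* If all halves of a bad rectangle were good, [Hsplit] would make it good. Description turns the
     existence of a bad half into a function that can be iterated. *)
  assert (step : forall Q : {Q | bad Q}, {Q' : {Q' | bad Q'} | half_of (proj1_sig Q) (proj1_sig Q')}).
  { intros [Q [[HQ1 HQ2] HQ]]. apply constructive_indefinite_description.
    apply NNPP. intro Hno. apply HQ. apply Hsplit; try assumption. intros Q' HQ'.
    apply NNPP. intro HS. apply Hno.
    assert (HB : bad Q') by (split; [destruct HQ'; lra | exact HS]).
    exists (exist _ Q' HB). exact HQ'. }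
  set (u := fix u (k : nat) : {Q | bad Q} := match k with
     | O => exist _ Q0 (conj (conj H1 H2) Hn) | Datatypes.S k => proj1_sig (step (u k)) end).
  set (r := fun k => proj1_sig (u k)).
  assert (Hr : forall k, half_of (r k) (r (Datatypes.S k))).
  { intro k. exact (proj2_sig (step (u k))). }
  assert (Hb : forall k, bad (r k)) by (intro k; exact (proj2_sig (u k))).
  destruct (nested_limit (fun k => rl (r k)) (fun k => rr (r k))) as [p Hp].
  { intro k. cbv beta. destruct (Hb k) as [? ?]; lra. }
  { intro k. cbv beta. destruct (Hr k) as [? ?]; lra. }
  { intro k. cbv beta. destruct (Hr k) as [? ?]; lra. }
  destruct (nested_limit (fun k => rb (r k)) (fun k => rt (r k))) as [q Hq].
  { intro k. cbv beta. destruct (Hb k) as [? ?]; lra. }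
  { intro k. cbv beta. destruct (Hr k) as [? ?]; lra. }
  { intro k. cbv beta. destruct (Hr k) as [? ?]; lra. }
  destruct (Hloc p q (Hp O) (Hq O)) as [del [Hd HS]].
  assert (Hsz : forall k, rr (r k) - rl (r k) = (rr Q0 - rl Q0) * (/ 2) ^ k /\
                          rt (r k) - rb (r k) = (rt Q0 - rb Q0) * (/ 2) ^ k).
  { induction k as [|k [I1 I2]]; [change (r O) with Q0; simpl; split; lra|].
    destruct (Hr k) as [_ [A B]]. rewrite A, B, I1, I2. simpl. split; lra. }
  assert (Hin : forall k, rl Q0 <= rl (r k) /\ rr (r k) <= rr Q0 /\ rb Q0 <= rb (r k) /\ rt (r k) <= rt Q0).
  { induction k as [|k IH]; [change (r O) with Q0; repeat split; lra|]. destruct (Hr k) as [A _]. repeat split; lra. }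
  destruct (half_pow_small del ((rr Q0 - rl Q0) + (rt Q0 - rb Q0)) Hd) as [k Hk].
  destruct (Hb k) as [_ HB]. apply HB.
  destruct (Hsz k) as [Z1 Z2]. destruct (Hin k) as (N1 & N2 & N3 & N4).
  assert (0 < (/ 2) ^ k) by (apply pow_lt; lra).
  apply HS; try assumption; [apply Hp | apply Hq | |]; rewrite ?Z1, ?Z2; nra.
Qed.

Lemma bdry_quarter (f : C -> C) (a b c d e : R) : a <= b -> c <= d ->
  (forall z, in_rect a b c d z -> Ccont f z) ->
  (forall a' b' c' d', a <= a' -> b' <= b -> c <= c' -> d' <= d ->
     b' - a' = (b - a) / 2 -> d' - c' = (d - c) / 2 -> Cmod (bdry f a' b' c' d') <= e) ->
  Cmod (bdry f a b c d) <= 4 * e.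
Proof.
  intros Hab Hcd Hf He.
  assert (Ex : forall a' b' c' d', a <= a' -> a' <= b' -> b' <= b -> c <= c' -> c' <= d' -> d' <= d ->
    ex_bdry f a' b' c' d').
  { intros. apply ex_bdry_cont; try assumption. intros z [Hz1 [Hz2 _]]. apply Hf. split; lra. }
  rewrite (bdry_split_h f a ((a + b) / 2) b c d) by (try apply Ex; lra).
  rewrite (bdry_split_v f a ((a + b) / 2) c ((c + d) / 2) d) by (try apply Ex; lra).
  rewrite (bdry_split_v f ((a + b) / 2) b c ((c + d) / 2) d) by (try apply Ex; lra).
  eapply Rle_trans; [apply Cmod_triangle|].
  eapply Rle_trans; [apply Rplus_le_compat; apply Cmod_triangle|].
  assert (A1 := He a ((a + b) / 2) c ((c + d) / 2)). assert (A2 := He a ((a + b) / 2) ((c + d) / 2) d).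
  assert (A3 := He ((a + b) / 2) b c ((c + d) / 2)). assert (A4 := He ((a + b) / 2) b ((c + d) / 2) d).
  lra.
Qed.

(** The bound [e' * size^2] passes from the quarters to the whole, because four pieces compensate a
    squared size divided by four. On small rectangles it follows from differentiability, since the
    affine part of [f] contributes nothing. *)
Lemma goursat (f : C -> C) (a b c d : R) : a <= b -> c <= d ->
  (forall z, in_rect a b c d z -> exists l, Cder f z l) -> bdry f a b c d = 0.
Proof.
  intros Hab Hcd Hf.
  assert (Hc : forall z, in_rect a b c d z -> Ccont f z).
  { intros z Hz. destruct (Hf z Hz) as [l Hl]. apply (Cder_cont f z l Hl). }
  apply Cmod_eq_0. apply Rle_antisym; [|apply Cmod_ge_0].
  apply le_epsilon. intros e He. rewrite Rplus_0_l.
  set (sz := b - a + (d - c)).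
  (* The [1] keeps the denominator positive when the rectangle is a point. *)
  set (e' := e / (sz * sz + 1)).
  assert (Hs : 0 < sz * sz + 1) by nra.
  assert (He' : 0 < e') by (apply Rdiv_lt_0_compat; assumption).
  apply Rle_trans with (e' * (sz * sz)).
  2: { apply Rle_trans with (e' * (sz * sz + 1)); [nra|]. right. unfold e'. field. lra. }
  assert (G := rect_induction (fun Q => a <= rl Q -> rr Q <= b -> c <= rb Q -> rt Q <= d ->
     Cmod (bdry f (rl Q) (rr Q) (rb Q) (rt Q)) <=
      e' * ((rr Q - rl Q + (rt Q - rb Q)) * (rr Q - rl Q + (rt Q - rb Q)))) (Rect a b c d)).
  simpl in G. apply G; try assumption; try lra; clear G.
  - intros Q HQ1 HQ2 IH HQa HQb HQc HQd.
    set (s := rr Q - rl Q + (rt Q - rb Q)) in *.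
    replace (e' * (s * s)) with (4 * (e' * (s * s) / 4)) by field.
    apply bdry_quarter; try assumption.
    { intros z [Hz1 Hz2]. apply Hc. split; lra. }
    intros a' b' c' d' I1 I2 I3 I4 I5 I6.
    specialize (IH (Rect a' b' c' d')). simpl in IH.
    eapply Rle_trans; [apply IH; try lra|].
    + unfold half_of; simpl. repeat split; lra.
    + rewrite I5, I6. right. unfold s. field.
  - intros p q Hp Hq.
    destruct (Hf (p, q)) as [l Hl]; [split; assumption|].
    destruct (proj1 (Cder_eps f (p, q) l) Hl (e' / 2)) as [del [Hdel Hh]]; [lra|].
    exists (del / 2). split; [lra|].
    intros Q HpQ HqQ _ _ _ _ Hd1 Hd2 HQa HQb HQc HQd.
    set (s := rr Q - rl Q + (rt Q - rb Q)).
    set (A := fun z : C => (f (p, q) - l * (p, q) + l * z)%C).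
    assert (EA : ex_bdry A (rl Q) (rr Q) (rb Q) (rt Q)).
    { apply ex_bdry_cont; try lra. intros z _.
      apply (Cder_cont A z (RtoC 0 + (RtoC 0 * z + l * RtoC 1))%C). unfold A.
      apply Cder_plus; [apply Cder_const|]. apply (Cder_mult (fun _ => l) (fun z => z)); [apply Cder_const | apply Cder_id]. }
    assert (EF : ex_bdry f (rl Q) (rr Q) (rb Q) (rt Q)).
    { apply ex_bdry_cont; try lra. intros z (Hz1 & Hz2 & _). apply Hc. split; lra. }
    assert (E : bdry f (rl Q) (rr Q) (rb Q) (rt Q) = bdry (fun z => f z - A z)%C (rl Q) (rr Q) (rb Q) (rt Q)).
    { rewrite bdry_minus by assumption. unfold A at 1. rewrite bdry_affine by lra. ring. }
    rewrite E.
    (* The perimeter is [2 * s], which is why [e' / 2] was asked of the derivative. *)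
    eapply Rle_trans; [apply (bdry_bound _ _ _ _ _ (e' / 2 * s)); try lra|].
    + apply ex_bdry_cont; try lra. intros z (Hz1 & Hz2 & _).
      destruct (Hf z) as [m Hm]; [split; lra|].
      apply (Cder_cont _ z (m - (RtoC 0 + (RtoC 0 * z + l * RtoC 1)))%C).
      apply Cder_minus; [exact Hm|]. unfold A.
      apply Cder_plus; [apply Cder_const|]. apply (Cder_mult (fun _ => l) (fun z => z)); [apply Cder_const | apply Cder_id].
    + intros z (Hz1 & Hz2 & _).
      assert (Hz : Cmod (z - (p, q)) <= s).
      { eapply Rle_trans; [apply Cmod_le_abs|]. unfold s. destruct z as [z1 z2]; simpl in *.
        unfold Re, Im in *; simpl in *. apply Rplus_le_compat; apply Rabs_le; lra. }
      assert (Hz' : Cmod (z - (p, q)) < del) by (unfold s in Hz; lra).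
      specialize (Hh _ Hz').
      replace ((p, q) + (z - (p, q)))%C with z in Hh by ring.
      replace (f z - A z)%C with (f z - f (p, q) - (z - (p, q)) * l)%C by (unfold A; ring).
      eapply Rle_trans; [exact Hh|]. apply Rmult_le_compat_l; lra.
    + right. unfold s. field.
Qed.

(* The point [w] may be cut out by a small square, on whose boundary the integral tends to [0]. *)
Lemma goursat_punctured (g : C -> C) (w : C) (a b c d M r : R) :
  a < Re w < b -> c < Im w < d -> 0 < r ->
  (forall z, in_rect a b c d z -> z <> w -> exists l, Cder g z l) ->
  (forall z, z <> w -> Cmod (z - w) < r -> Cmod (g z) <= M) ->
  bdry g a b c d = 0.
Proof.
  intros Hx Hy Hr Hg HM.
  destruct w as [x y]; simpl in Hx, Hy.
  assert (Hc : forall z, in_rect a b c d z -> z <> (x, y) -> Ccont g z).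
  { intros z Hz Hn. destruct (Hg z Hz Hn) as [l Hl]. apply (Cder_cont g z l Hl). }
  assert (M0 : 0 <= M).
  { apply Rle_trans with (Cmod (g ((x + r / 2)%R, y))); [apply Cmod_ge_0|]. apply HM.
    - intro E; injection E; lra.
    - replace ((((x + r / 2)%R, y) : C) - (x, y))%C with (RtoC (r / 2)) by (unfold RtoC, Cminus, Cplus, Copp; simpl; f_equal; ring).
      rewrite Cmod_R, Rabs_pos_eq; lra. }
  apply Cmod_eq_0. apply Rle_antisym; [|apply Cmod_ge_0].
  apply le_epsilon. intros e He. rewrite Rplus_0_l.
  (* The side of the square: it fits into the rectangle, stays in the disc where [M] bounds [g], and
     makes the boundary contribution [4 * h * M] smaller than [e]. *)
  set (h := Rmin (Rmin (x - a) (b - x)) (Rmin (Rmin (y - c) (d - y)) (Rmin (r / 4) (e / (8 * (M + 1)))))).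
  assert (He1 : 0 < e / (8 * (M + 1))) by (apply Rdiv_lt_0_compat; lra).
  assert (Hh : 0 < h) by (unfold h; repeat apply Rmin_pos; lra).
  assert (L1 : h <= x - a) by (unfold h; eapply Rle_trans; [apply Rmin_l | apply Rmin_l]).
  assert (L2 : h <= b - x) by (unfold h; eapply Rle_trans; [apply Rmin_l | apply Rmin_r]).
  assert (L3 : h <= y - c) by (unfold h; eapply Rle_trans; [apply Rmin_r | eapply Rle_trans; [apply Rmin_l | apply Rmin_l]]).
  assert (L4 : h <= d - y) by (unfold h; eapply Rle_trans; [apply Rmin_r | eapply Rle_trans; [apply Rmin_l | apply Rmin_r]]).
  assert (L5 : h <= r / 4) by (unfold h; eapply Rle_trans; [apply Rmin_r | eapply Rle_trans; [apply Rmin_r | apply Rmin_l]]).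
  assert (L6 : h <= e / (8 * (M + 1))) by (unfold h; eapply Rle_trans; [apply Rmin_r | eapply Rle_trans; [apply Rmin_r | apply Rmin_r]]).
  assert (Ex : forall a' b' c' d', a <= a' -> a' <= b' -> b' <= b -> c <= c' -> c' <= d' -> d' <= d ->
    (x <> a' /\ x <> b' /\ y <> c' /\ y <> d') -> ex_bdry g a' b' c' d').
  { intros. apply ex_bdry_cont; try assumption. intros z (Hz1 & Hz2 & Hz3). apply Hc.
    - split; lra.
    - intros ->. simpl in Hz3. lra. }
  assert (Zero : forall a' b' c' d', a <= a' -> a' <= b' -> b' <= b -> c <= c' -> c' <= d' -> d' <= d ->
    (x < a' \/ b' < x \/ y < c' \/ d' < y) -> bdry g a' b' c' d' = 0).
  { intros. apply goursat; try assumption. intros z [Hz1 Hz2]. apply Hg.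
    - split; lra.
    - intros ->. simpl in Hz1, Hz2. lra. }
  rewrite (bdry_split_h g a (x - h / 2) b c d) by (try apply Ex; lra).
  rewrite (Zero a (x - h / 2)) by lra.
  rewrite (bdry_split_h g (x - h / 2) (x + h / 2) b c d) by (try apply Ex; lra).
  rewrite (Zero (x + h / 2) b) by lra.
  rewrite (bdry_split_v g (x - h / 2) (x + h / 2) c (y - h / 2) d) by (try apply Ex; lra).
  rewrite (Zero _ _ c (y - h / 2)) by lra.
  rewrite (bdry_split_v g (x - h / 2) (x + h / 2) (y - h / 2) (y + h / 2) d) by (try apply Ex; lra).
  rewrite (Zero _ _ (y + h / 2) d) by lra.
  rewrite !Cplus_0_l, !Cplus_0_r.
  eapply Rle_trans; [apply (bdry_bound _ _ _ _ _ M); try lra|].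
  - apply Ex; lra.
  - intros z (Hz1 & Hz2 & Hz3). apply HM.
    + intros ->. simpl in Hz3. lra.
    + eapply Rle_lt_trans; [apply Cmod_le_abs|]. apply Rle_lt_trans with (h / 2 + h / 2); [|lra].
      destruct z as [z1 z2]; unfold Re, Im in *; simpl in *.
      apply Rplus_le_compat; apply Rabs_le; lra.
  - apply Rle_trans with (8 * (M + 1) * h); [nra|].
    apply Rle_trans with (8 * (M + 1) * (e / (8 * (M + 1)))); [apply Rmult_le_compat_l; lra | right; field; lra].
Qed.

(** * Unique continuation *)

Lemma Re_CInt (f : R -> C) (a b : R) : ex_CInt f a b -> Re (CInt f a b) = RInt (fun x => Re (f x)) a b.
Proof.
  intro H. symmetry. apply (is_RInt_unique (V := R_CompleteNormedModule)).
  apply (is_RInt_fct_extend_fst (U := R_NormedModule) (V := R_NormedModule) f), CInt_correct, H.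
Qed.

Lemma Im_CInt (f : R -> C) (a b : R) : ex_CInt f a b -> Im (CInt f a b) = RInt (fun x => Im (f x)) a b.
Proof.
  intro H. symmetry. apply (is_RInt_unique (V := R_CompleteNormedModule)).
  apply (is_RInt_fct_extend_snd (U := R_NormedModule) (V := R_NormedModule) f), CInt_correct, H.
Qed.

Lemma Rcont_Re (f : R -> C) (x : R) : Rcont f x -> continuous (fun t => Re (f t)) x.
Proof. intro H. apply (continuous_comp f (fun z : C => fst z)); [exact H | apply continuous_fst]. Qed.

Lemma Rcont_Im (f : R -> C) (x : R) : Rcont f x -> continuous (fun t => Im (f t)) x.
Proof. intro H. apply (continuous_comp f (fun z : C => snd z)); [exact H | apply continuous_snd]. Qed.

Lemma minus_neq_0 (z w : C) : z <> w -> (z - w)%C <> 0.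
Proof. intros H E. apply H. replace z with (z - w + w)%C by ring. rewrite E. ring. Qed.

Lemma on_bdry_neq (a b c d : R) (w z : C) :
  a < Re w < b -> c < Im w < d -> on_bdry a b c d z -> z <> w.
Proof. intros H1 H2 (Hz1 & Hz2 & Hz3) ->. lra. Qed.

Lemma Cder_shift (w z : C) : Cder (fun z => z - w)%C z (RtoC 1).
Proof.
  eapply Cder_ext_val; [|apply Cder_minus; [apply Cder_id | apply Cder_const]]. ring.
Qed.

Lemma ex_Cder_div_shift (f : C -> C) (w z : C) : z <> w -> (exists l, Cder f z l) ->
  exists l, Cder (fun z => f z / (z - w))%C z l.
Proof.
  intros Hz [l Hl]. apply (Cder_div f (fun z => z - w)%C z l (RtoC 1)).
  - apply minus_neq_0, Hz.
  - exact Hl.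
  - apply Cder_shift.
Qed.

Lemma ex_bdry_div_shift (f : C -> C) (w : C) (a b c d : R) :
  a < Re w < b -> c < Im w < d -> (forall z, in_rect a b c d z -> exists l, Cder f z l) ->
  ex_bdry (fun z => f z / (z - w))%C a b c d.
Proof.
  intros Hx Hy Hf. apply ex_bdry_cont; try lra. intros z Hz.
  destruct (ex_Cder_div_shift f w z) as [l Hl].
  - apply (on_bdry_neq a b c d); assumption.
  - apply Hf. destruct Hz as (H1 & H2 & _). split; assumption.
  - apply (Cder_cont _ z l Hl).
Qed.

(** The difference quotient of [f] at [w] is bounded near [w] by [1 + |f'(w)|], so its integral
    vanishes by [goursat_punctured]. The integral of [1 / (z - w)] is left unevaluated;
    [winding_neq_0] is the property of it that serves later. *)
Lemma cauchy_formula (f : C -> C) (w : C) (a b c d : R) :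
  a < Re w < b -> c < Im w < d -> (forall z, in_rect a b c d z -> exists l, Cder f z l) ->
  bdry (fun z => f z / (z - w))%C a b c d = (f w * bdry (fun z => 1 / (z - w))%C a b c d)%C.
Proof.
  intros Hx Hy Hf.
  assert (E1 := ex_bdry_div_shift f w a b c d Hx Hy Hf).
  assert (E2 : ex_bdry (fun z => 1 / (z - w))%C a b c d).
  { apply (ex_bdry_div_shift (fun _ => RtoC 1)); try assumption. intros z _. eexists. apply Cder_const. }
  assert (E3 : ex_bdry (fun z => f w * (1 / (z - w)))%C a b c d).
  { apply ex_bdry_cont; try lra. intros z Hz.
    destruct (ex_Cder_div_shift (fun _ => RtoC 1) w z) as [l Hl].
    - apply (on_bdry_neq a b c d); assumption.
    - eexists. apply Cder_const.
    - eapply Cder_cont. apply Cder_mult; [apply Cder_const | exact Hl]. }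
  assert (Z : bdry (fun z => f z / (z - w) - f w * (1 / (z - w)))%C a b c d = 0).
  { destruct (Hf w) as [l Hl]; [split; lra|].
    destruct (proj1 (Cder_eps f w l) Hl 1 Rlt_0_1) as [r [Hr Hh]].
    apply (goursat_punctured _ w a b c d (1 + Cmod l) r); try assumption.
    - intros z Hz Hn.
      destruct (ex_Cder_div_shift f w z Hn (Hf z Hz)) as [l1 Hl1].
      destruct (ex_Cder_div_shift (fun _ => RtoC 1) w z Hn) as [l2 Hl2]; [eexists; apply Cder_const|].
      eexists. apply Cder_minus; [exact Hl1 | apply Cder_mult; [apply Cder_const | exact Hl2]].
    - intros z Hn Hz. specialize (Hh _ Hz).
      replace (w + (z - w))%C with z in Hh by ring.
      assert (Hn' := minus_neq_0 z w Hn).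
      replace (f z / (z - w) - f w * (1 / (z - w)))%C with ((f z - f w) / (z - w))%C by (field; exact Hn').
      rewrite Cmod_div by exact Hn'.
      assert (Hp : 0 < Cmod (z - w)) by (apply Cmod_gt_0; exact Hn').
      apply Rmult_le_reg_r with (Cmod (z - w)); [exact Hp|].
      unfold Rdiv. rewrite Rmult_assoc, Rinv_l, Rmult_1_r by lra.
      replace (f z - f w)%C with (f z - f w - (z - w) * l + (z - w) * l)%C by ring.
      eapply Rle_trans; [apply Cmod_triangle|]. rewrite (Cmod_mult (z - w)). lra. }
  rewrite bdry_minus, bdry_scal in Z by assumption.
  transitivity (bdry (fun z => f z / (z - w))%C a b c d - f w * bdry (fun z => 1 / (z - w))%C a b c d
    + f w * bdry (fun z => 1 / (z - w))%C a b c d)%C; [ring|].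
  rewrite Z. ring.
Qed.

(** The imaginary part is a sum of four real integrals, one for each side, and each integrand is
    positive because [w] lies strictly inside. *)
Lemma winding_neq_0 (w : C) (a b c d : R) :
  a < Re w < b -> c < Im w < d -> bdry (fun z => 1 / (z - w))%C a b c d <> 0.
Proof.
  intros Hx Hy.
  assert (E2 : ex_bdry (fun z => 1 / (z - w))%C a b c d).
  { apply (ex_bdry_div_shift (fun _ => RtoC 1)); try assumption. intros z _. eexists. apply Cder_const. }
  assert (Hc : forall z, on_bdry a b c d z -> Ccont (fun z => 1 / (z - w))%C z).
  { intros z Hz. destruct (ex_Cder_div_shift (fun _ => RtoC 1) w z) as [l Hl].
    - apply (on_bdry_neq a b c d); assumption.
    - eexists. apply Cder_const.
    - apply (Cder_cont _ z l Hl). }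
  intro E0. apply (f_equal Im) in E0. destruct E2 as (F1 & F2 & F3 & F4).
  assert (E : Im (bdry (fun z => 1 / (z - w))%C a b c d) =
    RInt (fun x => Im (1 / ((x, c) - w))%C) a b + RInt (fun y => Re (1 / ((b, y) - w))%C) c d
    + RInt (fun x => - Im (1 / ((x, d) - w))%C) a b + RInt (fun y => - Re (1 / ((a, y) - w))%C) c d).
  { rewrite (RInt_opp (V := R_CompleteNormedModule) (fun x => Im (1 / ((x, d) - w))%C)).
    2: { destruct F3 as [l Hl]. exists (snd l).
         apply (is_RInt_fct_extend_snd (U := R_NormedModule) (V := R_NormedModule) _ _ _ _ Hl). }
    rewrite (RInt_opp (V := R_CompleteNormedModule) (fun x => Re (1 / ((a, x) - w))%C)).
    2: { destruct F4 as [l Hl]. exists (fst l).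
         apply (is_RInt_fct_extend_fst (U := R_NormedModule) (V := R_NormedModule) _ _ _ _ Hl). }
    rewrite <- !Re_CInt, <- !Im_CInt by assumption.
    unfold bdry. set (I1 := CInt _ a b). set (I2 := CInt _ c d). set (I3 := CInt _ a b). set (I4 := CInt _ c d).
    unfold opp; simpl. unfold Re, Im. ring. }
  rewrite E in E0. clear E. change (Im 0) with 0 in E0.
  destruct w as [x0 y0]; simpl in Hx, Hy.
  assert (SQ : forall p q, p <> 0 \/ q <> 0 -> 0 < p * p + q * q).
  { intros p q [Hp | Hp]; generalize (Rle_0_sqr p) (Rle_0_sqr q) (Rsqr_pos_lt _ Hp); unfold Rsqr; lra. }
  assert (P : forall x y, (x - x0) * (x - x0) + (y - y0) * (y - y0) > 0 ->
     Im (1 / ((x, y) - (x0, y0)))%C = - (y - y0) / ((x - x0) * (x - x0) + (y - y0) * (y - y0)) /\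
     Re (1 / ((x, y) - (x0, y0)))%C = (x - x0) / ((x - x0) * (x - x0) + (y - y0) * (y - y0))).
  { intros x y Hp. unfold Cdiv, Cinv, Cminus, Cmult, Cplus, Copp; simpl. split; field; lra. }
  assert (P1 : 0 < RInt (fun x => Im (1 / ((x, c) - (x0, y0)))%C) a b).
  { apply RInt_gt_0; [lra | |].
    - intros x Hxx. assert (Q := SQ (x - x0) (c - y0) ltac:(lra)). destruct (P x c) as [-> _]; [lra|]. apply Rdiv_lt_0_compat; lra.
    - intros x Hxx. apply Rcont_Im, (Rcont_hor (fun z => 1 / (z - (x0, y0)))%C), Hc. unfold on_bdry; simpl; lra. }
  assert (P2 : 0 < RInt (fun y => Re (1 / ((b, y) - (x0, y0)))%C) c d).
  { apply RInt_gt_0; [lra | |].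
    - intros x Hxx. assert (Q := SQ (b - x0) (x - y0) ltac:(lra)). destruct (P b x) as [_ ->]; [lra|]. apply Rdiv_lt_0_compat; lra.
    - intros x Hxx. apply Rcont_Re, (Rcont_ver (fun z => 1 / (z - (x0, y0)))%C), Hc. unfold on_bdry; simpl; lra. }
  assert (P3 : 0 < RInt (fun x => - Im (1 / ((x, d) - (x0, y0)))%C) a b).
  { apply RInt_gt_0; [lra | |].
    - intros x Hxx. assert (Q := SQ (x - x0) (d - y0) ltac:(lra)). destruct (P x d) as [-> _]; [lra|].
      replace (- (- (d - y0) / ((x - x0) * (x - x0) + (d - y0) * (d - y0))))
       with ((d - y0) / ((x - x0) * (x - x0) + (d - y0) * (d - y0))) by (field; lra).
      apply Rdiv_lt_0_compat; lra.
    - intros x Hxx. apply (continuous_opp (V := R_NormedModule)).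
      apply Rcont_Im, (Rcont_hor (fun z => 1 / (z - (x0, y0)))%C), Hc. unfold on_bdry; simpl; lra. }
  assert (P4 : 0 < RInt (fun y => - Re (1 / ((a, y) - (x0, y0)))%C) c d).
  { apply RInt_gt_0; [lra | |].
    - intros x Hxx. assert (Q := SQ (a - x0) (x - y0) ltac:(lra)). destruct (P a x) as [_ ->]; [lra|].
      replace (- ((a - x0) / ((a - x0) * (a - x0) + (x - y0) * (x - y0))))
       with ((x0 - a) / ((a - x0) * (a - x0) + (x - y0) * (x - y0))) by (field; lra).
      apply Rdiv_lt_0_compat; lra.
    - intros x Hxx. apply (continuous_opp (V := R_NormedModule)).
      apply Rcont_Re, (Rcont_ver (fun z => 1 / (z - (x0, y0)))%C), Hc. unfold on_bdry; simpl; lra. }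
  lra.
Qed.

Lemma Rcont_bounded (f : R -> C) (a b : R) : a <= b -> (forall x, a <= x <= b -> Rcont f x) ->
  exists M, 0 <= M /\ forall x, a <= x <= b -> Cmod (f x) <= M.
Proof.
  intros Hab H.
  destruct (bounded_continuity (V := C_R_NormedModule) f a b H) as [M HM].
  exists M. split.
  - apply Rle_trans with (Cmod (f a)); [apply Cmod_ge_0|]. rewrite <- Cnorm_R. left. apply HM. lra.
  - intros x Hx. rewrite <- Cnorm_R. left. apply HM, Hx.
Qed.

Lemma bdry_bounded (f : C -> C) (a b c d : R) : a <= b -> c <= d ->
  (forall z, on_bdry a b c d z -> Ccont f z) ->
  exists M, 0 <= M /\ forall z, on_bdry a b c d z -> Cmod (f z) <= M.
Proof.
  intros Hab Hcd H.
  destruct (Rcont_bounded (fun x => f (x, c)) a b Hab) as [M1 [N1 H1]].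
  { intros x Hx. apply Rcont_hor, H. unfold on_bdry; simpl; lra. }
  destruct (Rcont_bounded (fun x => f (x, d)) a b Hab) as [M2 [N2 H2]].
  { intros x Hx. apply Rcont_hor, H. unfold on_bdry; simpl; lra. }
  destruct (Rcont_bounded (fun x => f (a, x)) c d Hcd) as [M3 [N3 H3]].
  { intros x Hx. apply Rcont_ver, H. unfold on_bdry; simpl; lra. }
  destruct (Rcont_bounded (fun x => f (b, x)) c d Hcd) as [M4 [N4 H4]].
  { intros x Hx. apply Rcont_ver, H. unfold on_bdry; simpl; lra. }
  exists (M1 + M2 + M3 + M4). split; [lra|].
  intros [x y] (Hx & Hy & [E | [E | [E | E]]]); simpl in *; subst.
  - specialize (H3 y Hy). lra.
  - specialize (H4 y Hy). lra.
  - specialize (H1 x Hx). lra.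
  - specialize (H2 x Hx). lra.
Qed.

Lemma exp_growth_zero (x A K : R) : 0 <= x -> 0 < A ->
  (forall N : nat, x * exp (INR N * A) <= K) -> x = 0.
Proof.
  intros Hx HA H. destruct Hx as [Hx | Hx]; [exfalso | auto].
  destruct (INR_unbounded (K / (x * A))) as [N HN].
  specialize (H N).
  assert (E := exp_ineq1_le (INR N * A)).
  assert (HxA : 0 < x * A) by nra.
  assert (K < INR N * (x * A)).
  { replace K with (K / (x * A) * (x * A)) by (field; nra). apply Rmult_lt_compat_r; assumption. }
  nra.
Qed.

(* The weight [exp (N e^(kappa (z - i y0)))] has modulus [1] on the two horizontal sides,
   and as [N] grows it favours [w] over the left side. *)
Lemma unique_continuation (h : C -> C) (a b y0 H x : R) :
  0 < H -> a < x < b ->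
  (forall z, in_rect a b (y0 - H) (y0 + H) z -> exists l, Cder h z l) ->
  (forall y, y0 - H <= y <= y0 + H -> h (b, y) = 0) ->
  h (x, y0) = 0.
Proof.
  intros HH Hx Hh Hz.
  set (c := y0 - H). set (d := y0 + H). set (w := (x, y0) : C).
  assert (Hwx : a < Re w < b) by (simpl; lra).
  assert (Hwy : c < Im w < d) by (unfold c, d; simpl; lra).
  (* On the horizontal sides [kap * (Im z - y0)] is then [PI / 2] up to sign, where the real part of
     [wgt] vanishes. *)
  set (kap := PI / 2 / H).
  assert (Hk : 0 < kap) by (unfold kap; generalize PI_RGT_0; intro; apply Rdiv_lt_0_compat; lra).
  set (wgt := fun z : C => Cexp (kap * (z - y0 * Ci))%C).
  assert (Hphi : forall z, exists l, Cder wgt z l).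
  { intro z. eexists. apply (Cder_comp Cexp (fun z => kap * (z - y0 * Ci))%C); [apply Cder_Cexp|].
    apply Cder_mult; [apply Cder_const | apply Cder_shift]. }
  assert (Rphi : forall z, Re (wgt z) = exp (kap * Re z) * cos (kap * (Im z - y0))).
  { intros [z1 z2]. unfold wgt, Cexp, Ci, RtoC, Cmult, Cminus, Cplus, Copp; simpl. f_equal; f_equal; ring. }
  set (A0 := exp (kap * a)). set (A1 := exp (kap * x)).
  assert (HA : A0 < A1) by (apply exp_increasing; nra).
  assert (HA0 : 0 < A0) by apply exp_pos.
  destruct (bdry_bounded (fun z => h z / (z - w))%C a b c d) as [B [HB0 HB]]; try (unfold c, d; lra).
  { intros z Hzb. destruct (ex_Cder_div_shift h w z) as [l Hl].
    - apply (on_bdry_neq a b c d); assumption.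
    - apply Hh. destruct Hzb as (? & ? & _); split; assumption.
    - apply (Cder_cont _ z l Hl). }
  set (W := bdry (fun z => 1 / (z - w))%C a b c d).
  assert (HW : 0 < Cmod W) by (apply Cmod_gt_0, winding_neq_0; assumption).
  assert (Main : Cmod (h w) * Cmod W = 0).
  { apply (exp_growth_zero _ (A1 - A0) (2 * (b - a + (d - c)) * B)).
    - apply Rmult_le_pos; apply Cmod_ge_0.
    - lra.
    - intro N.
      set (G := fun z => (h z * Cexp (INR N * wgt z))%C).
      assert (HG : forall z, in_rect a b c d z -> exists l, Cder G z l).
      { intros z Hin. destruct (Hh z Hin) as [l1 Hl1]. destruct (Hphi z) as [l2 Hl2].
        eexists. apply Cder_mult; [exact Hl1|].
        apply (Cder_comp Cexp (fun z => INR N * wgt z)%C); [apply Cder_Cexp|].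
        apply Cder_mult; [apply Cder_const | exact Hl2]. }
      assert (CF := cauchy_formula G w a b c d Hwx Hwy HG). fold W in CF.
      assert (CB : Cmod (bdry (fun z => G z / (z - w))%C a b c d) <= 2 * (b - a + (d - c)) * (B * exp (INR N * A0))).
      { apply bdry_bound; try (unfold c, d; lra).
        - apply ex_bdry_div_shift; assumption.
        - intros z Hzb. unfold G.
          replace (h z * Cexp (INR N * wgt z) / (z - w))%C with (h z / (z - w) * Cexp (INR N * wgt z))%C
            by (unfold Cdiv; ring).
          destruct (Req_dec (Re z) b) as [Eb | Nb].
          + destruct z as [z1 z2]; simpl in Eb; subst z1. rewrite Hz by (destruct Hzb as (_ & ? & _); exact H0).
            unfold Cdiv. rewrite !Cmult_0_l, Cmod_0. apply Rmult_le_pos; [exact HB0 | left; apply exp_pos].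
          + rewrite Cmod_mult. apply Rmult_le_compat; try apply Cmod_ge_0; [apply HB, Hzb|].
            rewrite Cmod_Cexp. apply exp_mono.
            replace (Re (INR N * wgt z)%C) with (INR N * Re (wgt z)) by (simpl; unfold Re; ring).
            apply Rmult_le_compat_l; [apply pos_INR|]. rewrite Rphi.
            destruct Hzb as (_ & _ & [E | [E | [E | E]]]).
            * rewrite E. fold A0. generalize (COS_bound (kap * (Im z - y0))). nra.
            * contradiction.
            * rewrite E. replace (kap * (c - y0)) with (- (PI / 2)) by (unfold kap, c; field; lra).
              rewrite cos_neg, cos_PI2. lra.
            * rewrite E. replace (kap * (d - y0)) with (PI / 2) by (unfold kap, d; field; lra).
              rewrite cos_PI2. lra. }
      (* This reads [|h w| |W| e^(N A1) <= C e^(N A0)] with [C] independent of [N]. Division by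
         [e^(N A0)] gives the form of [exp_growth_zero], as [A0 < A1]. *)
      rewrite CF in CB. unfold G in CB. rewrite !Cmod_mult, Cmod_Cexp in CB.
      replace (Re (INR N * wgt w)%C) with (INR N * A1) in CB.
      2: { replace (Re (INR N * wgt w)%C) with (INR N * Re (wgt w)) by (simpl; unfold Re; ring).
           rewrite Rphi. unfold w; simpl. replace (kap * (y0 - y0)) with 0 by ring. rewrite cos_0. unfold A1. ring. }
      replace (INR N * A1) with (INR N * (A1 - A0) + INR N * A0) in CB by ring.
      rewrite exp_plus in CB.
      apply Rmult_le_reg_r with (exp (INR N * A0)); [apply exp_pos|]. lra. }
  apply Cmod_eq_0. apply Rmult_integral in Main. destruct Main as [E|E]; [exact E | lra].
Qed.

(** A leftward step along the real axis would meet the pole at [1]. The upper half-plane is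
    therefore reached leftwards, and the half-plane [Re s < 1] is then reached downwards from it,
    which is a leftward step for the rotated function [D (Ci * z)]. *)
Lemma zero_of_zero_right (D : C -> C) :
  (forall s : C, s <> 1 -> exists l, Cder D s l) ->
  (forall s : C, 1 < Re s -> D s = 0) ->
  forall s : C, Re s < 1 -> D s = 0.
Proof.
  intros HD H0.
  assert (Hup : forall s : C, 0 < Im s -> D s = 0).
  { intros [x y] Hy; simpl in Hy.
    apply (unique_continuation D (x - 1) (Rmax 2 (x + 1)) y (y / 2) x); [lra | | |].
    - generalize (Rmax_r 2 (x + 1)). lra.
    - intros z [_ Hz]. apply HD. intros ->. simpl in Hz. lra.
    - intros t _. apply H0. simpl. generalize (Rmax_l 2 (x + 1)). lra. }
  intros [x y] Hx; simpl in Hx.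
  assert (K : (fun z => D (Ci * z)%C) (y, - x) = 0).
  { apply (unique_continuation (fun z => D (Ci * z)%C) (y - 1) (Rmax 1 (y + 1)) (- x) ((1 - x) / 2) y); [lra | | |].
    - generalize (Rmax_r 1 (y + 1)). lra.
    - intros z [_ Hz]. destruct (HD (Ci * z)%C) as [l Hl].
      + intro E. apply (f_equal Re) in E. destruct z as [z1 z2]. simpl in *. lra.
      + eexists. apply (Cder_comp D (fun z => Ci * z)%C); [exact Hl|].
        apply Cder_mult; [apply Cder_const | apply Cder_id].
    - intros t _. apply Hup. simpl. generalize (Rmax_l 1 (y + 1)). lra. }
  cbv beta in K. rewrite <- K. f_equal. unfold Ci, Cmult; simpl. f_equal; ring.
Qed.

Lemma C_series_unique (u : nat -> C) (l m : C) :
  @is_series C_AbsRing C_NormedModule u l -> @is_series C_AbsRing C_NormedModule u m -> l = m.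
Proof.
  intros H1 H2.
  apply (filterlim_locally_unique (K := C_AbsRing) (V := C_NormedModule) _ l m H1 H2).
Qed.

Lemma hurwitz_unique (w : C) (f g : C -> C) :
  is_hurwitz_zeta w f -> is_hurwitz_zeta w g -> forall s, Re s < 1 -> f s = g s.
Proof.
  intros [F1 F2] [G1 G2] s Hs.
  assert (Z : (fun s => f s - g s)%C s = 0).
  { apply (zero_of_zero_right (fun s => f s - g s)%C); [| |exact Hs].
    - intros t Ht. destruct (F1 t Ht) as [l Hl]. destruct (G1 t Ht) as [m Hm].
      exists (l - m)%C. apply Cder_minus; assumption.
    - intros t Ht. rewrite (C_series_unique _ _ _ (F2 t Ht) (G2 t Ht)). ring. }
  cbv beta in Z. replace (f s) with (f s - g s + g s)%C by ring. rewrite Z. ring.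
Qed.

(** An explicit continuation [f] shows that the one chosen by [epsilon] meets its specification. The
    two agree on the open set [Re s < 1], hence so do their derivatives there; the radius [1 - Re s]
    keeps [s + h] inside. *)
Lemma C_derive_hurwitz (w : C) (f : C -> C) (s l : C) :
  is_hurwitz_zeta w f -> Re s < 1 -> Cder f s l -> C_derive (fun s => hurwitz_zeta s w) s = l.
Proof.
  intros Hf Hs Hd. apply is_C_derive_unique.
  assert (Hg : is_hurwitz_zeta w (epsilon (inhabits (fun _ : C => RtoC 0)) (is_hurwitz_zeta w))).
  { apply epsilon_spec. exists f. exact Hf. }
  apply Cder_eps. intros eps He.
  destruct (proj1 (Cder_eps f s l) Hd eps He) as [del [Hdel Hh]].
  exists (Rmin del (1 - Re s)). split; [apply Rmin_pos; lra|].
  intros h Hhd.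
  assert (H1 : Cmod h < del) by (eapply Rlt_le_trans; [exact Hhd | apply Rmin_l]).
  assert (H2 : Cmod h < 1 - Re s) by (eapply Rlt_le_trans; [exact Hhd | apply Rmin_r]).
  unfold hurwitz_zeta.
  rewrite !(hurwitz_unique w _ f Hg Hf); [apply Hh, H1 | exact Hs |].
  simpl. unfold Re in *. generalize (Re_le_Cmod h). unfold Re. lra.
Qed.

(** * Euler-Maclaurin summation *)

(** Unlike in [sum_n], the upper index is excluded, so that the sum may be empty. *)
Fixpoint csum (f : nat -> C) (n : nat) : C :=
  match n with O => RtoC 0 | S n => (csum f n + f n)%C end.

Lemma csum_ext (f g : nat -> C) (n : nat) : (forall j, (j < n)%nat -> f j = g j) -> csum f n = csum g n.
Proof.
  induction n as [|n IH]; intro H; [reflexivity|]. simpl. rewrite IH, H by (intros; try apply H; lia).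
  reflexivity.
Qed.

Lemma csum_minus (f g : nat -> C) (n : nat) : csum (fun j => f j - g j)%C n = (csum f n - csum g n)%C.
Proof. induction n as [|n IH]; simpl; [ring | rewrite IH; ring]. Qed.

Lemma csum_scal (c : C) (f : nat -> C) (n : nat) : csum (fun j => c * f j)%C n = (c * csum f n)%C.
Proof. induction n as [|n IH]; simpl; [ring | rewrite IH; ring]. Qed.

Lemma csum_shift (f : nat -> C) (n : nat) : csum f (S n) = (f O + csum (fun j => f (S j)) n)%C.
Proof. induction n as [|n IH]; [simpl; ring|]. simpl in *. rewrite IH. ring. Qed.

Lemma csum_zero (f : nat -> C) (n : nat) : (forall j, (j < n)%nat -> f j = 0) -> csum f n = 0.
Proof.
  intro H. rewrite (csum_ext f (fun _ => RtoC 0)) by exact H.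
  clear H. induction n as [|n IH]; simpl; [reflexivity | rewrite IH; ring].
Qed.

Lemma csum_telescope (f : nat -> C) (n : nat) : csum (fun j => f j - f (S j))%C n = (f O - f n)%C.
Proof. induction n as [|n IH]; simpl; [ring | rewrite IH; ring]. Qed.

Lemma Rder_csum (f df : nat -> R -> C) (x : R) (n : nat) :
  (forall j, (j < n)%nat -> Rder (f j) x (df j x)) ->
  Rder (fun t => csum (fun j => f j t) n) x (csum (fun j => df j x) n).
Proof.
  induction n as [|n IH]; intro H; simpl; [apply Rder_const|].
  apply Rder_plus; [apply IH; intros; apply H; lia | apply H; lia].
Qed.

(* [em_kernel k x = B_k(x) / k!]: successive primitives of mean value [0] on [[0, 1]]. *)
Fixpoint em_kernel (k : nat) : R -> R :=
  match k with
  | O => fun _ => 1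
  | S k => fun x => RInt (em_kernel k) 0 x - RInt (fun y => RInt (em_kernel k) 0 y) 0 1
  end.

Lemma is_derive_RInt_cont (f : R -> R) (x : R) : (forall y, continuous f y) ->
  is_derive (fun x => RInt f 0 x) x (f x).
Proof.
  intro H. apply (is_derive_RInt (V := R_NormedModule) f (fun x => RInt f 0 x) 0).
  - exists (mkposreal 1 Rlt_0_1). intros y _. apply (RInt_correct (V := R_CompleteNormedModule)).
    apply (ex_RInt_continuous (V := R_CompleteNormedModule)). intros; apply H.
  - apply H.
Qed.

Lemma is_derive_cont (f : R -> R) (x l : R) : is_derive f x l -> continuous f x.
Proof. intro H. apply (ex_derive_continuous (K := R_AbsRing) (V := R_NormedModule)). exists l. exact H. Qed.

Lemma em_kernel_cont (k : nat) (x : R) : continuous (em_kernel k) x.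
Proof.
  revert x. induction k as [|k IH]; intro x; [apply continuous_const|].
  simpl. apply (continuous_minus (V := R_NormedModule)).
  - apply (is_derive_cont _ x (em_kernel k x)), is_derive_RInt_cont, IH.
  - apply continuous_const.
Qed.

Lemma em_kernel_derive (k : nat) (x : R) : is_derive (em_kernel (S k)) x (em_kernel k x).
Proof.
  simpl. replace (em_kernel k x) with (em_kernel k x - 0) by ring.
  apply (is_derive_minus (V := R_NormedModule)).
  - apply is_derive_RInt_cont, em_kernel_cont.
  - apply (is_derive_const (V := R_NormedModule)).
Qed.

Lemma em_kernel_mean (k : nat) : RInt (em_kernel (S k)) 0 1 = 0.
Proof.
  apply (is_RInt_unique (V := R_CompleteNormedModule)). simpl.
  set (m := RInt (fun y => RInt (em_kernel k) 0 y) 0 1).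
  replace 0 with (m - (1 - 0) * m) at 2 by ring.
  apply (is_RInt_minus (V := R_NormedModule)).
  - apply (RInt_correct (V := R_CompleteNormedModule)).
    apply (ex_RInt_continuous (V := R_CompleteNormedModule)). intros y _.
    apply (is_derive_cont _ y (em_kernel k y)), is_derive_RInt_cont, em_kernel_cont.
  - apply (is_RInt_const (V := R_NormedModule) 0 1 m).
Qed.

(** The jump is the mean of the preceding kernel, which is [1] for the constant kernel and [0]
    afterwards. *)
Lemma em_kernel_jump (k : nat) : em_kernel (S k) 1 - em_kernel (S k) 0 = match k with O => 1 | S _ => 0 end.
Proof.
  assert (E : em_kernel (S k) 1 - em_kernel (S k) 0 = RInt (em_kernel k) 0 1).
  { simpl. rewrite (RInt_point (V := R_CompleteNormedModule) 0). unfold zero; simpl. ring. }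
  rewrite E. destruct k as [|k]; [|apply em_kernel_mean].
  simpl. rewrite (RInt_const (V := R_CompleteNormedModule) 0 1 1). unfold scal; simpl; unfold mult; simpl. ring.
Qed.

(* [B_k / k!], with [B_1 = 1 / 2]. *)
Definition em_coef (k : nat) : R := em_kernel k 1.

Lemma Rcont_mult (f g : R -> C) (x : R) : Rcont f x -> Rcont g x -> Rcont (fun t => f t * g t)%C x.
Proof.
  intros Hf Hg.
  assert (A1 := Rcont_Re _ _ Hf). assert (A2 := Rcont_Im _ _ Hf).
  assert (B1 := Rcont_Re _ _ Hg). assert (B2 := Rcont_Im _ _ Hg).
  apply (continuous_ext (fun t => (Re (f t) * Re (g t) - Im (f t) * Im (g t), Re (f t) * Im (g t) + Im (f t) * Re (g t)) : C)).
  { intro t. reflexivity. }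
  apply (continuous_comp_2 (fun t => Re (f t) * Re (g t) - Im (f t) * Im (g t))
    (fun t => Re (f t) * Im (g t) + Im (f t) * Re (g t)) (fun a b => (a, b) : C)).
  - apply (continuous_minus (V := R_NormedModule)); apply (continuous_mult (K := R_AbsRing)); assumption.
  - apply (continuous_plus (V := R_NormedModule)); apply (continuous_mult (K := R_AbsRing)); assumption.
  - apply (continuous_ext (fun p : R * R => p)); [intros [u v]; reflexivity | apply continuous_id].
Qed.

Lemma Rcont_RtoC (f : R -> R) (x : R) : continuous f x -> Rcont (fun t => RtoC (f t)) x.
Proof.
  intro H. apply (continuous_comp_2 f (fun _ => 0) (fun a b => (a, b) : C)); [exact H | apply continuous_const |].
  apply (continuous_ext (fun p : R * R => p)); [intros [u v]; reflexivity | apply continuous_id].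
Qed.

Lemma CInt_by_parts_em_kernel (k : nat) (g dg : R -> C) :
  (forall x, 0 <= x <= 1 -> Rder g x (- dg x)%C) ->
  (forall x, 0 <= x <= 1 -> Rcont dg x) ->
  CInt (fun x => em_kernel k x * g x)%C 0 1 =
   (em_kernel (S k) 1 * g 1 - em_kernel (S k) 0 * g 0 + CInt (fun x => em_kernel (S k) x * dg x)%C 0 1)%C.
Proof.
  intros Hd Hc.
  assert (Hg : forall x, 0 <= x <= 1 -> Rcont g x) by (intros x Hx; apply (Rder_continuous _ _ _ (Hd x Hx))).
  assert (I2 : ex_CInt (fun x => em_kernel (S k) x * dg x)%C 0 1).
  { apply ex_CInt_cont; [lra|]. intros x Hx. apply Rcont_mult; [apply Rcont_RtoC, em_kernel_cont | apply Hc, Hx]. }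
  apply CInt_unique.
  assert (D : is_CInt (fun x => em_kernel k x * g x + em_kernel (S k) x * - dg x)%C 0 1
     (em_kernel (S k) 1 * g 1 - em_kernel (S k) 0 * g 0)%C).
  { apply (is_CInt_derive (fun x => em_kernel (S k) x * g x)%C); [lra | |].
    - intros x Hx. apply (Rder_mult (fun x => RtoC (em_kernel (S k) x))); [apply Rder_RtoC, em_kernel_derive | apply Hd, Hx].
    - intros x Hx. apply (continuous_plus (V := C_R_NormedModule)).
      + apply Rcont_mult; [apply Rcont_RtoC, em_kernel_cont | apply Hg, Hx].
      + apply Rcont_mult; [apply Rcont_RtoC, em_kernel_cont |].
        apply (continuous_opp (V := C_R_NormedModule)), Hc, Hx. }
  assert (P := is_RInt_plus (V := C_R_NormedModule) _ _ _ _ _ _ D (CInt_correct _ _ _ I2)).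
  eapply is_CInt_ext; [lra | | exact P].
  intros x _. change (em_kernel k x * g x + em_kernel (S k) x * - dg x + em_kernel (S k) x * dg x = em_kernel k x * g x)%C. ring.
Qed.

(** The chain condition makes [g 0] a primitive of [- g 1], so the integral of [g 1] is the term
    [j = 0]. Each integration by parts against the next kernel then produces one more term. *)
Lemma euler_maclaurin_exact (N : nat) (g : nat -> R -> C) :
  (forall j x, 0 <= x <= 1 -> Rder (g j) x (- g (S j) x)%C) ->
  g 1%nat 0 = (csum (fun j => em_coef j * (g j 0 - g j 1))%C (S (S N))
     - CInt (fun x => em_kernel (S N) x * g (S (S N)) x)%C 0 1)%C.
Proof.
  intro Hd.
  assert (Hc : forall j x, 0 <= x <= 1 -> Rcont (g j) x) by (intros j x Hx; apply (Rder_continuous _ _ _ (Hd j x Hx))).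
  induction N as [|N IH].
  - assert (P := CInt_by_parts_em_kernel 0 (g 1%nat) (g 2%nat) (Hd 1%nat) (Hc 2%nat)).
    assert (J := em_kernel_jump 0). simpl in J.
    assert (Q : CInt (fun x => em_kernel 0 x * g 1%nat x)%C 0 1 = (g O 0 - g O 1)%C).
    { apply CInt_unique.
      assert (D := is_CInt_derive (fun x => - g O x)%C (fun x => - - g 1%nat x)%C 0 1).
      eapply is_CInt_ext; [lra | | replace (g O 0 - g O 1)%C with (- g O 1 - - g O 0)%C by ring; apply D].
      - intros x _. simpl. ring.
      - lra.
      - intros x Hx. apply Rder_opp, Hd, Hx.
      - intros x Hx. apply (continuous_opp (V := C_R_NormedModule)), (continuous_opp (V := C_R_NormedModule)), Hc, Hx. }
    rewrite Q in P.
    set (I := CInt _ 0 1) in *. cbn [csum]. unfold em_coef. change (em_kernel 0 1) with 1.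
    (* The jump of the first kernel is the source of the isolated value [g 1 0] on the left-hand
       side; the later kernels have equal endpoint values and contribute differences. *)
    assert (J' : RtoC (em_kernel 1 0) = (RtoC (em_kernel 1 1) - 1)%C).
    { rewrite <- RtoC_minus. f_equal. simpl. lra. }
    rewrite J' in P.
    replace (g O 0 - g O 1)%C with (em_kernel 1 1 * g 1%nat 1 - (em_kernel 1 1 - 1) * g 1%nat 0 + I)%C by (symmetry; exact P).
    ring.
  - rewrite IH at 1. clear IH.
    rewrite (CInt_by_parts_em_kernel (S N) (g (S (S N))) (g (S (S (S N)))) (Hd _) (Hc _)).
    assert (J := em_kernel_jump (S N)). cbv beta iota in J.
    assert (J' : em_kernel (S (S N)) 0 = em_kernel (S (S N)) 1) by lra.
    rewrite J'. change (csum ?f (S (S (S N)))) with (csum f (S (S N)) + f (S (S N)))%C.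
    cbv beta. change (em_coef (S (S N))) with (em_kernel (S (S N)) 1). ring.
Qed.

(** The constant is a bound of the kernel on [[0, 1]], hence common to all chains. This uniformity
    is what permits summation over the shifts [w + k] and expansion in [s]. *)
Lemma euler_maclaurin (N : nat) : (1 <= N)%nat -> exists M, 0 <= M /\ forall (g : nat -> R -> C) (B : R),
  (forall j x, 0 <= x <= 1 -> Rder (g j) x (- g (S j) x)%C) ->
  (forall x, 0 <= x <= 1 -> Cmod (g (S N) x) <= B) ->
  Cmod (g 1%nat 0 - csum (fun j => em_coef j * (g j 0 - g j 1))%C (S N)) <= M * B.
Proof.
  intro HN. destruct N as [|N]; [lia|].
  destruct (Rcont_bounded (fun x => RtoC (em_kernel (S N) x)) 0 1) as [M [HM0 HM]]; [lra | |].
  { intros x _. apply Rcont_RtoC, em_kernel_cont. }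
  exists M. split; [exact HM0|]. intros g B Hd HB.
  rewrite (euler_maclaurin_exact N g Hd).
  replace (_ - _)%C with (- CInt (fun x => em_kernel (S N) x * g (S (S N)) x)%C 0 1)%C by ring.
  rewrite Cmod_opp.
  replace (M * B) with ((1 - 0) * (M * B)) by ring.
  apply CInt_bound; [lra | |].
  - apply ex_CInt_cont; [lra|]. intros x Hx.
    apply Rcont_mult; [apply Rcont_RtoC, em_kernel_cont | apply (Rder_continuous _ _ _ (Hd (S (S N)) x Hx))].
  - intros x Hx. rewrite Cmod_mult. apply Rmult_le_compat; try apply Cmod_ge_0; [apply HM, Hx | apply HB, Hx].
Qed.

(** * Taylor polynomials as chains, and the recursion for the coefficients *)

Definition taylor_term (y : C) (k : nat) : C := (y ^ k / RtoC (INR (Factorial.fact k)))%C.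

Lemma fact_neq_C (k : nat) : RtoC (INR (Factorial.fact k)) <> 0.
Proof. intro E. apply RtoC_inj in E. exact (INR_fact_neq_0 k E). Qed.

Lemma Rder_taylor_term (f : R -> C) (x : R) (l : C) (k : nat) : Rder f x l ->
  Rder (fun t => taylor_term (f t) (S k)) x (l * taylor_term (f x) k)%C.
Proof.
  intro H.
  assert (Hp : forall m, Rder (fun t => f t ^ S m)%C x (INR (S m) * l * f x ^ m)%C).
  { induction m as [|m IH].
    - eapply Rder_ext_val; [|apply (Rder_mult f (fun _ => RtoC 1)); [exact H | apply Rder_const]].
      simpl. ring.
    - eapply Rder_ext_val; [|apply (Rder_mult f (fun t => f t ^ S m)%C); [exact H | exact IH]].
      rewrite (S_INR (S m)), RtoC_plus. simpl (f x ^ S m)%C. ring. }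
  unfold taylor_term. eapply Rder_ext_val; [|apply (Rder_mult (fun t => f t ^ S k)%C (fun _ => / RtoC (INR (Factorial.fact (S k))))%C); [apply Hp | apply Rder_const]].
  cbv beta. assert (F := fact_neq_C k). assert (FS := fact_neq_C (S k)).
  change (Factorial.fact (S k)) with (S k * Factorial.fact k)%nat in *.
  rewrite mult_INR, RtoC_mult in *.
  assert (RtoC (INR (S k)) <> 0).
  { intro E. apply FS. rewrite E. ring. }
  field; repeat split; assumption.
Qed.

Lemma taylor_term_0 (y : C) : taylor_term y 0 = 1.
Proof. unfold taylor_term; simpl. field. Qed.

Lemma taylor_term_0_S (k : nat) : taylor_term 0 (S k) = 0.
Proof. unfold taylor_term, Cdiv. simpl. ring. Qed.

(* A family of polynomials in [y]: differentiating increases [j] by one. *)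
Definition taylor (x : nat -> C) (M j : nat) (y : C) : C := csum (fun k => taylor_term y k * x (j + k)%nat)%C (M - j).

Lemma Rder_taylor (x : nat -> C) (M j : nat) (a v : C) (t : R) :
  Rder (fun t => taylor x M j (a + t * v))%C t (v * taylor x M (S j) (a + t * v))%C.
Proof.
  unfold taylor. destruct (M - j)%nat as [|m] eqn:E.
  - replace (M - S j)%nat with O by lia. simpl. eapply Rder_ext_val; [|apply Rder_const]. ring.
  - replace (M - S j)%nat with m by lia.
    apply (Rder_ext
      (fun t => taylor_term (a + t * v) 0 * x (j + 0)%nat + csum (fun k => taylor_term (a + t * v) (S k) * x (j + S k)%nat) m)%C).
    { intro u. rewrite csum_shift. reflexivity. }
    eapply Rder_ext_val; [|apply Rder_plus; [|apply (Rder_csum _ (fun k t => v * taylor_term (a + t * v) k * x (j + S k)%nat)%C)]].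
    + rewrite <- csum_scal. rewrite Cplus_0_l. apply csum_ext. intros k _.
      replace (j + S k)%nat with (S j + k)%nat by lia. ring.
    + apply (Rder_ext (fun _ => x (j + 0)%nat)).
      { intro u. rewrite taylor_term_0. ring. }
      apply Rder_const.
    + intros k _. cbv beta.
      eapply Rder_ext_val; [|apply (Rder_mult (fun t => taylor_term (a + t * v) (S k)) (fun _ => x (j + S k)%nat)); [apply Rder_taylor_term, Rder_affine | apply Rder_const]].
      cbv beta. ring.
Qed.

Lemma taylor_at_0 (x : nat -> C) (M j : nat) : (j < M)%nat -> taylor x M j 0 = x j.
Proof.
  intro H. unfold taylor. replace (M - j)%nat with (S (M - j - 1)) by lia.
  rewrite csum_shift, taylor_term_0. rewrite csum_zero.
  - replace (j + 0)%nat with j by lia. ring.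
  - intros k _. rewrite taylor_term_0_S. ring.
Qed.

(* The Euler-Maclaurin formula is exact on polynomials. *)
Lemma taylor_telescope (x : nat -> C) (N : nat) (z : C) : (1 <= N)%nat ->
  csum (fun j => em_coef j * (taylor x (S N) j (1 - z) - taylor x (S N) j (1 - (z + 1))))%C (S N)
    = taylor x (S N) 1 (1 - z).
Proof.
  intro HN. destruct (euler_maclaurin N HN) as [M [HM0 HM]].
  (* In the direction [-1] the polynomials form a chain with the right sign. The member of index
     [S N] is an empty sum, so the remainder is bounded by [0]. *)
  specialize (HM (fun j t => taylor x (S N) j ((1 - z) + t * (- (1)))%C) 0). cbv beta in HM.
  assert (E : forall j, taylor x (S N) j (1 - z + 0 * - (1)) = taylor x (S N) j (1 - z)) by (intro; f_equal; ring).
  assert (E1 : forall j, taylor x (S N) j (1 - z + 1 * - (1)) = taylor x (S N) j (1 - (z + 1))) by (intro; f_equal; ring).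
  rewrite E in HM.
  rewrite (csum_ext _ (fun j => em_coef j * (taylor x (S N) j (1 - z) - taylor x (S N) j (1 - (z + 1))))%C) in HM.
  2: { intros j _. rewrite E, E1. reflexivity. }
  assert (Z : Cmod (taylor x (S N) 1 (1 - z) - csum (fun j => em_coef j * (taylor x (S N) j (1 - z) - taylor x (S N) j (1 - (z + 1))))%C (S N)) <= M * 0).
  { apply HM.
    - intros j t _. eapply Rder_ext_val; [|apply Rder_taylor]. ring.
    - intros t _. unfold taylor. rewrite Nat.sub_diag. simpl. rewrite Cmod_0. lra. }
  rewrite Rmult_0_r in Z.
  assert (Z' := Cmod_eq_0 _ (Rle_antisym _ _ Z (Cmod_ge_0 _))).
  match goal with |- ?a = ?b => transitivity (b - (b - a))%C; [ring | rewrite Z'; ring] end.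
Qed.

(** Exactness on the monomial [y^(k+1) / (k+1)!], taken at [z = 0]. Each coefficient becomes a
    rational expression in the previous ones, which is how numbers defined by integrals are seen to
    lie in the field. *)
Lemma em_coef_recursion (k : nat) :
  RtoC (em_coef k) = (taylor_term 1 k - csum (fun j => em_coef j * taylor_term 1 (S k - j))%C k)%C.
Proof.
  assert (TT := taylor_telescope (fun i => if Nat.eqb i (S k) then RtoC 1 else RtoC 0) (S k) 0 ltac:(lia)).
  assert (X : forall j y, (j <= S k)%nat ->
     taylor (fun i => if Nat.eqb i (S k) then RtoC 1 else RtoC 0) (S (S k)) j y = taylor_term y (S k - j)).
  { intros j y Hj. unfold taylor. replace (S (S k) - j)%nat with (S (S k - j)) by lia.
    cbn [csum]. rewrite csum_zero.
    - replace (j + (S k - j))%nat with (S k) by lia. rewrite Nat.eqb_refl. ring.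
    - intros i Hi. destruct (Nat.eqb_spec (j + i) (S k)); [lia | ring]. }
  replace (1 - 0)%C with (RtoC 1) in TT by ring. replace (1 - (0 + 1))%C with (RtoC 0) in TT by ring.
  rewrite X in TT by lia. replace (S k - 1)%nat with k in TT by lia. rewrite <- TT.
  rewrite (csum_ext _ (fun j => em_coef j * (taylor_term 1 (S k - j) - taylor_term 0 (S k - j)))%C).
  2: { intros j Hj. rewrite !X by lia. reflexivity. }
  cbn [csum]. rewrite Nat.sub_diag, !taylor_term_0.
  replace (S k - k)%nat with 1%nat by lia.
  rewrite taylor_term_0_S.
  rewrite (csum_ext _ (fun j => em_coef j * taylor_term 1 (S k - j))%C).
  2: { intros j Hj. replace (S k - j)%nat with (S (k - j)) by lia. rewrite taylor_term_0_S. ring. }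
  replace (taylor_term 1 1) with (RtoC 1). 2: { unfold taylor_term; simpl. field. }
  ring.
Qed.

(** * The terms of the Euler-Maclaurin expansion of the Hurwitz zeta function *)

(* The rising factorial [s (s+1) ... (s+j-2)], where [j = 0] stands for [1 / (s-1)];
   [dpoch s j] is its derivative in [s]. *)
Fixpoint poch (s : C) (j : nat) : C :=
  match j with O => (/ (s - 1))%C | S j => (poch s j * (s + INR j - 1))%C end.

Fixpoint dpoch (s : C) (j : nat) : C :=
  match j with O => (- / ((s - 1) * (s - 1)))%C | S j => (dpoch s j * (s + INR j - 1) + poch s j)%C end.

Definition zpow (s : C) (j : nat) (z : C) : C := Cexp (- (s + INR j - 1) * Clog z)%C.
(* [hterm s j z] is [1 / Gamma(s) * int_0^oo t^(s-1) t^(j-1) e^(-zt) dt] (continued in [s]), and [dhterm]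
   is its derivative in [s]. *)
Definition hterm (s : C) (j : nat) (z : C) : C := (poch s j * zpow s j z)%C.
Definition dhterm (s : C) (j : nat) (z : C) : C := ((dpoch s j - poch s j * Clog z) * zpow s j z)%C.

Lemma poch_1 (s : C) : s <> 1 -> poch s 1 = 1.
Proof. intro H. simpl. field. apply minus_neq_0, H. Qed.

Lemma dpoch_1 (s : C) : s <> 1 -> dpoch s 1 = 0.
Proof. intro H. simpl. field. apply minus_neq_0, H. Qed.

Lemma Cder_poch (s : C) (j : nat) : s <> 1 -> Cder (fun s => poch s j) s (dpoch s j).
Proof.
  intro Hs. induction j as [|j IH].
  - simpl. eapply Cder_ext_val; [|apply (Cder_comp (fun t => / t)%C (fun s => s - 1)%C); [apply Cder_inv, minus_neq_0, Hs | apply Cder_shift]].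
    ring.
  - simpl. eapply Cder_ext_val; [|apply Cder_mult; [exact IH|]].
    2: { apply Cder_minus; [apply Cder_plus; [apply Cder_id | apply Cder_const] | apply Cder_const]. }
    cbv beta. ring.
Qed.

Lemma Cder_hterm (s : C) (j : nat) (z : C) : s <> 1 -> Cder (fun s => hterm s j z) s (dhterm s j z).
Proof.
  intro Hs. unfold hterm, zpow. eapply Cder_ext_val; [|apply Cder_mult; [apply Cder_poch, Hs|]].
  2: { apply (Cder_comp Cexp (fun s => - (s + INR j - 1) * Clog z)%C); [apply Cder_Cexp|].
       apply (Cder_mult (fun s => - (s + INR j - 1))%C (fun _ => Clog z)); [|apply Cder_const].
       apply Cder_opp, Cder_minus; [apply Cder_plus; [apply Cder_id | apply Cder_const] | apply Cder_const]. }
  cbv beta. unfold dhterm, zpow. ring.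
Qed.

Lemma zpow_S (s : C) (j : nat) (z : C) : 0 < Re z -> zpow s (S j) z = (zpow s j z / z)%C.
Proof.
  intro Hz. unfold zpow. rewrite S_INR, RtoC_plus.
  replace (- (s + (INR j + 1) - 1) * Clog z)%C with (- (s + INR j - 1) * Clog z + - Clog z)%C by ring.
  rewrite Cexp_plus, Cexp_opp, Cexp_Clog by exact Hz. reflexivity.
Qed.

Lemma Rder_zpow (s : C) (j : nat) (a v : C) (x : R) : 0 < Re (a + x * v)%C ->
  Rder (fun x => zpow s j (a + x * v)) x (- (s + INR j - 1) * v * zpow s (S j) (a + x * v))%C.
Proof.
  intro Hz. rewrite zpow_S by exact Hz. unfold zpow.
  eapply Rder_ext_val; [|apply Rder_Cexp, Rder_scal_l, Rder_Clog; [exact Hz | apply Rder_affine]].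
  cbv beta. unfold Cdiv. ring.
Qed.

Lemma Rder_hterm (s : C) (j : nat) (a v : C) (x : R) : 0 < Re (a + x * v)%C ->
  Rder (fun x => hterm s j (a + x * v)) x (- (v * hterm s (S j) (a + x * v)))%C.
Proof.
  intro Hz. unfold hterm. eapply Rder_ext_val; [|apply Rder_scal_l, Rder_zpow, Hz].
  simpl. ring.
Qed.

Lemma Rder_dhterm (s : C) (j : nat) (a v : C) (x : R) : 0 < Re (a + x * v)%C ->
  Rder (fun x => dhterm s j (a + x * v)) x (- (v * dhterm s (S j) (a + x * v)))%C.
Proof.
  intro Hz. unfold dhterm.
  eapply Rder_ext_val; [|apply Rder_mult; [|apply Rder_zpow, Hz]].
  2: { apply Rder_minus; [apply Rder_const|]. apply Rder_scal_l, Rder_Clog; [exact Hz | apply Rder_affine]. }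
  cbv beta. assert (Hn := C_neq_0_of_Re _ Hz).
  replace (zpow s j (a + x * v)) with (zpow s (S j) (a + x * v) * (a + x * v))%C
    by (rewrite zpow_S by exact Hz; field; exact Hn).
  simpl. field. exact Hn.
Qed.

(** From index [1] on, the factor [1 / (s - 1)] has cancelled and [poch] agrees with a polynomial in
    [s], so the error is of second order on the whole unit disc. *)
Lemma poch_quadratic (s : C) (j : nat) : s <> 1 -> exists K, 0 <= K /\
  forall h, Cmod h <= 1 -> (s + h)%C <> 1 ->
   Cmod (poch (s + h) (S j) - poch s (S j) - h * dpoch s (S j))%C <= K * (Cmod h * Cmod h).
Proof.
  intro Hs. induction j as [|j [K [HK IH]]].
  - exists 0. split; [lra|]. intros h _ Hh. rewrite !poch_1, dpoch_1 by assumption.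
    replace (1 - 1 - h * 0)%C with (RtoC 0) by ring. rewrite Cmod_0. lra.
  - set (e := (s + INR (S j) - 1)%C).
    exists (Cmod (dpoch s (S j)) + K * (Cmod e + 1)).
    assert (He := Cmod_ge_0 e). assert (Hq := Cmod_ge_0 (dpoch s (S j))).
    split; [nra|]. intros h Hh Hsh. specialize (IH h Hh Hsh).
    change (poch ?x (S (S j))) with (poch x (S j) * (x + INR (S j) - 1))%C.
    change (dpoch ?x (S (S j))) with (dpoch x (S j) * (x + INR (S j) - 1) + poch x (S j))%C.
    fold e. replace (s + h + INR (S j) - 1)%C with (e + h)%C by (unfold e; ring).
    set (P := poch s (S j)) in *. set (Q := dpoch s (S j)) in *. set (P' := poch (s + h) (S j)) in *.
    replace (P' * (e + h) - P * e - h * (Q * e + P))%C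
      with ((P' - P - h * Q) * (e + h) + h * h * Q)%C by ring.
    eapply Rle_trans; [apply Cmod_triangle|]. rewrite !Cmod_mult.
    assert (H2 := Cmod_triangle e h). assert (Hh0 := Cmod_ge_0 h).
    assert (Cmod (P' - P - h * Q) * Cmod (e + h) <= K * (Cmod h * Cmod h) * (Cmod e + 1)).
    { apply Rmult_le_compat; try apply Cmod_ge_0; [exact IH | lra]. }
    nra.
Qed.

Lemma sqr_le_exp (x : R) : 0 <= x -> x * x <= 4 * exp x.
Proof.
  intro Hx. replace x with (x / 2 + x / 2) at 3 by field. rewrite exp_plus.
  assert (H := exp_ineq1_le (x / 2)). nra.
Qed.

(** The constant must not depend on [z], since the estimate is summed over [z = w + k].
    Differentiating [z^(-s)] twice costs two logarithms of [z], and [e^(2 |Clog z|)] absorbs them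
    together with the factor [|Cexp y|]. *)
Lemma hterm_quadratic (s : C) (j : nat) : s <> 1 -> exists K, 0 <= K /\
  forall h z, Cmod h <= 1 -> (s + h)%C <> 1 ->
   Cmod (hterm (s + h) (S j) z - hterm s (S j) z - h * dhterm s (S j) z)%C
     <= K * (Cmod h * Cmod h) * (Cmod (zpow s (S j) z) * exp (2 * Cmod (Clog z))).
Proof.
  intro Hs. destruct (poch_quadratic s j Hs) as [K [HK HP]].
  set (P := poch s (S j)) in *. set (Q := dpoch s (S j)) in *.
  assert (HP0 := Cmod_ge_0 P). assert (HQ0 := Cmod_ge_0 Q).
  exists (4 * Cmod P + 2 * Cmod Q + K). split; [lra|].
  intros h z Hh Hsh. specialize (HP h Hh Hsh).
  set (P' := poch (s + h) (S j)) in *.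
  set (l := Clog z). set (X := zpow s (S j) z). set (y := (- h * l)%C).
  assert (EX : zpow (s + h) (S j) z = (X * Cexp y)%C).
  { unfold X, zpow. rewrite <- Cexp_plus. f_equal. unfold y, l. ring. }
  unfold hterm, dhterm. rewrite EX. fold P Q P' X l.
  (* Three errors, each of second order in [h]: that of the exponential, the product of two
     first-order changes, and that of the polynomial. *)
  replace (P' * (X * Cexp y) - P * X - h * ((Q - P * l) * X))%C
    with (X * (P * (Cexp y - 1 - y) + h * Q * (Cexp y - 1) + (P' - P - h * Q) * Cexp y))%C
    by (unfold y; ring).
  rewrite Cmod_mult, (Rmult_comm (Cmod X)), <- Rmult_assoc.
  assert (HX := Cmod_ge_0 X).
  replace (_ * (Cmod h * Cmod h) * Cmod X * exp (2 * Cmod l))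
   with ((4 * Cmod P + 2 * Cmod Q + K) * (Cmod h * Cmod h) * exp (2 * Cmod l) * Cmod X) by ring.
  apply Rmult_le_compat_r; [exact HX|].
  assert (Hl := Cmod_ge_0 l). assert (Hh0 := Cmod_ge_0 h).
  assert (Hy : Cmod y = Cmod h * Cmod l) by (unfold y; rewrite Cmod_mult, Cmod_opp; reflexivity).
  assert (Hyl : Cmod y <= Cmod l) by (rewrite Hy; nra).
  set (u := exp (Cmod l)).
  assert (Hu2 : exp (2 * Cmod l) = u * u) by (unfold u; rewrite <- exp_plus; f_equal; ring).
  assert (Hu : 1 + Cmod l <= u) by (unfold u; apply exp_ineq1_le).
  assert (Hll : Cmod l * Cmod l <= 4 * u) by (apply sqr_le_exp, Hl).
  assert (Hey : exp (Cmod y) <= u) by (apply exp_mono, Hyl).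
  assert (Hey0 := exp_pos (Cmod y)).
  assert (B1 : Cmod (Cexp y - 1 - y) <= 4 * (Cmod h * Cmod h) * (u * u)).
  { eapply Rle_trans; [apply Cexp_bound2|]. rewrite Hy at 1 2.
    replace (Cmod h * Cmod l * (Cmod h * Cmod l) * exp (Cmod y)) with ((Cmod h * Cmod h) * ((Cmod l * Cmod l) * exp (Cmod y))) by ring.
    replace (4 * (Cmod h * Cmod h) * (u * u)) with ((Cmod h * Cmod h) * ((4 * u) * u)) by ring.
    apply Rmult_le_compat_l; [nra|]. apply Rmult_le_compat; nra. }
  assert (B2 : Cmod (Cexp y - 1) <= Cmod h * (u * u)).
  { eapply Rle_trans; [apply Cexp_bound1|]. rewrite Hy at 1. rewrite Rmult_assoc.
    apply Rmult_le_compat_l; [lra|]. apply Rmult_le_compat; lra. }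
  assert (B3 : Cmod (Cexp y) <= u * u).
  { rewrite Cmod_Cexp. apply Rle_trans with u; [|nra]. apply exp_mono.
    eapply Rle_trans; [apply Re_le_Cmod | exact Hyl]. }
  rewrite Hu2.
  eapply Rle_trans; [apply Cmod_triangle|].
  eapply Rle_trans; [apply Rplus_le_compat_r, Cmod_triangle|].
  rewrite !Cmod_mult.
  assert (C1 : Cmod P * Cmod (Cexp y - 1 - y) <= Cmod P * (4 * (Cmod h * Cmod h) * (u * u))) by (apply Rmult_le_compat_l; assumption).
  assert (C2 : Cmod h * Cmod Q * Cmod (Cexp y - 1) <= Cmod h * Cmod Q * (Cmod h * (u * u))) by (apply Rmult_le_compat_l; [nra | assumption]).
  assert (C3 : Cmod (P' - P - h * Q) * Cmod (Cexp y) <= K * (Cmod h * Cmod h) * (u * u)) by (apply Rmult_le_compat; try apply Cmod_ge_0; assumption).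
  assert (0 <= Cmod Q * (Cmod h * Cmod h) * (u * u)).
  { apply Rmult_le_pos; [apply Rmult_le_pos; nra | nra]. }
  nra.
Qed.

Lemma Cmod_hterm (s : C) (j : nat) (z : C) : Cmod (hterm s j z) = Cmod (poch s j) * Cmod (zpow s j z).
Proof. apply Cmod_mult. Qed.

(** The logarithm is absorbed by [1 + x / 2 <= e^(x / 2)], at the price of half a unit of decay. *)
Lemma dhterm_bound (s : C) (j : nat) (z : C) :
  Cmod (dhterm s j z) <= 2 * (Cmod (dpoch s j) + Cmod (poch s j)) * (Cmod (zpow s j z) * exp (/ 2 * Cmod (Clog z))).
Proof.
  unfold dhterm. rewrite Cmod_mult.
  assert (H1 : Cmod (dpoch s j - poch s j * Clog z) <= Cmod (dpoch s j) + Cmod (poch s j) * Cmod (Clog z)).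
  { eapply Rle_trans; [apply Cmod_minus_le|]. rewrite Cmod_mult. lra. }
  assert (H2 := exp_ineq1_le (/ 2 * Cmod (Clog z))).
  assert (Hl := Cmod_ge_0 (Clog z)). assert (HX := Cmod_ge_0 (zpow s j z)).
  assert (Hq := Cmod_ge_0 (dpoch s j)). assert (Hp := Cmod_ge_0 (poch s j)).
  replace (2 * (Cmod (dpoch s j) + Cmod (poch s j)) * (Cmod (zpow s j z) * exp (/ 2 * Cmod (Clog z))))
    with (2 * (Cmod (dpoch s j) + Cmod (poch s j)) * exp (/ 2 * Cmod (Clog z)) * Cmod (zpow s j z)) by ring.
  apply Rmult_le_compat_r; [exact HX|]. nra.
Qed.

(** The exponent [beta] measures the growth conceded to factors logarithmic in [z]: [0] for [hterm],
    [1/2] for its derivative in [s], [2] for the second-order remainder. Each unit of it takes one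
    unit from the decay exponent. *)
Lemma zpow_decay (w s : C) (j : nat) (beta : R) : 0 < Re w -> 0 <= beta -> beta <= Re s + INR j - 1 ->
  exists K, 0 <= K /\ forall (k : nat) (x : R), 0 <= x <= 1 ->
   Cmod (zpow s j (w + INR k + x * 1)) * exp (beta * Cmod (Clog (w + INR k + x * 1)))
     <= K * exp (- (Re s + INR j - 1 - beta) * ln (INR k + 1)).
Proof.
  intros Hw Hb Hsb.
  (* When [Re w < 1] the first points may have modulus below [1] and a negative logarithm. The
     constant [c0] gives [|Z| >= c0 * (k + 1)], and [L] makes up for the sign. *)
  set (c0 := Rmin 1 (Re w)).
  assert (Hc0 : 0 < c0) by (apply Rmin_pos; lra).
  assert (Hc1 : c0 <= 1) by apply Rmin_l. assert (Hc2 : c0 <= Re w) by apply Rmin_r.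
  set (L := - ln c0).
  assert (HL : 0 <= L).
  { unfold L. rewrite <- ln_1. assert (ln c0 <= ln 1) by (apply ln_le; lra). rewrite ln_1 in *. lra. }
  set (al := Re s + INR j - 1) in *.
  exists (exp (2 * Rabs (Im s) + beta * (2 * L + 2) + (al - beta) * L)).
  split; [left; apply exp_pos|].
  intros k x Hx. unfold zpow.
  set (Z := (w + INR k + x * 1)%C).
  assert (HZ : c0 * (INR k + 1) <= Cmod Z).
  { eapply Rle_trans; [|apply Re_le_Cmod]. unfold Z; simpl. unfold Re in *.
    assert (Hk := pos_INR k). nra. }
  assert (Hk := pos_INR k).
  set (A := ln (Cmod Z)). set (B := Im (Clog Z)).
  assert (HA : - L + ln (INR k + 1) <= A).
  { unfold L, A. rewrite Ropp_involutive, <- ln_mult by lra. apply ln_le; [nra | exact HZ]. }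
  assert (HB : Rabs B <= 2) by apply Cmod_Im_Clog.
  assert (Hu : 0 <= ln (INR k + 1)).
  { rewrite <- ln_1. apply ln_le; lra. }
  set (u := ln (INR k + 1)) in *.
  assert (HAa : Rabs A <= A + 2 * L) by (apply Rabs_le; lra).
  assert (Hl : Cmod (Clog Z) <= A + 2 * L + 2).
  { eapply Rle_trans; [apply Cmod_le_abs|]. rewrite Re_Clog. fold A. fold B. lra. }
  assert (HRe : Re (- (s + INR j - 1) * Clog Z)%C <= - al * A + 2 * Rabs (Im s)).
  { replace (Re (- (s + INR j - 1) * Clog Z)%C) with (- al * A + Im s * B).
    2: { unfold al, A, B. rewrite <- Re_Clog. unfold Re, Im. simpl. ring. }
    assert (Im s * B <= Rabs (Im s) * Rabs B) by (rewrite <- Rabs_mult; apply Rle_abs).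
    assert (Rabs (Im s) * Rabs B <= Rabs (Im s) * 2) by (apply Rmult_le_compat_l; [apply Rabs_pos | exact HB]).
    lra. }
  rewrite Cmod_Cexp, <- !exp_plus. apply exp_mono.
  assert (beta * Cmod (Clog Z) <= beta * (A + 2 * L + 2)) by (apply Rmult_le_compat_l; assumption).
  assert ((al - beta) * (- L + u) <= (al - beta) * A) by (apply Rmult_le_compat_l; lra).
  lra.
Qed.

Lemma exp_ln_lim (d : R) : 0 < d -> is_lim_seq (fun k => exp (- d * ln (INR k + 1))) 0.
Proof.
  intro Hd. apply is_lim_seq_spec. intros eps.
  destruct (INR_unbounded (exp (- ln eps / d))) as [N HN].
  exists N. intros k Hk. rewrite Rminus_0_r, Rabs_pos_eq by (left; apply exp_pos).
  rewrite <- (exp_ln eps) by apply cond_pos. apply exp_increasing.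
  assert (HkN : INR N <= INR k) by (apply le_INR, Hk).
  assert (H : - ln eps / d < ln (INR k + 1)).
  { rewrite <- (ln_exp (- ln eps / d)). apply ln_increasing; [apply exp_pos | lra]. }
  apply (Rmult_lt_compat_l d) in H; [|exact Hd].
  replace (d * (- ln eps / d)) with (- ln eps) in H by (field; lra). lra.
Qed.

Lemma exp_ln_2 (a : R) (k : nat) : 2 <= a -> exp (- a * ln (INR k + 1)) <= / ((INR k + 1) * (INR k + 1)).
Proof.
  intro Ha. assert (Hk := pos_INR k).
  assert (Hu : 0 <= ln (INR k + 1)) by (rewrite <- ln_1; apply ln_le; lra).
  apply Rle_trans with (exp (- (ln (INR k + 1) + ln (INR k + 1)))).
  - apply exp_mono. nra.
  - rewrite exp_Ropp, exp_plus, exp_ln by lra. lra.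
Qed.

(** * Limits and series of complex numbers *)

Definition clim (u : nat -> C) (l : C) : Prop := is_lim_seq (fun n => Cmod (u n - l)) 0.

Lemma clim_le (u : nat -> C) (l : C) (v : nat -> R) :
  (forall n, Cmod (u n - l) <= v n) -> is_lim_seq v 0 -> clim u l.
Proof.
  intros H Hv. apply (is_lim_seq_le_le (fun _ => 0) _ v); [|apply is_lim_seq_const | exact Hv].
  intro n. split; [apply Cmod_ge_0 | apply H].
Qed.

Lemma clim_ext (u v : nat -> C) (l : C) : (forall n, u n = v n) -> clim u l -> clim v l.
Proof. intros H Hu. apply (is_lim_seq_ext (fun n => Cmod (u n - l))); [intro n; rewrite H; reflexivity | exact Hu]. Qed.

Lemma clim_const (c : C) : clim (fun _ => c) c.
Proof.
  apply (is_lim_seq_ext (fun _ => 0)); [|apply is_lim_seq_const].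
  intros _. replace (c - c)%C with (RtoC 0) by ring. rewrite Cmod_0. reflexivity.
Qed.

Lemma clim_plus (u v : nat -> C) (l m : C) : clim u l -> clim v m -> clim (fun n => u n + v n)%C (l + m)%C.
Proof.
  intros Hu Hv. apply (clim_le _ _ (fun n => Cmod (u n - l) + Cmod (v n - m))).
  - intro n. replace (u n + v n - (l + m))%C with (u n - l + (v n - m))%C by ring. apply Cmod_triangle.
  - replace (Finite 0) with (Finite (0 + 0)) by (f_equal; ring). apply is_lim_seq_plus'; assumption.
Qed.

Lemma clim_scal (c : C) (u : nat -> C) (l : C) : clim u l -> clim (fun n => c * u n)%C (c * l)%C.
Proof.
  intros Hu. apply (clim_le _ _ (fun n => Cmod c * Cmod (u n - l))).
  - intro n. replace (c * u n - c * l)%C with (c * (u n - l))%C by ring. rewrite Cmod_mult. lra.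
  - replace (Finite 0) with (Rbar_mult (Cmod c) 0) by (simpl; f_equal; ring). apply is_lim_seq_scal_l. exact Hu.
Qed.

Lemma clim_minus (u v : nat -> C) (l m : C) : clim u l -> clim v m -> clim (fun n => u n - v n)%C (l - m)%C.
Proof.
  intros Hu Hv. replace (l - m)%C with (l + - (1) * m)%C by ring.
  apply (clim_ext (fun n => u n + - (1) * v n)%C); [intro n; ring|].
  apply clim_plus; [exact Hu | apply clim_scal, Hv].
Qed.

Lemma clim_bound (u : nat -> C) (l : C) (B : R) : clim u l -> (forall n, Cmod (u n) <= B) -> Cmod l <= B.
Proof.
  intros Hu HB.
  assert (H : Rbar_le (Cmod l - B) 0).
  { apply (is_lim_seq_le (fun _ => Cmod l - B) (fun n => Cmod (u n - l))); [|apply is_lim_seq_const | exact Hu].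
    intro n. generalize (Cmod_triangle (u n) (l - u n)) (HB n) (Cmod_minus_sym l (u n)).
    replace (u n + (l - u n))%C with l by ring. lra. }
  simpl in H. lra.
Qed.

Lemma clim_unique (u : nat -> C) (l m : C) : clim u l -> clim u m -> l = m.
Proof.
  intros Hl Hm.
  assert (H : Cmod (l - m) <= 0).
  { apply (clim_bound (fun n => u n - u n)%C); [apply clim_minus; assumption|].
    intro n. replace (u n - u n)%C with (RtoC 0) by ring. rewrite Cmod_0. lra. }
  assert (E := Cmod_eq_0 _ (Rle_antisym _ _ H (Cmod_ge_0 _))).
  replace l with (l - m + m)%C by ring. rewrite E. ring.
Qed.

Lemma clim_shift (u : nat -> C) (l : C) : clim u l <-> clim (fun n => u (S n)) l.
Proof. split; apply (is_lim_seq_incr_1 (fun n => Cmod (u n - l))). Qed.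

Lemma clim_csum (u : nat -> nat -> C) (n : nat) : (forall j, (j < n)%nat -> clim (u j) 0) ->
  clim (fun k => csum (fun j => u j k) n) 0.
Proof.
  induction n as [|n IH]; intro H; simpl; [apply clim_const|].
  replace (RtoC 0) with (0 + 0)%C by ring. apply clim_plus; [apply IH; intros; apply H; lia | apply H; lia].
Qed.

Lemma inv_sqr_sum (n : nat) : sum_n (fun k => / ((INR k + 1) * (INR k + 1))) n <= 2 - / (INR n + 1).
Proof.
  induction n as [|n IH].
  - rewrite sum_O. simpl. lra.
  - rewrite sum_Sn. unfold plus; simpl plus. rewrite S_INR in *.
    assert (Hn := pos_INR n).
    assert (/ ((INR n + 1 + 1) * (INR n + 1 + 1)) <= / (INR n + 1) - / (INR n + 1 + 1)).
    { replace (/ (INR n + 1) - / (INR n + 1 + 1)) with (/ ((INR n + 1) * (INR n + 1 + 1))) by (field; lra).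
      apply Rinv_le_contravar; nra. }
    simpl. lra.
Qed.

Lemma inv_sqr_series : ex_series (fun k => / ((INR k + 1) * (INR k + 1))).
Proof.
  destruct (ex_finite_lim_seq_incr (sum_n (fun k => / ((INR k + 1) * (INR k + 1)))) 2) as [l Hl].
  - intro n. rewrite sum_Sn. unfold plus; simpl. assert (Hn := pos_INR (S n)).
    assert (0 < / ((INR (S n) + 1) * (INR (S n) + 1))) by (apply Rinv_0_lt_compat; nra). simpl in *. lra.
  - intro n. eapply Rle_trans; [apply inv_sqr_sum|]. assert (Hn := pos_INR n).
    assert (0 < / (INR n + 1)) by (apply Rinv_0_lt_compat; lra). lra.
  - exists l. exact Hl.
Qed.

Lemma sum_n_csum (a : nat -> C) (n : nat) : @sum_n C_R_NormedModule a n = csum a (S n).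
Proof.
  induction n as [|n IH].
  - rewrite sum_O. simpl. ring.
  - rewrite sum_Sn, IH. reflexivity.
Qed.

(** The explicit bound [2 * K] on the sum is what lets a series of second-order remainders be again
    of second order. *)
Lemma csum_converges (a : nat -> C) (K : R) : 0 <= K ->
  (forall k, Cmod (a k) <= K * / ((INR k + 1) * (INR k + 1))) ->
  exists l, clim (csum a) l /\ Cmod l <= 2 * K.
Proof.
  intros HK Ha.
  destruct (ex_series_le (K := R_AbsRing) (V := C_R_CompleteNormedModule) a (fun k => K * / ((INR k + 1) * (INR k + 1)))) as [l Hl].
  - intro n. eapply Rle_trans; [|apply Ha]. right. apply Cnorm_R.
  - apply (ex_series_scal (V := R_NormedModule) K). apply inv_sqr_series.
  - assert (L : clim (csum a) l).
    { apply clim_shift. apply is_lim_seq_spec. intro eps.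
      assert (Hl' := proj1 (filterlim_locally_ball_norm (K := R_AbsRing) (U := C_R_NormedModule) (sum_n a) l) Hl eps).
      destruct Hl' as [N HN]. exists N. intros n Hn. specialize (HN n Hn).
      rewrite Rminus_0_r, Rabs_pos_eq by apply Cmod_ge_0.
      rewrite <- sum_n_csum, <- Cnorm_R. exact HN. }
    exists l. split; [exact L|].
    apply (clim_bound (fun n => csum a (S n))); [apply -> clim_shift; exact L|].
    intro n.
    assert (S1 : Cmod (csum a (S n)) <= K * sum_n (fun k => / ((INR k + 1) * (INR k + 1))) n).
    { induction n as [|n IH].
      - simpl csum. rewrite sum_O, Cplus_0_l. apply Ha.
      - rewrite sum_Sn. change (csum a (S (S n))) with (csum a (S n) + a (S n))%C.
        eapply Rle_trans; [apply Cmod_triangle|]. unfold plus; simpl plus.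
        generalize (Ha (S n)). simpl in *. lra. }
    assert (S2 := inv_sqr_sum n). assert (Hn := pos_INR n).
    assert (0 < / (INR n + 1)) by (apply Rinv_0_lt_compat; lra). nra.
Qed.

(** * Analytic continuation of the Hurwitz zeta function *)

(** The formal Euler-Maclaurin expansion of the sum of [g 1 (z + k)] over [k >= 0]. Below, [emrem]
    is its failure to telescope in one step, and [empart] replaces the tail of the series by it. *)
Definition emsum (N : nat) (g : nat -> C -> C) (z : C) : C := csum (fun j => em_coef j * g j z)%C (S N).

Definition emrem (N : nat) (g : nat -> C -> C) (z : C) : C :=
  (g 1%nat z - (emsum N g z - emsum N g (z + 1)))%C.

Definition empart (N : nat) (g : nat -> C -> C) (w : C) (K : nat) : C :=
  (csum (fun k => g 1%nat (w + INR k)%C) K + emsum N g (w + INR K))%C.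

(** The remainders are of the size of [g (S N)], so for large [N] the series on the right converges
    even where that of [g 1] diverges. This is the mechanism of the continuation. *)
Lemma empart_emrem (N : nat) (g : nat -> C -> C) (w : C) (K : nat) :
  empart N g w K = (emsum N g w + csum (fun k => emrem N g (w + INR k)%C) K)%C.
Proof.
  unfold empart. induction K as [|K IH].
  - simpl. rewrite !Cplus_0_r, Cplus_0_l. reflexivity.
  - cbn [csum]. unfold emrem at 2.
    replace (w + INR K + 1)%C with (w + INR (S K))%C by (rewrite S_INR, RtoC_plus; ring).
    transitivity (csum (fun k => g 1%nat (w + INR k)%C) K + emsum N g (w + INR K) - emsum N g (w + INR K)
       + g 1%nat (w + INR K)%C + emsum N g (w + INR (S K)))%C; [ring|].
    rewrite IH. ring.
Qed.

(** The rule obeyed by Laplace integrals of [t^(j-1) e^(-zt)], where differentiation in [z] brings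
    down [-t]. *)
Definition is_chain (g : nat -> C -> C) : Prop := forall j (z : C) (x : R),
  0 < Re (z + x * 1)%C -> Rder (fun x => g j (z + x * 1)%C) x (- g (S j) (z + x * 1))%C.

Lemma emrem_bound (N : nat) : (1 <= N)%nat -> exists M, 0 <= M /\ forall (g : nat -> C -> C) (z : C) (B : R),
  is_chain g -> 0 < Re z -> (forall x, 0 <= x <= 1 -> Cmod (g (S N) (z + x * 1)%C) <= B) ->
  Cmod (emrem N g z) <= M * B.
Proof.
  intro HN. destruct (euler_maclaurin N HN) as [M [HM0 HM]].
  exists M. split; [exact HM0|]. intros g z B Hg Hz HB.
  specialize (HM (fun j x => g j (z + x * 1)%C) B).
  assert (H := HM (fun j x Hx => Hg j z x ltac:(simpl in *; unfold Re in *; lra)) HB). clear HM.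
  cbv beta in H. unfold emrem, emsum. rewrite <- csum_minus.
  replace (z + 0 * 1)%C with z in H by ring.
  erewrite (csum_ext (fun j => _ - _)%C); [exact H|].
  intros j _. cbv beta. replace (z + 0 * 1)%C with z by ring. replace (z + 1 * 1)%C with (z + 1)%C by ring. ring.
Qed.

Lemma chain_hterm (s : C) : is_chain (hterm s).
Proof.
  intros j z x Hz. eapply Rder_ext_val; [|apply Rder_hterm, Hz]. ring.
Qed.

Lemma chain_dhterm (s : C) : is_chain (dhterm s).
Proof.
  intros j z x Hz. eapply Rder_ext_val; [|apply Rder_dhterm, Hz]. ring.
Qed.

Lemma emrem_hterm_bound (w s : C) (N : nat) : 0 < Re w -> (1 <= N)%nat -> 4 <= Re s + INR N ->
  exists K, 0 <= K /\ forall k, Cmod (emrem N (hterm s) (w + INR k)) <= K * / ((INR k + 1) * (INR k + 1)).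
Proof.
  intros Hw HN Hs. destruct (emrem_bound N HN) as [M [HM0 HM]].
  destruct (zpow_decay w s (S N) 0) as [K [HK0 HK]]; [exact Hw | lra | rewrite S_INR; lra |].
  assert (Hp := Cmod_ge_0 (poch s (S N))).
  exists (M * (Cmod (poch s (S N)) * K)). split; [repeat apply Rmult_le_pos; lra|].
  intro k. rewrite Rmult_assoc. apply HM; [apply chain_hterm | simpl; unfold Re in *; generalize (pos_INR k); lra |].
  intros x Hx. rewrite Cmod_hterm, Rmult_assoc. apply Rmult_le_compat_l; [exact Hp|].
  specialize (HK k x Hx). rewrite Rmult_0_l, exp_0, Rmult_1_r in HK.
  eapply Rle_trans; [exact HK|]. apply Rmult_le_compat_l; [exact HK0|].
  apply exp_ln_2. rewrite S_INR. lra.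
Qed.

Lemma emrem_dhterm_bound (w s : C) (N : nat) : 0 < Re w -> (1 <= N)%nat -> 4 <= Re s + INR N ->
  exists K, 0 <= K /\ forall k, Cmod (emrem N (dhterm s) (w + INR k)) <= K * / ((INR k + 1) * (INR k + 1)).
Proof.
  intros Hw HN Hs. destruct (emrem_bound N HN) as [M [HM0 HM]].
  destruct (zpow_decay w s (S N) (/ 2)) as [K [HK0 HK]]; [exact Hw | lra | rewrite S_INR; lra |].
  assert (Hp := Cmod_ge_0 (poch s (S N))). assert (Hq := Cmod_ge_0 (dpoch s (S N))).
  exists (M * (2 * (Cmod (dpoch s (S N)) + Cmod (poch s (S N))) * K)). split; [repeat apply Rmult_le_pos; lra|].
  intro k. rewrite Rmult_assoc. apply HM; [apply chain_dhterm | simpl; unfold Re in *; generalize (pos_INR k); lra |].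
  intros x Hx. eapply Rle_trans; [apply dhterm_bound|].
  rewrite (Rmult_assoc _ K). apply Rmult_le_compat_l; [lra|].
  eapply Rle_trans; [apply HK, Hx|]. apply Rmult_le_compat_l; [exact HK0|].
  apply exp_ln_2. rewrite S_INR. lra.
Qed.

(** The second-order remainders in [s] form again a chain in [z], so [emrem_bound] applies to them
    as a whole. Of the decay [Re s + N], two units pay for [e^(2 |Clog z|)], and what is left still
    dominates the inverse squares. *)
Lemma emrem_quadratic (w s : C) (N : nat) : 0 < Re w -> s <> 1 -> (1 <= N)%nat -> 5 <= Re s + INR N ->
  exists K, 0 <= K /\ forall h k, Cmod h <= 1 -> (s + h)%C <> 1 ->
   Cmod (emrem N (hterm (s + h)) (w + INR k) - emrem N (hterm s) (w + INR k) - h * emrem N (dhterm s) (w + INR k))%C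
     <= K * (Cmod h * Cmod h) * / ((INR k + 1) * (INR k + 1)).
Proof.
  intros Hw Hs1 HN Hs. destruct (emrem_bound N HN) as [M [HM0 HM]].
  destruct (zpow_decay w s (S N) 2) as [K [HK0 HK]]; [exact Hw | lra | rewrite S_INR; lra |].
  destruct (hterm_quadratic s N Hs1) as [K2 [HK20 HK2]].
  exists (M * (K2 * K)). split; [repeat apply Rmult_le_pos; lra|].
  intros h k Hh Hsh.
  set (g := fun j z => (hterm (s + h) j z - hterm s j z - h * dhterm s j z)%C).
  assert (E : (emrem N (hterm (s + h)) (w + INR k) - emrem N (hterm s) (w + INR k) - h * emrem N (dhterm s) (w + INR k))%C
     = emrem N g (w + INR k)).
  { assert (Eg : forall z, emsum N g z = (emsum N (hterm (s + h)) z - emsum N (hterm s) z - h * emsum N (dhterm s) z)%C).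
    { intro z. unfold emsum. rewrite <- csum_scal, <- !csum_minus. apply csum_ext. intros j _. unfold g. ring. }
    unfold emrem. rewrite !Eg. unfold g. ring. }
  rewrite E.
  replace (M * (K2 * K) * (Cmod h * Cmod h) * / ((INR k + 1) * (INR k + 1)))
    with (M * (K2 * (Cmod h * Cmod h) * (K * / ((INR k + 1) * (INR k + 1))))) by ring.
  apply HM.
  - intros j z x Hz. unfold g.
    eapply Rder_ext_val; [|apply Rder_minus; [apply Rder_minus; apply chain_hterm, Hz | apply Rder_scal_l, chain_dhterm, Hz]].
    ring.
  - simpl; unfold Re in *; generalize (pos_INR k); lra.
  - intros x Hx. unfold g. eapply Rle_trans; [apply HK2; assumption|].
    apply Rmult_le_compat_l; [generalize (Cmod_ge_0 h); intro; apply Rmult_le_pos; nra|].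
    eapply Rle_trans; [apply HK, Hx|]. apply Rmult_le_compat_l; [exact HK0|].
    apply exp_ln_2. rewrite S_INR. lra.
Qed.

Lemma clim_hterm (w s : C) (j : nat) : 0 < Re w -> 0 < Re s + INR j - 1 ->
  clim (fun k => hterm s j (w + INR k)) 0.
Proof.
  intros Hw Hs.
  destruct (zpow_decay w s j 0) as [K [HK0 HK]]; [exact Hw | lra | lra |].
  apply (clim_le _ _ (fun k => Cmod (poch s j) * K * exp (- (Re s + INR j - 1) * ln (INR k + 1)))).
  - intro k. replace (hterm s j (w + INR k) - 0)%C with (hterm s j (w + INR k)) by ring.
    rewrite Cmod_hterm, Rmult_assoc. apply Rmult_le_compat_l; [apply Cmod_ge_0|].
    specialize (HK k 0 ltac:(lra)). rewrite Rmult_0_l, exp_0, Rmult_1_r, Rminus_0_r in HK.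
    replace (w + INR k + 0 * 1)%C with (w + INR k)%C in HK by ring. exact HK.
  - replace (Finite 0) with (Rbar_mult (Cmod (poch s j) * K) 0) by (simpl; f_equal; ring).
    apply is_lim_seq_scal_l, exp_ln_lim, Hs.
Qed.

Lemma clim_dhterm (w s : C) (j : nat) : 0 < Re w -> / 2 < Re s + INR j - 1 ->
  clim (fun k => dhterm s j (w + INR k)) 0.
Proof.
  intros Hw Hs.
  destruct (zpow_decay w s j (/ 2)) as [K [HK0 HK]]; [exact Hw | lra | lra |].
  apply (clim_le _ _ (fun k => 2 * (Cmod (dpoch s j) + Cmod (poch s j)) * K * exp (- (Re s + INR j - 1 - / 2) * ln (INR k + 1)))).
  - intro k. replace (dhterm s j (w + INR k) - 0)%C with (dhterm s j (w + INR k)) by ring.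
    eapply Rle_trans; [apply dhterm_bound|]. rewrite (Rmult_assoc _ K).
    apply Rmult_le_compat_l; [generalize (Cmod_ge_0 (dpoch s j)) (Cmod_ge_0 (poch s j)); lra|].
    specialize (HK k 0 ltac:(lra)).
    replace (w + INR k + 0 * 1)%C with (w + INR k)%C in HK by ring. exact HK.
  - replace (Finite 0) with (Rbar_mult (2 * (Cmod (dpoch s j) + Cmod (poch s j)) * K) 0) by (simpl; f_equal; ring).
    apply is_lim_seq_scal_l, exp_ln_lim. lra.
Qed.

(** Raising the order adds terms evaluated at [w + K], which tend to [0]. *)
Lemma empart_add (w s : C) (N i : nat) (l : C) : 0 < Re w -> 0 < Re s + INR N ->
  clim (empart N (hterm s) w) l -> clim (empart (N + i) (hterm s) w) l.
Proof.
  intros Hw Hs H. induction i as [|i IH]; [rewrite Nat.add_0_r; exact H|].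
  replace (N + S i)%nat with (S (N + i)) by lia.
  replace l with (l + em_coef (S (N + i)) * 0)%C by ring.
  apply (clim_ext (fun K => empart (N + i) (hterm s) w K + em_coef (S (N + i)) * hterm s (S (N + i)) (w + INR K))%C).
  - intro K. unfold empart, emsum. cbn [csum]. ring.
  - apply clim_plus; [exact IH | apply clim_scal, clim_hterm; [exact Hw|]].
    rewrite S_INR, plus_INR. generalize (pos_INR i). lra.
Qed.

(* The limit exists and does not depend on [N] once [N] is large, see [hzeta_spec]. *)
Definition hzeta (w s : C) : C := epsilon (inhabits (RtoC 0))
  (fun l => exists N, 4 <= Re s + INR N /\ clim (empart N (hterm s) w) l).

Lemma hzeta_spec (w s : C) (N : nat) : 0 < Re w -> (1 <= N)%nat -> 4 <= Re s + INR N ->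
  clim (empart N (hterm s) w) (hzeta w s).
Proof.
  intros Hw HN Hs.
  destruct (emrem_hterm_bound w s N Hw HN Hs) as [K [HK0 HK]].
  destruct (csum_converges _ K HK0 HK) as [l0 [Hl0 _]].
  assert (H1 : clim (empart N (hterm s) w) (emsum N (hterm s) w + l0)%C).
  { apply (clim_ext (fun K => emsum N (hterm s) w + csum (fun k => emrem N (hterm s) (w + INR k)%C) K)%C).
    - intro n. symmetry. apply empart_emrem.
    - apply clim_plus; [apply clim_const | exact Hl0]. }
  destruct (epsilon_spec (inhabits (RtoC 0)) (fun l => exists N, 4 <= Re s + INR N /\ clim (empart N (hterm s) w) l))
    as [N' [HN' H2]].
  { exists (emsum N (hterm s) w + l0)%C, N. split; assumption. }
  fold (hzeta w s) in H2.
  replace (hzeta w s) with (emsum N (hterm s) w + l0)%C; [exact H1|].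
  (* The order [N'] chosen by [epsilon] is unknown; both limits are compared at the common order
     [N + N']. *)
  apply (clim_unique (empart (N + N') (hterm s) w)).
  - apply empart_add; [exact Hw | lra | exact H1].
  - rewrite Nat.add_comm. apply empart_add; [exact Hw | lra | exact H2].
Qed.

Lemma nat_above (x : R) : exists N : nat, (1 <= N)%nat /\ x <= INR N.
Proof.
  destruct (INR_unbounded x) as [N HN]. exists (S N). split; [lia|]. rewrite S_INR. lra.
Qed.

Lemma Re_plus_ge (s h : C) : Cmod h <= 1 -> Re s - 1 <= Re (s + h)%C.
Proof.
  intro Hh. generalize (re_le_Cmod h) (Rle_abs (- Re h)). rewrite Rabs_Ropp.
  destruct s, h; unfold Re; simpl. lra.
Qed.

Lemma Cder_csum (f : nat -> C -> C) (df : nat -> C) (s : C) (n : nat) :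
  (forall j, Cder (f j) s (df j)) -> Cder (fun s => csum (fun j => f j s) n) s (csum df n).
Proof.
  intro H. induction n as [|n IH]; simpl; [apply Cder_const | apply Cder_plus; [exact IH | apply H]].
Qed.

(** The finite part [emsum] is differentiated term by term, and the series of remainders through its
    summable second-order expansion. The margin between [5] and [4] lets the same [N] serve at all
    [s + h] with [|h| <= 1]. *)
Lemma hzeta_derive (w s : C) (N : nat) : 0 < Re w -> s <> 1 -> (1 <= N)%nat -> 5 <= Re s + INR N ->
  exists l, Cder (hzeta w) s l /\ clim (empart N (dhterm s) w) l.
Proof.
  intros Hw Hs1 HN Hs.
  destruct (emrem_dhterm_bound w s N Hw HN) as [K [HK0 HK]]; [lra|].
  destruct (csum_converges _ K HK0 HK) as [l0 [Hl0 _]].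
  destruct (emrem_quadratic w s N Hw Hs1 HN Hs) as [K2 [HK20 HK2]].
  exists (emsum N (dhterm s) w + l0)%C. split.
  2: { apply (clim_ext (fun K => emsum N (dhterm s) w + csum (fun k => emrem N (dhterm s) (w + INR k)%C) K)%C).
    - intro n. symmetry. apply empart_emrem.
    - apply clim_plus; [apply clim_const | exact Hl0]. }
  assert (L : forall s', 4 <= Re s' + INR N ->
    clim (csum (fun k => emrem N (hterm s') (w + INR k)%C)) (hzeta w s' - emsum N (hterm s') w)%C).
  { intros s' Hs'. apply (clim_ext (fun K => empart N (hterm s') w K - emsum N (hterm s') w)%C).
    - intro n. rewrite empart_emrem. ring.
    - apply clim_minus; [apply hzeta_spec; assumption | apply clim_const]. }
  assert (D1 : Cder (fun s => emsum N (hterm s) w) s (emsum N (dhterm s) w)).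
  { unfold emsum. apply (Cder_csum (fun j s => em_coef j * hterm s j w)%C (fun j => em_coef j * dhterm s j w)%C).
    intro j. eapply Cder_ext_val; [|apply Cder_mult; [apply Cder_const | apply Cder_hterm, Hs1]]. cbv beta. ring. }
  assert (Hd : 0 < Cmod (s - 1)) by (apply Cmod_gt_0, minus_neq_0, Hs1).
  assert (D2 : Cder (fun s => hzeta w s - emsum N (hterm s) w)%C s l0).
  { apply Cder_of_quadratic with (K := 2 * K2) (r := Rmin 1 (Cmod (s - 1) / 2)).
    { apply Rmin_pos; lra. }
    intros h Hh.
    assert (Hh1 : Cmod h <= 1) by (eapply Rle_trans; [exact Hh | apply Rmin_l]).
    assert (Hh2 : Cmod h <= Cmod (s - 1) / 2) by (eapply Rle_trans; [exact Hh | apply Rmin_r]).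
    assert (Hsh : (s + h)%C <> 1).
    { intro E. replace (s - 1)%C with (- h)%C in Hd, Hh2 by (rewrite <- E; ring).
      rewrite Cmod_opp in *. lra. }
    set (u := fun k => (emrem N (hterm (s + h)) (w + INR k) - emrem N (hterm s) (w + INR k) - h * emrem N (dhterm s) (w + INR k))%C).
    destruct (csum_converges u (K2 * (Cmod h * Cmod h))) as [m [Hm Hmb]].
    { generalize (Cmod_ge_0 h); nra. }
    { intro k. exact (HK2 h k Hh1 Hsh). }
    replace (hzeta w (s + h) - emsum N (hterm (s + h)) w - (hzeta w s - emsum N (hterm s) w) - h * l0)%C with m; [lra|].
    apply (clim_unique (csum u)); [exact Hm|].
    apply (clim_ext (fun n => csum (fun k => emrem N (hterm (s + h)) (w + INR k)%C) n
       - csum (fun k => emrem N (hterm s) (w + INR k)%C) n - h * csum (fun k => emrem N (dhterm s) (w + INR k)%C) n)%C).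
    - intro n. unfold u. rewrite !csum_minus, csum_scal. reflexivity.
    - apply clim_minus; [apply clim_minus; apply L | apply clim_scal, Hl0].
      + generalize (Re_plus_ge s h Hh1). lra.
      + lra. }
  apply (is_derive_ext (K := C_AbsRing) (V := C_NormedModule) (fun s => emsum N (hterm s) w + (hzeta w s - emsum N (hterm s) w))%C).
  - intro t. change (emsum N (hterm t) w + (hzeta w t - emsum N (hterm t) w) = hzeta w t)%C. ring.
  - apply Cder_plus; assumption.
Qed.

Lemma Cpower_hterm (s z : C) : s <> 1 -> Cpower z (- s)%C = hterm s 1 z.
Proof.
  intro Hs. unfold hterm, zpow, Cpower. rewrite poch_1 by exact Hs. simpl INR.
  rewrite Cmult_1_l. f_equal. ring.
Qed.

(** For [Re s > 1] all terms of the expansion at [w + n], including the one with [j = 0], tend to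
    [0], so the limit is the plain series. *)
Lemma hzeta_is_hurwitz (w : C) : 0 < Re w -> is_hurwitz_zeta w (hzeta w).
Proof.
  intro Hw. split.
  - intros s Hs. destruct (nat_above (5 - Re s)) as [N [HN1 HN2]].
    destruct (hzeta_derive w s N Hw Hs HN1) as [l [Hl _]]; [lra|]. exists l. exact Hl.
  - intros s Hs.
    assert (Hs1 : s <> 1) by (intros ->; simpl in Hs; lra).
    destruct (nat_above (4 - Re s)) as [N [HN1 HN2]].
    assert (Z := hzeta_spec w s N Hw HN1 ltac:(lra)).
    assert (L : clim (csum (fun k => Cpower (INR k + w) (- s))) (hzeta w s)).
    { replace (hzeta w s) with (hzeta w s - 0)%C by ring.
      apply (clim_ext (fun n => empart N (hterm s) w n - emsum N (hterm s) (w + INR n))%C).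
      - intro n. unfold empart.
        rewrite (csum_ext (fun k => Cpower (INR k + w) (- s)) (fun k => hterm s 1 (w + INR k))).
        + ring.
        + intros j _. rewrite <- Cpower_hterm by exact Hs1. f_equal. ring.
      - apply clim_minus; [exact Z|]. unfold emsum.
        apply (clim_csum (fun j k => em_coef j * hterm s j (w + INR k))%C). intros j _.
        replace (RtoC 0) with (em_coef j * 0)%C by ring. apply clim_scal, clim_hterm; [exact Hw|].
        generalize (pos_INR j). lra. }
    apply clim_shift in L. apply is_lim_seq_spec in L.
    unfold is_series. apply (filterlim_locally_ball_norm (K := C_AbsRing) (U := C_NormedModule)).
    intro eps. destruct (L eps) as [n0 Hn0]. exists n0. intros n Hn. specialize (Hn0 n Hn).
    rewrite Rminus_0_r, Rabs_pos_eq in Hn0 by apply Cmod_ge_0.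
    rewrite <- sum_n_csum in Hn0. exact Hn0.
Qed.

Lemma hurwitz_derivative_limit (n N : nat) (w : C) : 0 < Re w -> (n + 5 <= N)%nat ->
  clim (empart N (dhterm (- INR n)%R) w) (C_derive (fun s => hurwitz_zeta s w) (RtoC (- INR n))).
Proof.
  intros Hw HN. assert (Hn := pos_INR n).
  assert (HN' : INR n + 5 <= INR N) by (replace 5 with (INR 5) by (simpl; lra); rewrite <- plus_INR; apply le_INR; lia).
  destruct (hzeta_derive w (RtoC (- INR n)) N Hw) as [l [Hl1 Hl2]].
  - intro E. apply RtoC_inj in E. lra.
  - lia.
  - simpl. lra.
  - replace (C_derive (fun s => hurwitz_zeta s w) (RtoC (- INR n))) with l; [exact Hl2|].
    symmetry. apply (C_derive_hurwitz w (hzeta w)); [apply hzeta_is_hurwitz, Hw | simpl; lra | exact Hl1].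
Qed.

(** * Improper integrals *)

(** The two ends move independently, as in [is_RInt_gen], and integrability is asked on every
    compact subinterval of the open half-line. *)
Definition is_improper (f : R -> C) (l : C) : Prop :=
  (forall a b, 0 < a -> a <= b -> ex_CInt f a b) /\
  forall eta, 0 < eta -> exists e X, 0 < e /\ forall a b, 0 < a -> a < e -> X < b -> a <= b ->
    Cmod (CInt f a b - l) <= eta.

Lemma is_improper_RInt_gen (f : R -> C) (l : C) : is_improper f l ->
  @is_RInt_gen C_R_NormedModule f (at_right 0) (Rbar_locally p_infty) l.
Proof.
  intros [Hex Hl] P [eps HP].
  destruct (Hl (eps / 2)) as [e [X [He H]]]; [generalize (cond_pos eps); lra|].
  (* Separating the two ends at [1] ensures [a <= b]. *)
  exists (fun a => 0 < a /\ a < Rmin e 1) (fun b => Rmax X 1 < b).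
  - assert (Hm : 0 < Rmin e 1) by (apply Rmin_pos; lra).
    exists (mkposreal _ Hm). intros y Hy Hy0. unfold ball in Hy; simpl in Hy.
    unfold AbsRing_ball, abs, minus, plus, opp in Hy; simpl in Hy.
    rewrite Rabs_pos_eq in Hy by lra. lra.
  - exists (Rmax X 1). intros x Hx. exact Hx.
  - intros a b [Ha1 Ha2] Hb.
    assert (H1 := Rmin_l e 1). assert (H2 := Rmin_r e 1). assert (H3 := Rmax_l X 1). assert (H4 := Rmax_r X 1).
    exists (CInt f a b). split; [apply CInt_correct, Hex; simpl in *; lra|].
    apply HP. apply C_NormedModule_mixin_compat1. change (Cmod (CInt f a b - l)%C < eps).
    eapply Rle_lt_trans; [apply H; lra|]. generalize (cond_pos eps). lra.
Qed.

Lemma is_improper_unique (f : R -> C) (l m : C) : is_improper f l -> is_improper f m -> l = m.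
Proof.
  intros [_ H1] [_ H2].
  assert (Z : Cmod (l - m) <= 0).
  { apply le_epsilon. intros eps Heps. rewrite Rplus_0_l.
    destruct (H1 (eps / 2)) as [e1 [X1 [He1 B1]]]; [lra|].
    destruct (H2 (eps / 2)) as [e2 [X2 [He2 B2]]]; [lra|].
    set (a := Rmin (Rmin e1 e2) 1 / 2). set (b := Rmax (Rmax X1 X2) 1 + 1).
    assert (Ha : 0 < Rmin (Rmin e1 e2) 1) by (repeat apply Rmin_pos; lra).
    assert (A1 := Rmin_l (Rmin e1 e2) 1). assert (A2 := Rmin_r (Rmin e1 e2) 1).
    assert (A3 := Rmin_l e1 e2). assert (A4 := Rmin_r e1 e2).
    assert (C1 := Rmax_l (Rmax X1 X2) 1). assert (C2 := Rmax_r (Rmax X1 X2) 1).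
    assert (C3 := Rmax_l X1 X2). assert (C4 := Rmax_r X1 X2).
    specialize (B1 a b ltac:(unfold a; lra) ltac:(unfold a; lra) ltac:(unfold b; lra) ltac:(unfold a, b; lra)).
    specialize (B2 a b ltac:(unfold a; lra) ltac:(unfold a; lra) ltac:(unfold b; lra) ltac:(unfold a, b; lra)).
    replace (l - m)%C with ((CInt f a b - m) - (CInt f a b - l))%C by ring.
    eapply Rle_trans; [apply Cmod_minus_le|]. lra. }
  assert (E := Cmod_eq_0 _ (Rle_antisym _ _ Z (Cmod_ge_0 _))).
  replace l with (l - m + m)%C by ring. rewrite E. ring.
Qed.

Lemma CInt_ext (f g : R -> C) (a b : R) : a <= b -> (forall x, a < x < b -> f x = g x) ->
  CInt f a b = CInt g a b.
Proof.
  intros Hab H. apply (RInt_ext (V := C_R_CompleteNormedModule)).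
  rewrite Rmin_left, Rmax_right by exact Hab. exact H.
Qed.

Lemma is_improper_ext (f g : R -> C) (l : C) : (forall t, 0 < t -> f t = g t) -> is_improper f l -> is_improper g l.
Proof.
  intros E [H1 H2]. split.
  - intros a b Ha Hab. destruct (H1 a b Ha Hab) as [m Hm]. exists m.
    apply (is_CInt_ext f g a b m Hab); [intros x Hx; apply E; lra | exact Hm].
  - intros eta Heta. destruct (H2 eta Heta) as [e [X [He H]]]. exists e, X. split; [exact He|].
    intros a b Ha Hae Hb Hab. rewrite <- (CInt_ext f g a b Hab); [apply H; assumption|].
    intros x Hx. apply E. lra.
Qed.

Lemma is_improper_minus (f g : R -> C) (l m : C) : is_improper f l -> is_improper g m -> is_improper (fun t => f t - g t)%C (l - m)%C.
Proof.
  intros [F1 F2] [G1 G2]. split.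
  - intros a b Ha Hab. apply (ex_RInt_minus (V := C_R_NormedModule) f g); auto.
  - intros eta Heta.
    destruct (F2 (eta / 2)) as [e1 [X1 [He1 B1]]]; [lra|].
    destruct (G2 (eta / 2)) as [e2 [X2 [He2 B2]]]; [lra|].
    exists (Rmin e1 e2), (Rmax X1 X2). split; [apply Rmin_pos; assumption|].
    intros a b Ha Hae Hb Hab.
    assert (A3 := Rmin_l e1 e2). assert (A4 := Rmin_r e1 e2).
    assert (C3 := Rmax_l X1 X2). assert (C4 := Rmax_r X1 X2).
    rewrite CInt_minus by auto.
    replace (CInt f a b - CInt g a b - (l - m))%C with ((CInt f a b - l) - (CInt g a b - m))%C by ring.
    eapply Rle_trans; [apply Cmod_minus_le|].
    specialize (B1 a b). specialize (B2 a b). lra.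
Qed.

Lemma is_improper_scal (c : C) (f : R -> C) (l : C) : is_improper f l -> is_improper (fun t => c * f t)%C (c * l)%C.
Proof.
  intros [F1 F2]. assert (Hc := Cmod_ge_0 c). split.
  - intros a b Ha Hab. exists (c * CInt f a b)%C. apply is_CInt_scal, CInt_correct; auto.
  - intros eta Heta.
    destruct (F2 (eta / (Cmod c + 1))) as [e1 [X1 [He1 B1]]]; [apply Rdiv_lt_0_compat; lra|].
    exists e1, X1. split; [exact He1|]. intros a b Ha Hae Hb Hab.
    rewrite CInt_scal by auto.
    replace (c * CInt f a b - c * l)%C with (c * (CInt f a b - l))%C by ring.
    rewrite Cmod_mult. specialize (B1 a b Ha Hae Hb Hab).
    apply Rle_trans with ((Cmod c + 1) * (eta / (Cmod c + 1))).
    + apply Rmult_le_compat; try lra. apply Cmod_ge_0.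
    + right. field. lra.
Qed.

Lemma is_improper_plus (f g : R -> C) (l m : C) : is_improper f l -> is_improper g m -> is_improper (fun t => f t + g t)%C (l + m)%C.
Proof.
  intros Hf Hg. replace (l + m)%C with (l - - (1) * m)%C by ring.
  apply (is_improper_ext (fun t => f t - - (1) * g t)%C); [intros; ring|].
  apply is_improper_minus; [exact Hf | apply is_improper_scal, Hg].
Qed.

Lemma is_improper_0 : is_improper (fun _ => RtoC 0) 0.
Proof.
  assert (E : forall a b, a <= b -> is_CInt (fun _ => RtoC 0) a b (RtoC 0)).
  { intros a b Hab.
    assert (H : is_CInt (fun _ => RtoC 0) a b (RtoC 0 - RtoC 0)%C).
    { apply (is_CInt_derive (fun _ => RtoC 0)); [exact Hab | |]; intros x _; [apply Rder_const|].
      apply (Rder_continuous _ x 0), Rder_const. }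
    replace (RtoC 0 - RtoC 0)%C with (RtoC 0) in H by ring. exact H. }
  split.
  - intros a b _ Hab. exists (RtoC 0). apply E, Hab.
  - intros eta Heta. exists 1, 0. split; [lra|]. intros a b _ _ _ Hab.
    rewrite (CInt_unique _ _ _ _ (E a b Hab)). replace (0 - 0)%C with (RtoC 0) by ring. rewrite Cmod_0. lra.
Qed.

Lemma is_improper_csum (f : nat -> R -> C) (l : nat -> C) (n : nat) :
  (forall j, (j < n)%nat -> is_improper (f j) (l j)) -> is_improper (fun t => csum (fun j => f j t) n) (csum l n).
Proof.
  induction n as [|n IH]; intro H; simpl; [apply is_improper_0 | apply is_improper_plus; [apply IH; intros; apply H; lia | apply H; lia]].
Qed.

Lemma CInt_exp_bound (k : R -> C) (B d a b : R) : 0 < d -> 0 <= B -> a <= b -> ex_CInt k a b ->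
  (forall t, a <= t <= b -> Cmod (k t) <= B * exp (- d * t)) ->
  Cmod (CInt k a b) <= B / d * (exp (- d * a) - exp (- d * b)).
Proof.
  intros Hd HB Hab Hex Hk. rewrite <- Cnorm_R.
  apply (norm_RInt_le (V := C_R_NormedModule) k (fun t => B * exp (- d * t)) a b (CInt k a b)); [exact Hab | | |].
  - intros x Hx. rewrite Cnorm_R. apply Hk, Hx.
  - apply CInt_correct, Hex.
  - replace (B / d * (exp (- d * a) - exp (- d * b))) with (minus (- (B / d) * exp (- d * b)) (- (B / d) * exp (- d * a))).
    2: { unfold minus, plus, opp; simpl. ring. }
    apply (is_RInt_derive (V := R_CompleteNormedModule) (fun t => - (B / d) * exp (- d * t))).
    + intros x _. auto_derive; [exact I|]. field. lra.
    + intros x _. apply (is_derive_cont _ x (B * (- d * exp (- d * x)))). auto_derive; [exact I|]. ring.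
Qed.

Lemma exp_diff_le (a b : R) : 0 <= a -> a <= b -> exp (- a) - exp (- b) <= b - a.
Proof.
  intros Ha Hab. replace (- b) with (- a + - (b - a)) by ring. rewrite exp_plus.
  assert (H := exp_ineq1_le (- (b - a))).
  assert (H1 : exp (- a) <= 1) by (rewrite <- exp_0; apply exp_mono; lra).
  assert (H2 := exp_pos (- a)). nra.
Qed.

Lemma exp_neg_le_inv_sqr (x : R) : 0 < x -> exp (- x) <= 4 / (x * x).
Proof.
  intro Hx. rewrite exp_Ropp. assert (H := sqr_le_exp x (Rlt_le _ _ Hx)). assert (He := exp_pos x).
  apply Rmult_le_reg_l with (exp x); [exact He|]. rewrite Rinv_r by lra.
  apply Rmult_le_reg_r with (x * x); [nra|].
  replace (exp x * (4 / (x * x)) * (x * x)) with (4 * exp x) by (field; lra). lra.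
Qed.

Lemma Cplus_cancel_mid (a b c : C) : (a + b + c - b)%C = (a + c)%C.
Proof. ring. Qed.

(** Over the intervals [[1/(m+1), m+1]] successive integrals differ by a multiple of [1/(m+1)^2], so
    they converge; the same estimates at each end then free [a] and [b]. The bound [B / d] on the
    value is later what makes the remainder vanish as [Re z] grows. *)
Lemma is_improper_dominated (k : R -> C) (B d : R) : 0 < d -> 0 <= B ->
  (forall t, 0 < t -> Rcont k t) -> (forall t, 0 < t -> Cmod (k t) <= B * exp (- d * t)) ->
  exists l, is_improper k l /\ Cmod l <= B / d.
Proof.
  intros Hd HB Hc Hk.
  assert (Hex : forall a b, 0 < a -> a <= b -> ex_CInt k a b).
  { intros a b Ha Hab. apply ex_CInt_cont; [exact Hab|]. intros x Hx. apply Hc. lra. }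
  assert (HBd : 0 <= B / d) by (apply Rmult_le_pos; [exact HB | left; apply Rinv_0_lt_compat, Hd]).
  assert (Hbd : forall a b, 0 < a -> a <= b -> Cmod (CInt k a b) <= B / d * (exp (- d * a) - exp (- d * b))).
  { intros a b Ha Hab. apply CInt_exp_bound; auto. intros t Ht. apply Hk. lra. }
  assert (Hlin : forall a b, 0 < a -> a <= b -> Cmod (CInt k a b) <= B * (b - a)).
  { intros a b Ha Hab. eapply Rle_trans; [apply Hbd; assumption|].
    replace (B * (b - a)) with (B / d * (d * b - d * a)) by (field; lra).
    apply Rmult_le_compat_l; [exact HBd|]. rewrite !Ropp_mult_distr_l_reverse. apply exp_diff_le; nra. }
  assert (Htail : forall a b, 0 < a -> a <= b -> Cmod (CInt k a b) <= B / d * exp (- d * a)).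
  { intros a b Ha Hab. eapply Rle_trans; [apply Hbd; assumption|].
    apply Rmult_le_compat_l; [exact HBd|]. generalize (exp_pos (- d * b)). lra. }
  set (lo := fun m : nat => / (INR m + 1)). set (hi := fun m : nat => INR m + 1).
  assert (Hlo : forall m, 0 < lo m) by (intro m; apply Rinv_0_lt_compat; generalize (pos_INR m); lra).
  assert (Hlo1 : forall m, lo m <= 1).
  { intro m. unfold lo. rewrite <- Rinv_1. apply Rinv_le_contravar; generalize (pos_INR m); lra. }
  assert (Hhi1 : forall m, 1 <= hi m) by (intro m; unfold hi; generalize (pos_INR m); lra).
  assert (Split : forall a a' b' b, 0 < a -> a <= a' -> a' <= b' -> b' <= b ->
    CInt k a b = (CInt k a a' + CInt k a' b' + CInt k b' b)%C).
  { intros a a' b' b H1 H2 H3 H4. rewrite (CInt_Chasles k a a' b) by (try apply Hex; lra).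
    rewrite (CInt_Chasles k a' b' b) by (try apply Hex; lra). apply Cplus_assoc. }
  set (u := fun m => CInt k (lo m) (hi m)).
  set (v := fun m => (u (S m) - u m)%C).
  assert (Hlod : forall m, lo (S m) <= lo m).
  { intro m. unfold lo. rewrite S_INR. apply Rinv_le_contravar; generalize (pos_INR m); lra. }
  destruct (csum_converges v (B + B / d * (4 / (d * d)))) as [l [Hl _]].
  - assert (0 < 4 / (d * d)) by (apply Rdiv_lt_0_compat; nra). nra.
  - intro m. assert (Hm := pos_INR m). unfold v, u.
    rewrite (Split (lo (S m)) (lo m) (hi m) (hi (S m))); auto.
    2: { generalize (Hlo1 m) (Hhi1 m); lra. }
    2: { unfold hi. rewrite S_INR. lra. }
    rewrite (Cplus_cancel_mid (CInt k (lo (S m)) (lo m)) (CInt k (lo m) (hi m)) (CInt k (hi m) (hi (S m)))).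
    eapply Rle_trans; [apply Cmod_triangle|]. rewrite Rmult_plus_distr_r. apply Rplus_le_compat.
    + eapply Rle_trans; [apply Hlin; auto|]. apply Rmult_le_compat_l; [exact HB|].
      unfold lo. rewrite S_INR.
      replace (/ (INR m + 1) - / (INR m + 1 + 1)) with (/ ((INR m + 1) * (INR m + 1 + 1))) by (field; lra).
      apply Rinv_le_contravar; nra.
    + eapply Rle_trans; [apply Htail; unfold hi; rewrite ?S_INR; lra|].
      rewrite Rmult_assoc. apply Rmult_le_compat_l; [exact HBd|].
      rewrite Ropp_mult_distr_l_reverse. eapply Rle_trans; [apply exp_neg_le_inv_sqr; unfold hi; nra|].
      right. unfold hi. field. lra.
  - assert (Hu : clim u (u O + l)%C).
    { apply (clim_ext (fun m => u O + csum v m)%C).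
      - intro m. induction m as [|m IH]; [simpl; ring|]. cbn [csum].
        transitivity (u O + csum v m + v m)%C; [ring|]. rewrite IH. unfold v. ring.
      - apply clim_plus; [apply clim_const | exact Hl]. }
    exists (u O + l)%C. split; [split; [exact Hex|] |].
    + intros eta Heta.
      assert (Hev : is_lim_seq (fun m => Cmod (u m - (u O + l))) 0) by exact Hu.
      apply is_lim_seq_spec in Hev. destruct (Hev (mkposreal (eta / 2) ltac:(lra))) as [n1 Hn1].
      destruct (INR_unbounded ((B + B / d * (4 / (d * d))) * 2 / eta)) as [n2 Hn2].
      set (m := (n1 + n2)%nat). exists (lo m), (hi m). split; [apply Hlo|].
      intros a b Ha Ham Hb Hab.
      rewrite (Split a (lo m) (hi m) b); try lra; [|generalize (Hlo1 m) (Hhi1 m); lra].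
      specialize (Hn1 m ltac:(unfold m; lia)). simpl in Hn1. rewrite Rminus_0_r, Rabs_pos_eq in Hn1 by apply Cmod_ge_0.
      replace (CInt k a (lo m) + CInt k (lo m) (hi m) + CInt k (hi m) b - (u O + l))%C
        with (CInt k a (lo m) + CInt k (hi m) b + (u m - (u O + l)))%C by (unfold u; ring).
      eapply Rle_trans; [apply Cmod_triangle|].
      eapply Rle_trans; [apply Rplus_le_compat_r, Cmod_triangle|].
      assert (Hm := pos_INR m).
      assert (H1 : Cmod (CInt k a (lo m)) <= B * lo m).
      { eapply Rle_trans; [apply Hlin; lra|]. apply Rmult_le_compat_l; lra. }
      assert (H2 : Cmod (CInt k (hi m) b) <= B / d * (4 / (d * d)) * lo m).
      { eapply Rle_trans; [apply Htail; unfold hi in *; lra|].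
        rewrite Rmult_assoc. apply Rmult_le_compat_l; [exact HBd|].
        rewrite Ropp_mult_distr_l_reverse. eapply Rle_trans; [apply exp_neg_le_inv_sqr; unfold hi; nra|].
        replace (4 / (d * hi m * (d * hi m))) with (4 / (d * d) * (lo m * lo m)) by (unfold hi, lo; field; lra).
        apply Rmult_le_compat_l; [left; apply Rdiv_lt_0_compat; nra|].
        generalize (Hlo m) (Hlo1 m); nra. }
      assert (H3 : (B + B / d * (4 / (d * d))) * lo m <= eta / 2).
      { assert (INR n2 <= INR m) by (apply le_INR; unfold m; lia).
        apply Rmult_le_reg_r with (INR m + 1); [lra|]. unfold lo. rewrite Rmult_assoc, Rinv_l, Rmult_1_r by lra.
        set (q := B + B / d * (4 / (d * d))) in *.
        replace q with (q * 2 / eta * (eta / 2)) by (field; lra).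
        rewrite (Rmult_comm (eta / 2)). apply Rmult_le_compat_r; lra. }
      lra.
    + apply (clim_bound u); [exact Hu|]. intro m. eapply Rle_trans; [apply Htail; [apply Hlo|]|].
      * generalize (Hlo1 m) (Hhi1 m); lra.
      * rewrite <- (Rmult_1_r (B / d)) at 2. apply Rmult_le_compat_l; [exact HBd|].
        rewrite <- exp_0. apply exp_mono. generalize (Hlo m). nra.
Qed.

Lemma Rabs_mult_self (x : R) : Rabs x * Rabs x = x * x.
Proof. rewrite <- Rabs_mult. apply Rabs_pos_eq, Rle_0_sqr. Qed.

Lemma Rder_of_quadratic (f : R -> C) (x : R) (l : C) (K : R) :
  (forall h, Rabs h <= 1 -> Cmod (f (x + h)%R - f x - h * l)%C <= K * (h * h)) -> Rder f x l.
Proof.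
  intros H. split; [apply is_linear_scal_l|].
  intros y Hy eps.
  assert (y = x) as ->.
  { symmetry. exact (is_filter_lim_locally_unique (K:=R_AbsRing) (V:=R_NormedModule) x y Hy). }
  set (K' := Rmax K 1).
  assert (HK : 1 <= K') by apply Rmax_r. assert (HK2 : K <= K') by apply Rmax_l.
  assert (Hr : 0 < Rmin 1 (eps / K')).
  { apply Rmin_pos; [lra|]. apply Rdiv_lt_0_compat; [apply cond_pos | lra]. }
  exists (mkposreal _ Hr). intros t0 Ht. set (t := t0 : R) in *.
  change (Rabs (t - x) < Rmin 1 (eps / K')) in Ht.
  assert (H1 : Rabs (t - x) < 1) by (eapply Rlt_le_trans; [exact Ht | apply Rmin_l]).
  assert (H2 : Rabs (t - x) < eps / K') by (eapply Rlt_le_trans; [exact Ht | apply Rmin_r]).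
  rewrite Cnorm_R.
  specialize (H (t - x) (Rlt_le _ _ H1)). replace (x + (t - x)) with t in H by ring.
  apply Rle_trans with (Cmod (f t - f x - (t - x)%R * l)).
  { right. apply (f_equal Cmod). destruct (f t) as [a1 a2], (f x) as [b1 b2], l as [l1 l2].
    change ((a1 - b1 - (t - x) * l1, a2 - b2 - (t - x) * l2) = ((a1, a2) - (b1, b2) - RtoC (t - x) * (l1, l2))%C).
    unfold Cminus, Cplus, Copp, Cmult, RtoC; simpl. f_equal; ring. }
  eapply Rle_trans; [exact H|]. change (norm (minus t x)) with (Rabs (t - x)).
  assert (Hq : Rabs (t - x) * K' <= eps).
  { replace (pos eps) with (eps / K' * K') by (field; lra). apply Rmult_le_compat_r; lra. }
  assert (Hsq := Rabs_mult_self (t - x)).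
  generalize (Rabs_pos (t - x)). nra.
Qed.

(** * Laplace integrals over a compact interval, and Taylor's inequality *)

Definition laplace (kk : R -> C) (a b : R) (z : C) : C := CInt (fun t => kk t * Cexp (- (z * t)))%C a b.

Lemma Rcont_Cexp_lin (z : C) (t : R) : Rcont (fun t => Cexp (- (z * t))) t.
Proof.
  apply (Rder_continuous _ t (- (z * 1) * Cexp (- (z * t)))%C).
  apply Rder_Cexp, Rder_opp, Rder_scal_l, Rder_id.
Qed.

(** On a compact interval [Cexp_bound2] is uniform in [t], so the second-order error passes under
    the integral. *)
Lemma Rder_laplace (kk : R -> C) (a b : R) (z0 v : C) (x : R) : 0 < a -> a <= b ->
  (forall t, 0 < t -> Rcont kk t) ->
  Rder (fun x => laplace kk a b (z0 + x * v)) x (- (v * laplace (fun t => kk t * t)%C a b (z0 + x * v)))%C.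
Proof.
  intros Ha Hab Hc.
  destruct (Rcont_bounded kk a b Hab) as [Mk [HMk0 HMk]]; [intros; apply Hc; lra|].
  set (z := (z0 + x * v)%C).
  set (E := exp (Cmod z * b)). set (V := Cmod v * b).
  assert (HV : 0 <= V) by (unfold V; generalize (Cmod_ge_0 v); nra).
  apply (Rder_of_quadratic _ _ _ ((b - a) * (Mk * (E * (V * V * exp V))))).
  intros h Hh.
  assert (Hex : forall z, ex_CInt (fun t => kk t * Cexp (- (z * t)))%C a b).
  { intro z'. apply ex_CInt_cont; [exact Hab|]. intros t Ht. apply Rcont_mult; [apply Hc; lra | apply Rcont_Cexp_lin]. }
  assert (Hex2 : ex_CInt (fun t => kk t * t * Cexp (- (z * t)))%C a b).
  { apply ex_CInt_cont; [exact Hab|]. intros t Ht. apply Rcont_mult; [apply Rcont_mult; [apply Hc; lra|] | apply Rcont_Cexp_lin].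
    apply (Rder_continuous _ t 1), Rder_id. }
  replace (z0 + (x + h)%R * v)%C with (z + h * v)%C by (unfold z; rewrite RtoC_plus; ring).
  fold z. unfold laplace.
  replace (h * - (v * CInt (fun t => kk t * t * Cexp (- (z * t)))%C a b))%C
    with (- (h * v) * CInt (fun t => kk t * t * Cexp (- (z * t)))%C a b)%C by ring.
  rewrite <- CInt_scal by exact Hex2. rewrite <- CInt_minus by apply Hex.
  rewrite <- CInt_minus.
  2: { apply (ex_RInt_minus (V := C_R_NormedModule)); apply Hex. }
  2: { eexists. apply is_CInt_scal, CInt_correct, Hex2. }
  replace ((b - a) * (Mk * (E * (V * V * exp V))) * (h * h)) with ((b - a) * (Mk * (E * ((h * h) * (V * V * exp V))))) by ring.
  apply CInt_bound; [exact Hab | |].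
  { apply (ex_RInt_minus (V := C_R_NormedModule)).
    - apply (ex_RInt_minus (V := C_R_NormedModule)); apply Hex.
    - eexists. apply is_CInt_scal, CInt_correct, Hex2. }
  intros t Ht.
  set (y := (- (h * v * t))%C).
  replace (Cexp (- ((z + h * v) * t))) with (Cexp (- (z * t)) * Cexp y)%C.
  2: { rewrite <- Cexp_plus. f_equal. unfold y. ring. }
  replace (_ - _ - _)%C with (kk t * (Cexp (- (z * t)) * (Cexp y - 1 - y)))%C by (unfold y; ring).
  rewrite !Cmod_mult. apply Rmult_le_compat; [apply Cmod_ge_0 | apply Rmult_le_pos; apply Cmod_ge_0 | apply HMk, Ht |].
  assert (Hz0 := Cmod_ge_0 z). assert (Hv0 := Cmod_ge_0 v).
  apply Rmult_le_compat; try apply Cmod_ge_0.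
  - rewrite Cmod_Cexp. apply exp_mono. eapply Rle_trans; [apply Re_le_Cmod|].
    rewrite Cmod_opp, Cmod_mult, Cmod_R, Rabs_pos_eq by lra. nra.
  - assert (Hy : Cmod y <= Rabs h * V).
    { unfold y, V. rewrite Cmod_opp, !Cmod_mult, !Cmod_R, (Rabs_pos_eq t) by lra.
      rewrite Rmult_assoc. apply Rmult_le_compat_l; [apply Rabs_pos|]. nra. }
    assert (Hr := Rabs_pos h). assert (Hy0 := Cmod_ge_0 y).
    eapply Rle_trans; [apply Cexp_bound2|].
    replace (h * h * (V * V * exp V)) with ((Rabs h * V) * (Rabs h * V) * exp V).
    2: { rewrite <- (Rabs_mult_self h). ring. }
    assert (HhV : Rabs h * V <= V) by (rewrite <- (Rmult_1_l V) at 2; apply Rmult_le_compat_r; assumption).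
    apply Rmult_le_compat; [nra | left; apply exp_pos | apply Rmult_le_compat; assumption | apply exp_mono; lra].
Qed.

(** Downward induction from the top member [D M]: subtracting the Taylor polynomial makes the
    difference vanish at [0], and its derivative is [- v] times the difference one level up, where
    the mean value inequality takes its bound. *)
Lemma taylor_chain (D : nat -> R -> C) (v : C) (M : nat) (eta : R) :
  (forall j x, 0 <= x <= 1 -> Rder (D j) x (- (v * D (S j) x))%C) ->
  (forall x, 0 <= x <= 1 -> Cmod (D M x) <= eta) ->
  forall m j x, (j + m = M)%nat -> 0 <= x <= 1 ->
    Cmod (D j x - taylor (fun i => D i 0) M j (0 + x * - v))%C <= Cmod v ^ m * eta.
Proof.
  intros HD HM m. induction m as [|m IH]; intros j x Hj Hx.
  - replace j with M by lia. unfold taylor. rewrite Nat.sub_diag. simpl.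
    replace (D M x - 0)%C with (D M x) by ring. rewrite Rmult_1_l. apply HM, Hx.
  - set (f := fun x : R => (D j x - taylor (fun i => D i 0) M j (0 + x * - v))%C).
    assert (F0 : f 0 = 0).
    { unfold f. replace (0 + 0 * - v)%C with (RtoC 0) by ring. rewrite taylor_at_0 by lia. ring. }
    change (Cmod (f x) <= Cmod v ^ S m * eta).
    replace (f x) with (f x - f 0)%C by (rewrite F0; ring).
    assert (Hv := Cmod_ge_0 v).
    assert (He : 0 <= Cmod v ^ m * eta).
    { eapply Rle_trans; [apply Cmod_ge_0 | apply (IH (S j) 0 ltac:(lia) ltac:(lra))]. }
    assert (He' : 0 <= Cmod v ^ S m * eta) by (simpl; rewrite Rmult_assoc; apply Rmult_le_pos; assumption).
    apply Rle_trans with (Cmod v ^ S m * eta * (x - 0)).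
    2: { rewrite <- (Rmult_1_r (Cmod v ^ S m * eta)) at 2. apply Rmult_le_compat_l; lra. }
    apply (Rder_mvt f (fun x => - (v * (D (S j) x - taylor (fun i => D i 0) M (S j) (0 + x * - v))))%C 0 x); [lra | |].
    + intros y Hy. unfold f.
      eapply Rder_ext_val; [|apply Rder_minus; [apply HD; lra | apply Rder_taylor]]. ring.
    + intros y Hy. rewrite Cmod_opp, Cmod_mult. simpl. rewrite Rmult_assoc.
      apply Rmult_le_compat_l; [exact Hv | apply IH; [lia | lra]].
Qed.

(** * Regularized Laplace integrals *)

Definition neg_nat (n : nat) : C := RtoC (- INR n).
(* [(-1)^n n!], the derivative of [1 / Gamma] at [-n]. *)
Definition reg_coef (n : nat) : C := poch (neg_nat n) (S n).
(** The power [t^(j - n - 2)], which is [t^(s-1) t^(j-1)] at [s = -n]; it is a quotient because the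
    exponent is negative for [j < n + 2]. *)
Definition tpow (n j : nat) (t : C) : C := (t ^ j / t ^ (S (S n)))%C.

Lemma poch_vanish (n : nat) : poch (neg_nat n) (S (S n)) = 0.
Proof.
  change (reg_coef n * (neg_nat n + INR (S n) - 1) = 0)%C. unfold neg_nat.
  rewrite S_INR, RtoC_opp, RtoC_plus. ring.
Qed.

Lemma dpoch_top (n : nat) : dpoch (neg_nat n) (S (S n)) = reg_coef n.
Proof.
  change (dpoch (neg_nat n) (S n) * (neg_nat n + INR (S n) - 1) + reg_coef n = reg_coef n)%C. unfold neg_nat.
  rewrite S_INR, RtoC_opp, RtoC_plus. ring.
Qed.

(** At [s = -n] the rising factorial vanishes at index [n + 2], so the logarithm drops out and only
    the derivative of the factorial remains. At the same index [tpow] is [1], and both sides of the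
    comparison become elementary. *)
Lemma dhterm_top (n : nat) (z : C) : 0 < Re z -> dhterm (neg_nat n) (S (S n)) z = (reg_coef n / z)%C.
Proof.
  intro Hz. unfold dhterm. rewrite poch_vanish, dpoch_top. unfold zpow.
  replace (- (neg_nat n + INR (S (S n)) - 1) * Clog z)%C with (- Clog z)%C.
  - rewrite Cexp_opp, Cexp_Clog by exact Hz. unfold Cdiv. ring.
  - unfold neg_nat. rewrite !S_INR, RtoC_opp, !RtoC_plus. ring.
Qed.

Lemma Rcont_inv (f : R -> C) (x : R) : f x <> 0 -> Rcont f x -> Rcont (fun t => / f t)%C x.
Proof.
  intros H Hf. apply (continuous_comp f (fun z => / z)%C x Hf).
  apply (Cder_cont _ _ _ (Cder_inv (f x) H)).
Qed.

Lemma Rcont_id (x : R) : Rcont (fun t => RtoC t) x.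
Proof. apply (Rder_continuous _ x 1), Rder_id. Qed.

Lemma Rcont_const (c : C) (x : R) : Rcont (fun _ => c) x.
Proof. apply (Rder_continuous _ x 0), Rder_const. Qed.

Lemma Rcont_minus (f g : R -> C) (x : R) : Rcont f x -> Rcont g x -> Rcont (fun t => f t - g t)%C x.
Proof. apply (continuous_minus (V := C_R_NormedModule)). Qed.

Lemma Rcont_plus (f g : R -> C) (x : R) : Rcont f x -> Rcont g x -> Rcont (fun t => f t + g t)%C x.
Proof. apply (continuous_plus (V := C_R_NormedModule)). Qed.

Lemma Rcont_pow (j : nat) (x : R) : Rcont (fun t => RtoC t ^ j)%C x.
Proof.
  induction j as [|j IH]; simpl; [apply Rcont_const | apply Rcont_mult; [apply Rcont_id | exact IH]].
Qed.

Lemma RtoC_pow_neq_0 (t : R) (j : nat) : 0 < t -> (RtoC t ^ j)%C <> 0.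
Proof.
  intro Ht. apply Cmod_gt_0. rewrite Cmod_pow, Cmod_R, Rabs_pos_eq by lra. apply pow_lt, Ht.
Qed.

Lemma Rcont_tpow (n j : nat) (t : R) : 0 < t -> Rcont (fun t => tpow n j t) t.
Proof.
  intro Ht. unfold tpow, Cdiv. apply Rcont_mult; [apply Rcont_pow|].
  apply Rcont_inv; [apply RtoC_pow_neq_0, Ht | apply Rcont_pow].
Qed.

Lemma tpow_S (n j : nat) (t : C) : tpow n (S j) t = (tpow n j t * t)%C.
Proof. unfold tpow, Cdiv. simpl. ring. Qed.

Lemma tpow_top (n : nat) (t : R) : 0 < t -> tpow n (S (S n)) t = 1.
Proof. intro Ht. unfold tpow. field. apply RtoC_pow_neq_0, Ht. Qed.

Lemma laplace_tpow_S (n j : nat) (a b : R) (z : C) : a <= b ->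
  laplace (fun t => tpow n j t * t)%C a b z = laplace (fun t => tpow n (S j) t) a b z.
Proof.
  intro Hab. apply CInt_ext; [exact Hab|]. intros x _. rewrite tpow_S. reflexivity.
Qed.

Lemma is_CInt_Cexp (z : C) (a b : R) : z <> 0 -> a <= b ->
  is_CInt (fun t => Cexp (- (z * t))) a b ((Cexp (- (z * a)) - Cexp (- (z * b))) / z)%C.
Proof.
  intros Hz Hab.
  assert (H : is_CInt (fun t => Cexp (- (z * t))) a b (- / z * Cexp (- (z * b)) - - / z * Cexp (- (z * a)))%C).
  { apply (is_CInt_derive (fun t => - / z * Cexp (- (z * t)))%C); [exact Hab | |].
    - intros x _. eapply Rder_ext_val; [|apply Rder_scal_l, Rder_Cexp, Rder_opp, Rder_scal_l, Rder_id].
      cbv beta. field. exact Hz.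
    - intros x _. apply Rcont_Cexp_lin. }
  replace ((Cexp (- (z * a)) - Cexp (- (z * b))) / z)%C with (- / z * Cexp (- (z * b)) - - / z * Cexp (- (z * a)))%C
    by (field; exact Hz).
  exact H.
Qed.

Lemma exp_neg_le_inv (y : R) : 0 < y -> exp (- y) <= / y.
Proof.
  intro Hy. rewrite exp_Ropp. apply Rinv_le_contravar; [exact Hy|]. generalize (exp_ineq1_le y). lra.
Qed.

(** The error depends on [z] only through [d] and [W], so it holds uniformly along the segment from
    [1] to the point of interest. *)
Lemma CInt_Cexp_limit (z : C) (a b d W : R) : 0 < d -> d <= Re z -> Cmod z <= W -> 0 < a -> a <= 1 -> a <= b ->
  Cmod (CInt (fun t => Cexp (- (z * t))) a b - / z)%C <= / d * (W * exp W * a + / (d * b)).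
Proof.
  intros Hd Hdz HW Ha Ha1 Hab.
  assert (Hz0 : z <> 0) by (apply C_neq_0_of_Re; lra).
  assert (Hzm : d <= Cmod z) by (generalize (Re_le_Cmod z); lra).
  rewrite (CInt_unique _ _ _ _ (is_CInt_Cexp z a b Hz0 Hab)).
  replace ((Cexp (- (z * a)) - Cexp (- (z * b))) / z - / z)%C
    with (/ z * ((Cexp (- (z * a)) - 1) - Cexp (- (z * b))))%C by (field; exact Hz0).
  rewrite Cmod_mult, Cmod_inv by exact Hz0.
  apply Rmult_le_compat; [left; apply Rinv_0_lt_compat; lra | apply Cmod_ge_0 | apply Rinv_le_contravar; lra |].
  eapply Rle_trans; [apply Cmod_minus_le|]. apply Rplus_le_compat.
  - eapply Rle_trans; [apply Cexp_bound1|].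
    rewrite Cmod_opp, Cmod_mult, Cmod_R, Rabs_pos_eq by lra.
    assert (exp (Cmod z * a) <= exp W) by (apply exp_mono; nra).
    assert (Hp := exp_pos (Cmod z * a)).
    replace (W * exp W * a) with (W * a * exp W) by ring.
    apply Rmult_le_compat; nra.
  - rewrite Cmod_Cexp. eapply Rle_trans; [|apply exp_neg_le_inv; nra].
    apply exp_mono. replace (Re (- (z * b))%C) with (- (Re z * b)) by (destruct z; unfold Re; simpl; ring).
    nra.
Qed.

Lemma is_improper_Cexp : is_improper (fun t => Cexp (- (t : C))) 1.
Proof.
  apply (is_improper_ext (fun t => Cexp (- (1 * t)))); [intros t _; f_equal; ring|].
  split.
  - intros a b Ha Hab. apply ex_CInt_cont; [exact Hab|]. intros x _. apply Rcont_Cexp_lin.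
  - intros eta Heta. set (W := exp 1). assert (HW : 0 < W) by apply exp_pos.
    exists (Rmin 1 (eta / (2 * W))), (2 / eta).
    assert (H1 : 0 < eta / (2 * W)) by (apply Rdiv_lt_0_compat; lra).
    assert (H2 : 0 < 2 / eta) by (apply Rdiv_lt_0_compat; lra).
    split; [apply Rmin_pos; lra|]. intros a b Ha Ham Hb Hab.
    assert (M1 := Rmin_l 1 (eta / (2 * W))). assert (M2 := Rmin_r 1 (eta / (2 * W))).
    assert (L : Cmod (CInt (fun t => Cexp (- (1 * t))) a b - / 1)%C <= / 1 * (1 * exp 1 * a + / (1 * b))).
    { apply CInt_Cexp_limit; simpl; try lra. rewrite Cmod_1. lra. }
    replace (/ 1)%C with (RtoC 1) in L by field.
    eapply Rle_trans; [exact L|].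
    fold W. rewrite Rinv_1, !Rmult_1_l.
    assert (W * a <= eta / 2).
    { replace (eta / 2) with (W * (eta / (2 * W))) by (field; lra). apply Rmult_le_compat_l; lra. }
    assert (/ b <= eta / 2).
    { replace (eta / 2) with (/ (2 / eta)) by (field; lra). apply Rinv_le_contravar; lra. }
    lra.
Qed.

Lemma is_CInt_csum (f : nat -> R -> C) (l : nat -> C) (a b : R) (n : nat) : a <= b ->
  (forall j, is_CInt (f j) a b (l j)) -> is_CInt (fun t => csum (fun j => f j t) n) a b (csum l n).
Proof.
  intros Hab H. induction n as [|n IH]; simpl.
  - assert (Z := is_CInt_scal 0 (f O) a b (l O) (H O)). rewrite Cmult_0_l in Z.
    eapply is_CInt_ext; [exact Hab | | exact Z]. intros; cbv beta. ring.
  - apply (is_RInt_plus (V := C_R_NormedModule)); [exact IH | apply H].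
Qed.

Lemma taylor_lin (c : C) (x y : nat -> C) (M j : nat) (u : C) :
  taylor (fun i => c * x i - y i)%C M j u = (c * taylor x M j u - taylor y M j u)%C.
Proof.
  unfold taylor. rewrite <- csum_scal, <- csum_minus. apply csum_ext. intros k _. ring.
Qed.

(** The subtracted sum is the Taylor polynomial in [z] at [1] of [tpow n j t * Cexp (- (z * t))],
    with last power [t^(-1)]; what remains is bounded near [t = 0]. The variable is [1 - z] because
    differentiation in [z] brings down [-t]. *)
Definition reg_part (n j : nat) (z t : C) : C :=
  (reg_coef n * (tpow n j t * Cexp (- (z * t)) - taylor (fun i => tpow n i t * Cexp (- (1 * t))) (S (S n)) j (1 - z)))%C.

(** The polynomial [q_j] of the overview: the same Taylor polynomial, formed from the values of
    [dhterm] at [1]. *)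
Definition reg_value (n j : nat) (z : C) : C := taylor (fun i => dhterm (neg_nat n) i 1) (S (S n)) j (1 - z).

(* Along the segment from [1] to [z] both sides, truncated to [[a, b]], form a chain
   [D_j' = - v D_(j+1)] ending in the elementary integral of [Cexp (- (z * t))]. *)
Lemma is_improper_reg_part (n j : nat) (z : C) : 0 < Re z -> (j <= S (S n))%nat ->
  is_improper (fun t => reg_part n j z t) (dhterm (neg_nat n) j z - reg_value n j z)%C.
Proof.
  intros Hz Hj. set (M := S (S n)) in *. set (v := (z - 1)%C).
  assert (Hlap : forall i a b u, 0 < a -> a <= b -> is_CInt (fun t => tpow n i t * Cexp (- (u * t)))%C a b (laplace (fun t => tpow n i t) a b u)).
  { intros i a b u Ha Hab. apply CInt_correct, ex_CInt_cont; [exact Hab|].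
    intros t Ht. apply Rcont_mult; [apply Rcont_tpow; lra | apply Rcont_Cexp_lin]. }
  assert (Hint : forall a b, 0 < a -> a <= b -> is_CInt (fun t => reg_part n j z t) a b
     (reg_coef n * (laplace (fun t => tpow n j t) a b z - taylor (fun i => laplace (fun t => tpow n i t) a b 1) M j (1 - z)))%C).
  { intros a b Ha Hab. apply is_CInt_scal. apply (is_RInt_minus (V := C_R_NormedModule)); [apply Hlap; assumption|].
    unfold taylor. apply (is_CInt_csum (fun k t => taylor_term (1 - z) k * (tpow n (j + k) t * Cexp (- (1 * t))))%C
      (fun k => taylor_term (1 - z) k * laplace (fun t => tpow n (j + k) t) a b 1)%C); [exact Hab|].
    intro k. apply is_CInt_scal, Hlap; assumption. }
  set (d := Rmin 1 (Re z)).
  assert (Hd : 0 < d) by (apply Rmin_pos; lra).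
  assert (Hd1 : d <= 1) by apply Rmin_l. assert (Hd2 : d <= Re z) by apply Rmin_r.
  set (W := 1 + Cmod v). assert (HW : 1 <= W) by (unfold W; generalize (Cmod_ge_0 v); lra).
  set (path := fun x : R => (1 + x * v)%C).
  assert (Hpath : forall x, 0 <= x <= 1 -> d <= Re (path x) /\ Cmod (path x) <= W).
  { intros x Hx. split.
    - unfold path, v. destruct z as [z1 z2]. unfold Re in *; simpl in *. nra.
    - unfold path, W. eapply Rle_trans; [apply Cmod_triangle|]. rewrite Cmod_1, Cmod_mult, Cmod_R, Rabs_pos_eq by lra.
      generalize (Cmod_ge_0 v). nra. }
  split.
  { intros a b Ha Hab. eexists. apply Hint; assumption. }
  intros eta Heta.
  set (G := (Cmod v ^ (M - j) + 1) * (Cmod (reg_coef n) + 1) * / d).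
  assert (Hv0 : 0 <= Cmod v ^ (M - j)) by (apply pow_le, Cmod_ge_0).
  assert (Hc0 := Cmod_ge_0 (reg_coef n)). assert (Hd0 : 0 < / d) by (apply Rinv_0_lt_compat, Hd).
  assert (HG : 0 < G) by (unfold G; apply Rmult_lt_0_compat; [apply Rmult_lt_0_compat; lra | exact Hd0]).
  assert (HE : 0 < W * exp W) by (generalize (exp_pos W); nra).
  assert (H1 : 0 < eta / (2 * G * (W * exp W))) by (apply Rdiv_lt_0_compat; [lra | apply Rmult_lt_0_compat; lra]).
  assert (H2 : 0 < 2 * G / (eta * d)) by (apply Rdiv_lt_0_compat; [lra | apply Rmult_lt_0_compat; lra]).
  exists (Rmin 1 (eta / (2 * G * (W * exp W)))), (2 * G / (eta * d)).
  split; [apply Rmin_pos; lra|]. intros a b Ha Ham Hb Hab.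
  assert (M1 := Rmin_l 1 (eta / (2 * G * (W * exp W)))). assert (M2 := Rmin_r 1 (eta / (2 * G * (W * exp W)))).
  rewrite (CInt_unique _ _ _ _ (Hint a b Ha Hab)).
  set (D := fun j x => (reg_coef n * laplace (fun t => tpow n j t) a b (path x) - dhterm (neg_nat n) j (path x))%C).
  set (B := / d * (W * exp W * a + / (d * b))).
  assert (HB0 : 0 <= B).
  { unfold B. apply Rmult_le_pos; [lra|]. apply Rplus_le_le_0_compat; [nra|]. left. apply Rinv_0_lt_compat. nra. }
  assert (P0 : path 0 = 1) by (unfold path; ring).
  assert (P1 : path 1 = z) by (unfold path, v; ring).
  (* The integrals in [D] may diverge as [a] tends to [0]. What is controlled is their difference
     with the Taylor polynomial taken at the start of the path, and that difference is the
     regularized integral minus its expected value. *)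
  assert (TC : Cmod (D j 1 - taylor (fun i => D i 0) M j (0 + 1 * - v))%C <= Cmod v ^ (M - j) * (Cmod (reg_coef n) * B)).
  { apply (taylor_chain D v M); [| | lia | lra].
  - intros i x Hx. unfold D. destruct (Hpath x Hx) as [Hp1 Hp2].
    eapply Rder_ext_val; [|apply Rder_minus; [apply Rder_scal_l, Rder_laplace; [exact Ha | exact Hab | intros; apply Rcont_tpow; assumption] |]].
    2: { apply Rder_dhterm. fold (path x). lra. }
    fold (path x). cbv beta. rewrite laplace_tpow_S by exact Hab. ring.
  (* The top member is the error of the integral of [e^(-zt)] over [[a, b]] against [1 / z]. *)
  - intros x Hx. destruct (Hpath x Hx) as [Hp1 Hp2]. unfold D. rewrite dhterm_top by lra.
    replace (laplace (fun t => tpow n M t) a b (path x)) with (CInt (fun t => Cexp (- (path x * t))) a b).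
    2: { apply CInt_ext; [exact Hab|]. intros t Ht. unfold M. rewrite tpow_top by lra. symmetry. apply Cmult_1_l. }
    unfold Cdiv.
    replace (reg_coef n * CInt (fun t => Cexp (- (path x * t))) a b - reg_coef n * / path x)%C
      with (reg_coef n * (CInt (fun t => Cexp (- (path x * t))) a b - / path x))%C by ring.
    rewrite Cmod_mult. apply Rmult_le_compat_l; [exact Hc0|].
    apply CInt_Cexp_limit; try assumption. lra. }
  assert (Ey : (0 + 1 * - v)%C = (1 - z)%C) by (unfold v; ring).
  assert (ED : D j 1 = (reg_coef n * laplace (fun t => tpow n j t) a b z - dhterm (neg_nat n) j z)%C) by (unfold D; rewrite P1; reflexivity).
  assert (ED0 : taylor (fun i => D i 0) M j (1 - z) =
    (reg_coef n * taylor (fun i => laplace (fun t => tpow n i t) a b 1) M j (1 - z) - taylor (fun i => dhterm (neg_nat n) i 1) M j (1 - z))%C).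
  { unfold D. rewrite P0. apply taylor_lin. }
  rewrite Ey, ED, ED0 in TC.
  replace (reg_coef n * (laplace (fun t => tpow n j t) a b z - taylor (fun i => laplace (fun t => tpow n i t) a b 1) M j (1 - z)) - (dhterm (neg_nat n) j z - reg_value n j z))%C
    with (reg_coef n * laplace (fun t => tpow n j t) a b z - dhterm (neg_nat n) j z -
       (reg_coef n * taylor (fun i => laplace (fun t => tpow n i t) a b 1) M j (1 - z) - taylor (fun i => dhterm (neg_nat n) i 1) M j (1 - z)))%C
    by (unfold reg_value; fold M; ring).
  eapply Rle_trans; [apply TC|].
  apply Rle_trans with (G * (W * exp W * a + / (d * b))).
    - unfold B, G.
      set (Y := W * exp W * a + / (d * b)).
      assert (HY : 0 <= Y). { unfold Y. apply Rplus_le_le_0_compat; [nra|]. left. apply Rinv_0_lt_compat. nra. }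
      replace (Cmod v ^ (M - j) * (Cmod (reg_coef n) * (/ d * Y))) with (Cmod v ^ (M - j) * Cmod (reg_coef n) * / d * Y) by ring.
      apply Rmult_le_compat_r; [exact HY|]. apply Rmult_le_compat_r; [lra|].
      apply Rmult_le_compat; lra.
    - assert (G * (W * exp W * a) <= eta / 2).
      { replace (eta / 2) with (G * (W * exp W * (eta / (2 * G * (W * exp W))))) by (field; repeat split; generalize (exp_pos W); lra).
        apply Rmult_le_compat_l; [lra|]. apply Rmult_le_compat_l; lra. }
      assert (G * / (d * b) <= eta / 2).
      { replace (eta / 2) with (G * / (d * (2 * G / (eta * d)))) by (field; repeat split; lra).
        apply Rmult_le_compat_l; [lra|]. apply Rinv_le_contravar; nra. }
      lra.
Qed.

(** * The derivative of the Hurwitz zeta function as an integral *)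

Definition period_integrand (n : nat) (z t : C) : C :=
  (reg_coef n * (t / (1 - Cexp (- t)) / t ^ (S (S n)) * Cexp (- (z * t))
    - csum (fun j => em_coef j * taylor (fun i => tpow n i t * Cexp (- (1 * t))) (S (S n)) j (1 - z)) (S (S n))))%C.

Definition reg_sum (n : nat) (z : C) : C := csum (fun j => em_coef j * reg_value n j z)%C (S (S n)).

Definition em_tail (n : nat) (t : C) : C :=
  (t / (1 - Cexp (- t)) / t ^ (S (S n)) - csum (fun j => em_coef j * tpow n j t) (S (S n)))%C.

Lemma period_integrand_split (n : nat) (z t : C) :
  period_integrand n z t = (csum (fun j => em_coef j * reg_part n j z t) (S (S n)) + reg_coef n * (em_tail n t * Cexp (- (z * t))))%C.
Proof.
  unfold period_integrand, em_tail, reg_part.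
  rewrite (csum_ext (fun j => em_coef j * (reg_coef n * _))%C (fun j => reg_coef n * Cexp (- (z * t)) * (em_coef j * tpow n j t)
     - reg_coef n * (em_coef j * taylor (fun i => tpow n i t * Cexp (- (1 * t))) (S (S n)) j (1 - z)))%C)
    by (intros; ring).
  rewrite csum_minus, !csum_scal. ring.
Qed.

Lemma one_minus_Cexp (t : R) : (1 - Cexp (- (t : C)))%C = RtoC (1 - exp (- t)).
Proof. rewrite <- RtoC_opp, Cexp_RtoC, <- RtoC_minus. reflexivity. Qed.

Lemma one_minus_exp_pos (t : R) : 0 < t -> 0 < 1 - exp (- t).
Proof. intro Ht. assert (exp (- t) < exp 0) by (apply exp_increasing; lra). rewrite exp_0 in *. lra. Qed.

Lemma div_one_minus_exp_le (t : R) : 0 < t -> t / (1 - exp (- t)) <= 1 + t.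
Proof.
  intro Ht. assert (H := one_minus_exp_pos t Ht).
  apply Rmult_le_reg_r with (1 - exp (- t)); [exact H|].
  unfold Rdiv. rewrite Rmult_assoc, Rinv_l, Rmult_1_r by lra.
  assert (H1 : exp (- t) * (1 + t) <= 1).
  { rewrite exp_Ropp. assert (H2 := exp_ineq1_le t). assert (H3 := exp_pos t).
    apply Rmult_le_reg_l with (exp t); [exact H3|]. rewrite <- Rmult_assoc, Rinv_r by lra. lra. }
  lra.
Qed.

(** The chain [t^j e^(-tx)] turns the Euler-Maclaurin formula into the expansion of
    [t / (1 - e^(-t))], with an error valid for every [t > 0]. The order [n + 2], one term beyond
    those subtracted in [em_tail], gives an error of size [t^(n+3)], which survives division by
    [t^(n+2)] and by [1 - e^(-t)]; the extra term contributes a constant. *)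
Lemma em_tail_bound (n : nat) : exists B, 0 <= B /\ forall t : R, 0 < t -> Cmod (em_tail n t) <= B * (1 + t).
Proof.
  set (M := S (S n)).
  destruct (euler_maclaurin M) as [Bm [HB HE]]; [unfold M; lia|].
  exists (Bm + Cmod (em_coef M)). assert (He := Cmod_ge_0 (em_coef M)).
  split; [lra|]. intros t Ht.
  assert (Hq := one_minus_exp_pos t Ht).
  assert (Hden : RtoC (1 - exp (- t)) <> 0) by (intro E; apply RtoC_inj in E; lra).
  assert (HtM := RtoC_pow_neq_0 t M Ht).
  specialize (HE (fun j x => RtoC t ^ j * Cexp (- (t * x)))%C (t ^ S M)).
  cbv beta in HE.
  assert (E : Cmod (RtoC t - RtoC (1 - exp (- t)) * csum (fun j => em_coef j * RtoC t ^ j)%C (S M))%C <= Bm * t ^ S M).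
  { replace (RtoC t - RtoC (1 - exp (- t)) * csum (fun j => em_coef j * RtoC t ^ j)%C (S M))%C
     with (RtoC t ^ 1 * Cexp (- (t * 0)) - csum (fun j => em_coef j * (RtoC t ^ j * Cexp (- (t * 0)) - RtoC t ^ j * Cexp (- (t * 1)))) (S M))%C.
    - apply HE.
      + intros j x _. eapply Rder_ext_val; [|apply Rder_scal_l, Rder_Cexp, Rder_opp, Rder_scal_l, Rder_id].
        cbv beta. simpl. ring.
      + intros x Hx. rewrite Cmod_mult, Cmod_pow, Cmod_R, Rabs_pos_eq, Cmod_Cexp by lra.
        rewrite <- (Rmult_1_r (t ^ S M)) at 2. apply Rmult_le_compat_l; [apply pow_le; lra|].
        rewrite <- exp_0. apply exp_mono. simpl. nra.
    - rewrite <- csum_scal. replace (- (t * 0))%C with (RtoC 0) by ring. rewrite Cexp_0.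
      rewrite <- one_minus_Cexp. replace (t * 1)%C with (RtoC t) by ring. f_equal; [simpl; ring|].
      apply csum_ext. intros j _. ring. }
  assert (Er : em_tail n t = ((RtoC t - RtoC (1 - exp (- t)) * csum (fun j => em_coef j * RtoC t ^ j)%C (S M)) / RtoC (1 - exp (- t)) / RtoC t ^ M + em_coef M)%C).
  { unfold em_tail. fold M. rewrite one_minus_Cexp.
    rewrite (csum_ext (fun j => em_coef j * tpow n j t)%C (fun j => / RtoC t ^ M * (em_coef j * RtoC t ^ j))%C).
    2: { intros j _. unfold tpow. fold M. unfold Cdiv. ring. }
    rewrite csum_scal. cbn [csum]. field. split; assumption. }
  rewrite Er. eapply Rle_trans; [apply Cmod_triangle|].
  rewrite Rmult_plus_distr_r. apply Rplus_le_compat; [|nra].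
  rewrite !Cmod_div by assumption. rewrite Cmod_pow, !Cmod_R, !Rabs_pos_eq by lra.
  assert (HtM' : 0 < t ^ M) by (apply pow_lt, Ht).
  apply Rle_trans with (Bm * t ^ S M / (1 - exp (- t)) / t ^ M).
  - unfold Rdiv. apply Rmult_le_compat_r; [left; apply Rinv_0_lt_compat, HtM'|].
    apply Rmult_le_compat_r; [left; apply Rinv_0_lt_compat, Hq | exact E].
  - replace (Bm * t ^ S M / (1 - exp (- t)) / t ^ M) with (Bm * (t / (1 - exp (- t)))) by (change (t ^ S M) with (t * t ^ M); field; split; lra).
    apply Rmult_le_compat_l; [exact HB | apply div_one_minus_exp_le, Ht].
Qed.

Lemma Rcont_em_tail (n : nat) (t : R) : 0 < t -> Rcont (fun t => em_tail n t) t.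
Proof.
  intro Ht. unfold em_tail. apply Rcont_minus.
  - unfold Cdiv. apply Rcont_mult; [apply Rcont_mult; [apply Rcont_id|]|].
    + apply Rcont_inv.
      * rewrite one_minus_Cexp. intro E. apply RtoC_inj in E. generalize (one_minus_exp_pos t Ht). lra.
      * apply Rcont_minus; [apply Rcont_const|].
        apply (Rder_continuous _ t (- (1) * Cexp (- t))%C). apply Rder_Cexp, Rder_opp, Rder_id.
    + apply Rcont_inv; [apply RtoC_pow_neq_0, Ht | apply Rcont_pow].
  - assert (H : forall m, Rcont (fun t => csum (fun j => em_coef j * tpow n j t)%C m) t).
    { induction m as [|m IH]; simpl; [apply Rcont_const|].
      apply Rcont_plus; [exact IH|]. apply Rcont_mult; [apply Rcont_const | apply Rcont_tpow, Ht]. }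
    apply H.
Qed.

(** A part [e^(-dt)] of the decay pays for the factor [1 + t]. The rest gives a value of order
    [1 / Re z], with a constant independent of [z]. *)
Lemma is_improper_em_tail (n : nat) (d : R) : 0 < d -> exists B, 0 <= B /\ forall z : C, 2 * d <= Re z ->
  exists r, is_improper (fun t => reg_coef n * (em_tail n t * Cexp (- (z * t))))%C r /\ Cmod r <= B / (Re z - d).
Proof.
  intro Hd. destruct (em_tail_bound n) as [B [HB HBt]].
  (* Chosen so that [e * (1 + t) <= 1 + d * t <= e^(d t)]. *)
  set (e := Rmin 1 d). assert (He : 0 < e) by (apply Rmin_pos; lra).
  assert (He1 : e <= 1) by apply Rmin_l. assert (Hed : e <= d) by apply Rmin_r.
  assert (Hc0 := Cmod_ge_0 (reg_coef n)).
  assert (HB' : 0 <= Cmod (reg_coef n) * B / e).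
  { apply Rmult_le_pos; [nra | left; apply Rinv_0_lt_compat, He]. }
  exists (Cmod (reg_coef n) * B / e). split; [exact HB'|].
  intros z Hz. apply (is_improper_dominated _ _ (Re z - d)); [lra | exact HB' | |].
  - intros t Ht. apply Rcont_mult; [apply Rcont_const|].
    apply Rcont_mult; [apply Rcont_em_tail, Ht | apply Rcont_Cexp_lin].
  - intros t Ht. rewrite !Cmod_mult, Cmod_Cexp.
    replace (Re (- (z * t))%C) with (- (Re z - d) * t + - (d * t)).
    2: { destruct z; unfold Re; simpl. ring. }
    rewrite exp_plus.
    assert (H1 : (1 + t) * exp (- (d * t)) <= / e).
    { rewrite exp_Ropp. assert (H2 := exp_ineq1_le (d * t)). assert (H3 := exp_pos (d * t)).
      apply Rmult_le_reg_r with (e * exp (d * t)); [nra|].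
      replace ((1 + t) * / exp (d * t) * (e * exp (d * t))) with (e * (1 + t)) by (field; lra).
      replace (/ e * (e * exp (d * t))) with (exp (d * t)) by (field; lra). nra. }
    specialize (HBt t Ht). assert (Hx := exp_pos (- (Re z - d) * t)). assert (Hy := exp_pos (- (d * t))).
    apply Rle_trans with (Cmod (reg_coef n) * (B * (1 + t) * (exp (- (Re z - d) * t) * exp (- (d * t))))).
    + apply Rmult_le_compat_l; [exact Hc0|]. apply Rmult_le_compat_r; [nra | exact HBt].
    + replace (Cmod (reg_coef n) * (B * (1 + t) * (exp (- (Re z - d) * t) * exp (- (d * t)))))
       with (Cmod (reg_coef n) * B * exp (- (Re z - d) * t) * ((1 + t) * exp (- (d * t)))) by ring.
      replace (Cmod (reg_coef n) * B / e * exp (- (Re z - d) * t)) with (Cmod (reg_coef n) * B * exp (- (Re z - d) * t) * / e) by (field; lra).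
      apply Rmult_le_compat_l; [|exact H1]. apply Rmult_le_pos; nra.
Qed.

Lemma is_improper_period_integrand (n : nat) (z r : C) : 0 < Re z ->
  is_improper (fun t => reg_coef n * (em_tail n t * Cexp (- (z * t))))%C r ->
  is_improper (fun t => period_integrand n z t) (csum (fun j => em_coef j * dhterm (neg_nat n) j z) (S (S n)) + r - reg_sum n z)%C.
Proof.
  intros Hz Hr.
  apply (is_improper_ext (fun t => csum (fun j => em_coef j * reg_part n j z t) (S (S n)) + reg_coef n * (em_tail n t * Cexp (- (z * t))))%C).
  { intros t _. symmetry. apply period_integrand_split. }
  replace (csum (fun j => em_coef j * dhterm (neg_nat n) j z) (S (S n)) + r - reg_sum n z)%C
   with (csum (fun j => em_coef j * (dhterm (neg_nat n) j z - reg_value n j z)) (S (S n)) + r)%C.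
  - apply is_improper_plus; [|exact Hr].
    apply (is_improper_csum (fun j t => em_coef j * reg_part n j z t)%C). intros j Hj.
    apply is_improper_scal, is_improper_reg_part; [exact Hz | lia].
  - unfold reg_sum. rewrite (csum_ext _ (fun j => em_coef j * dhterm (neg_nat n) j z - em_coef j * reg_value n j z)%C) by (intros; ring).
    rewrite csum_minus. ring.
Qed.

(** The factor [1 - e^(-t)] produced by the shift cancels the denominator, and the subtracted
    polynomials telescope because the Euler-Maclaurin formula is exact on them. *)
Lemma period_integrand_telescope (n : nat) (z : C) (t : R) : 0 < t ->
  (period_integrand n z t - period_integrand n (z + 1) t)%C = reg_part n 1 z t.
Proof.
  intro Ht. unfold period_integrand, reg_part.
  rewrite <- (taylor_telescope (fun i => tpow n i t * Cexp (- (1 * t)))%C (S n) z) by lia.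
  rewrite (csum_ext (fun j => em_coef j * (taylor _ _ j (1 - z) - _))%C
    (fun j => em_coef j * taylor (fun i => tpow n i t * Cexp (- (1 * t))) (S (S n)) j (1 - z)
      - em_coef j * taylor (fun i => tpow n i t * Cexp (- (1 * t))) (S (S n)) j (1 - (z + 1)))%C) by (intros; ring).
  rewrite csum_minus.
  replace (Cexp (- ((z + 1) * t))) with (Cexp (- (z * t)) * Cexp (- t))%C.
  2: { rewrite <- Cexp_plus. f_equal. ring. }
  assert (Hden : (1 - Cexp (- (t : C)))%C <> 0).
  { rewrite one_minus_Cexp. intro E. apply RtoC_inj in E. generalize (one_minus_exp_pos t Ht). lra. }
  assert (HtM := RtoC_pow_neq_0 t (S (S n)) Ht).
  set (X := csum _ _). set (Y := csum _ _). unfold tpow.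
  set (tM := (RtoC t ^ S (S n))%C) in *. set (e := Cexp (- (t : C))) in *.
  replace (RtoC t ^ 1)%C with (RtoC t) by (simpl; ring).
  field. split; assumption.
Qed.

(** The same exactness applied to the constants: adding [reg_sum] removes from the difference
    equation the polynomial introduced by the regularization. *)
Lemma qsum_telescope (n : nat) (z : C) : (reg_sum n z - reg_sum n (z + 1))%C = reg_value n 1 z.
Proof.
  unfold reg_sum, reg_value. rewrite <- csum_minus.
  rewrite <- (taylor_telescope (fun i => dhterm (neg_nat n) i 1) (S n) z) by lia.
  apply csum_ext. intros; ring.
Qed.

Lemma csum_add (f : nat -> C) (m k : nat) : csum f (m + k) = (csum f m + csum (fun j => f (m + j)%nat) k)%C.
Proof.
  induction k as [|k IH]; [rewrite Nat.add_0_r; simpl; ring|].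
  rewrite Nat.add_succ_r. simpl. rewrite IH. ring.
Qed.

(** By [Hstep] the partial sums of the divergent series telescope in [Psi]. The Euler-Maclaurin
    sequence whose limit is the derivative therefore equals [Psi 0] up to quantities at [w + K] that
    tend to [0]. *)
Theorem hurwitz_derivative_integral (n : nat) (w : C) : 0 < Re w ->
  is_improper (fun t => period_integrand n w t) (C_derive (fun s => hurwitz_zeta s w) (RtoC (- INR n)) - reg_sum n w)%C.
Proof.
  intro Hw. set (L := C_derive _ _).
  destruct (is_improper_em_tail n (Re w / 2)) as [B [HB HR]]; [lra|].
  assert (Hk : forall k, 2 * (Re w / 2) <= Re (w + INR k)%C).
  { intro k. generalize (pos_INR k). destruct w; unfold Re; simpl. lra. }
  assert (Hk0 : forall k, 0 < Re (w + INR k)%C) by (intro k; generalize (Hk k); lra).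
  (* The values of the tail integrals are known only to exist; description collects them into one
     sequence. *)
  set (r := fun k => proj1_sig (constructive_indefinite_description _ (HR (w + INR k)%C (Hk k)))).
  assert (Hr : forall k, is_improper (fun t => reg_coef n * (em_tail n t * Cexp (- ((w + INR k) * t))))%C (r k) /\ Cmod (r k) <= B / (Re (w + INR k)%C - Re w / 2)).
  { intro k. exact (proj2_sig (constructive_indefinite_description _ (HR (w + INR k)%C (Hk k)))). }
  clearbody r.
  set (Psi := fun k => (csum (fun j => em_coef j * dhterm (neg_nat n) j (w + INR k)) (S (S n)) + r k)%C).
  assert (HPsi : forall k, is_improper (fun t => period_integrand n (w + INR k) t) (Psi k - reg_sum n (w + INR k))%C).
  { intro k. unfold Psi. apply is_improper_period_integrand; [apply Hk0 | apply Hr]. }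
  assert (Hstep : forall k, (Psi k - Psi (S k))%C = dhterm (neg_nat n) 1 (w + INR k)).
  { intro k.
    assert (E : (Psi k - reg_sum n (w + INR k) - (Psi (S k) - reg_sum n (w + INR (S k))))%C = (dhterm (neg_nat n) 1 (w + INR k) - reg_value n 1 (w + INR k))%C).
    { apply (is_improper_unique (fun t => period_integrand n (w + INR k) t - period_integrand n (w + INR (S k)) t)%C).
      - apply is_improper_minus; apply HPsi.
      - apply (is_improper_ext (fun t => reg_part n 1 (w + INR k) t)).
        + intros t Ht. rewrite <- period_integrand_telescope by exact Ht. rewrite S_INR, RtoC_plus, Cplus_assoc. reflexivity.
        + apply is_improper_reg_part; [apply Hk0 | lia]. }
    rewrite <- qsum_telescope in E.
    replace (w + INR (S k))%C with (w + INR k + 1)%C in E by (rewrite S_INR, RtoC_plus; ring).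
    replace (Psi k - Psi (S k))%C with (Psi k - reg_sum n (w + INR k) - (Psi (S k) - reg_sum n (w + INR k + 1))
      + (reg_sum n (w + INR k) - reg_sum n (w + INR k + 1)))%C by ring.
    rewrite E. ring. }
  assert (HL := hurwitz_derivative_limit n (n + 5) w Hw (Nat.le_refl _)). fold L in HL.
  assert (HP : clim (empart (n + 5) (dhterm (RtoC (- INR n))) w) (Psi O)).
  { replace (Psi O) with (Psi O + (0 - 0))%C by ring.
    (* Of the [n + 6] terms in [emsum (n + 5)], the first [n + 2] cancel against those in [Psi K].
       The four others and [r K] are the two vanishing errors. *)
    apply (clim_ext (fun K => Psi O + (csum (fun j => em_coef (S (S n) + j)%nat * dhterm (neg_nat n) (S (S n) + j) (w + INR K)) 4 - r K))%C).
    - intro K. unfold empart, emsum. replace (S (n + 5)) with (S (S n) + 4)%nat by lia.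
      rewrite (csum_add _ (S (S n)) 4).
      rewrite (csum_ext (fun k => dhterm (RtoC (- INR n)) 1 (w + INR k)) (fun k => Psi k - Psi (S k))%C).
      2: { intros j _. symmetry. apply Hstep. }
      rewrite csum_telescope. unfold Psi at 3. fold (neg_nat n). ring.
    - apply clim_plus; [apply clim_const|]. apply clim_minus.
      + apply (clim_csum (fun j K => em_coef (S (S n) + j)%nat * dhterm (neg_nat n) (S (S n) + j) (w + INR K))%C).
        intros j _. replace (RtoC 0) with (em_coef (S (S n) + j) * 0)%C by ring.
        apply clim_scal, clim_dhterm; [exact Hw|]. rewrite plus_INR, !S_INR. generalize (pos_INR j). simpl. lra.
      + apply (clim_le _ _ (fun K => B * / (INR K + Re w / 2))).
        * intro K. replace (r K - 0)%C with (r K) by ring. destruct (Hr K) as [_ H].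
          replace (INR K + Re w / 2) with (Re (w + INR K)%C - Re w / 2); [exact H|].
          destruct w; unfold Re; simpl. field.
        * apply is_lim_seq_spec. intro eps.
          destruct (INR_unbounded (B / eps)) as [N HN]. exists N. intros K HK.
          assert (INR N <= INR K) by (apply le_INR, HK). assert (HK0 := pos_INR K). assert (Heps := cond_pos eps).
          rewrite Rminus_0_r, Rabs_pos_eq.
          2: { apply Rmult_le_pos; [exact HB | left; apply Rinv_0_lt_compat; lra]. }
          apply Rmult_lt_reg_r with (INR K + Re w / 2); [lra|].
          rewrite Rmult_assoc, Rinv_l, Rmult_1_r by lra.
          assert (B < INR K * eps); [|nra].
          replace B with (B / eps * eps) by (field; lra). apply Rmult_lt_compat_r; lra. }
  rewrite (clim_unique _ _ _ HL HP).
  assert (H0 := HPsi O). replace (w + INR 0)%C with w in H0 by (simpl; ring). exact H0.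
Qed.

(** * Membership in the generated fields *)

Lemma gen_field_eq (L : list (C -> C)) (f g : C -> C) : gen_field L f -> (forall t, f t = g t) -> gen_field L g.
Proof.
  intros Hf H. apply (gen_field_ext L f g Hf). intro z. apply filter_forall. exact H.
Qed.

Lemma gen_field_sub (L : list (C -> C)) (f g : C -> C) : gen_field L f -> gen_field L g ->
  gen_field L (fun t => f t - g t)%C.
Proof. intros Hf Hg. apply gen_field_add; [exact Hf | apply gen_field_opp, Hg]. Qed.

Lemma gen_field_div (L : list (C -> C)) (f g : C -> C) : gen_field L f -> gen_field L g ->
  gen_field L (fun t => f t / g t)%C.
Proof. intros Hf Hg. apply gen_field_mul; [exact Hf | apply gen_field_inv, Hg]. Qed.

Lemma gen_field_IZR (L : list (C -> C)) (m : Z) : gen_field L (fun _ => RtoC (IZR m)).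
Proof.
  apply (gen_field_eq L _ _ (gen_field_rat L (inject_Z m))). intros _. f_equal. unfold Q2R; simpl. field.
Qed.

Lemma gen_field_INR (L : list (C -> C)) (m : nat) : gen_field L (fun _ => RtoC (INR m)).
Proof. rewrite INR_IZR_INZ. apply gen_field_IZR. Qed.

Lemma gen_field_pow (L : list (C -> C)) (f : C -> C) (m : nat) : gen_field L f -> gen_field L (fun t => f t ^ m)%C.
Proof.
  intro Hf. induction m as [|m IH]; simpl; [apply (gen_field_IZR L 1) | apply gen_field_mul; assumption].
Qed.

Lemma gen_field_csum (L : list (C -> C)) (f : nat -> C -> C) (m : nat) :
  (forall j, (j < m)%nat -> gen_field L (f j)) -> gen_field L (fun t => csum (fun j => f j t) m).
Proof.
  induction m as [|m IH]; intro H; simpl; [apply (gen_field_IZR L 0)|].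
  apply gen_field_add; [apply IH; intros; apply H; lia | apply H; lia].
Qed.

Lemma gen_field_taylor_term (L : list (C -> C)) (f : C -> C) (k : nat) : gen_field L f -> gen_field L (fun t => taylor_term (f t) k).
Proof. intro Hf. apply gen_field_div; [apply gen_field_pow, Hf | apply gen_field_INR]. Qed.

Lemma gen_field_em_coef (L : list (C -> C)) (k : nat) : gen_field L (fun _ => RtoC (em_coef k)).
Proof.
  induction k as [k IH] using lt_wf_ind. rewrite em_coef_recursion.
  apply gen_field_sub; [apply (gen_field_taylor_term L (fun _ => RtoC 1)), (gen_field_IZR L 1)|].
  apply (gen_field_csum L (fun j _ => em_coef j * taylor_term 1 (S k - j))%C). intros j Hj.
  apply gen_field_mul; [apply IH, Hj | apply (gen_field_taylor_term L (fun _ => RtoC 1)), (gen_field_IZR L 1)].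
Qed.

Lemma gen_field_taylor (L : list (C -> C)) (x : nat -> C -> C) (f : C -> C) (M j : nat) :
  (forall i, gen_field L (x i)) -> gen_field L f -> gen_field L (fun t => taylor (fun i => x i t) M j (f t)).
Proof.
  intros Hx Hf. apply (gen_field_csum L (fun k t => taylor_term (f t) k * x (j + k)%nat t)%C). intros k _.
  apply gen_field_mul; [apply gen_field_taylor_term, Hf | apply Hx].
Qed.

Lemma gen_field_neg_nat (L : list (C -> C)) (n : nat) : gen_field L (fun _ => neg_nat n).
Proof.
  apply (gen_field_eq L (fun _ => - RtoC (INR n))%C); [apply gen_field_opp, gen_field_INR|].
  intros _. symmetry. apply RtoC_opp.
Qed.

Lemma gen_field_poch (L : list (C -> C)) (n j : nat) : gen_field L (fun _ => poch (neg_nat n) j).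
Proof.
  induction j as [|j IH]; simpl.
  - apply gen_field_inv, gen_field_sub; [apply gen_field_neg_nat | apply (gen_field_IZR L 1)].
  - apply gen_field_mul; [exact IH|]. apply gen_field_sub; [apply gen_field_add; [apply gen_field_neg_nat | apply gen_field_INR] | apply (gen_field_IZR L 1)].
Qed.

Lemma gen_field_dpoch (L : list (C -> C)) (n j : nat) : gen_field L (fun _ => dpoch (neg_nat n) j).
Proof.
  assert (H1 : gen_field L (fun _ => neg_nat n - 1)%C) by (apply gen_field_sub; [apply gen_field_neg_nat | apply (gen_field_IZR L 1)]).
  induction j as [|j IH]; simpl.
  - apply gen_field_opp, gen_field_inv, gen_field_mul; exact H1.
  - apply gen_field_add; [apply gen_field_mul; [exact IH|] | apply gen_field_poch].
    apply gen_field_sub; [apply gen_field_add; [apply gen_field_neg_nat | apply gen_field_INR] | apply (gen_field_IZR L 1)].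
Qed.

(** Since [Clog 1 = 0], the logarithm disappears and the power is [1]; the rational number [dpoch]
    is left. *)
Lemma gen_field_dhterm_1 (L : list (C -> C)) (n j : nat) : gen_field L (fun _ => dhterm (neg_nat n) j 1).
Proof.
  apply (gen_field_eq L _ _ (gen_field_dpoch L n j)). intros _. unfold dhterm, zpow. rewrite Clog_1, !Cmult_0_r, Cexp_0. ring.
Qed.

Lemma gen_field_reg_sum (L : list (C -> C)) (n : nat) (w : C) : gen_field L (fun _ => w) -> gen_field L (fun _ => reg_sum n w).
Proof.
  intro Hw. apply (gen_field_csum L (fun j _ => em_coef j * reg_value n j w)%C). intros j _.
  apply gen_field_mul; [apply gen_field_em_coef|].
  apply (gen_field_taylor L (fun i _ => dhterm (neg_nat n) i 1) (fun _ => 1 - w)%C); [intro i; apply gen_field_dhterm_1|].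
  apply gen_field_sub; [apply (gen_field_IZR L 1) | exact Hw].
Qed.

Lemma gen_field_period_integrand (L : list (C -> C)) (n : nat) (w : C) :
  gen_field L (fun t => t) -> gen_field L (fun t => Cexp (- t)) ->
  gen_field L (fun _ => w) -> gen_field L (fun t => Cexp (- (w * t))) -> gen_field L (period_integrand n w).
Proof.
  intros Ht He Hw Hwt. unfold period_integrand. apply gen_field_mul; [apply gen_field_poch|].
  apply gen_field_sub.
  - apply gen_field_mul; [|exact Hwt]. apply gen_field_div; [|apply gen_field_pow, Ht].
    apply gen_field_div; [exact Ht|]. apply gen_field_sub; [apply (gen_field_IZR L 1) | exact He].
  - apply (gen_field_csum L (fun j t => em_coef j * taylor (fun i => tpow n i t * Cexp (- (1 * t))) (S (S n)) j (1 - w))%C).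
    intros j _. apply gen_field_mul; [apply gen_field_em_coef|].
    apply (gen_field_taylor L (fun i t => tpow n i t * Cexp (- (1 * t)))%C (fun _ => 1 - w)%C).
    + intro i. apply gen_field_mul; [apply gen_field_div; apply gen_field_pow, Ht|].
      apply (gen_field_eq L _ _ He). intro t. f_equal. ring.
    + apply gen_field_sub; [apply (gen_field_IZR L 1) | exact Hw].
Qed.

(** The term [zeta'(-n)] is the same integral at [w = 1], which calls for no exponential other than
    [e^(-t)]. The field enters through four memberships, so the three cases differ only in how their
    generators produce [w] and the exponentials. *)
Lemma log_bendersky_period (L : list (C -> C)) (n : nat) (w : C) : 0 < Re w ->
  gen_field L (fun t => t) -> gen_field L (fun t => Cexp (- t)) ->
  gen_field L (fun _ => w) -> gen_field L (fun t => Cexp (- (w * t))) ->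
  is_exponential_period (gen_field L) (log_bendersky_gamma n w).
Proof.
  intros Hre Ht He Hw Hwt.
  exists (fun t => period_integrand n w t - period_integrand n 1 t + (reg_sum n w - reg_sum n 1) * Cexp (- t))%C. split.
  - apply gen_field_add.
    + apply gen_field_sub; [apply gen_field_period_integrand; assumption|]. apply gen_field_period_integrand; [exact Ht | exact He | apply (gen_field_IZR L 1) |].
      apply (gen_field_eq L _ _ He). intro t. f_equal. ring.
    + apply gen_field_mul; [|exact He]. apply gen_field_sub; apply gen_field_reg_sum; [exact Hw | apply (gen_field_IZR L 1)].
  - apply is_improper_RInt_gen. unfold log_bendersky_gamma.
    change (C_derive riemann_zeta) with (C_derive (fun s => hurwitz_zeta s 1)).
    set (A := C_derive _ _). set (B := C_derive _ _).
    replace (A - B)%C with ((A - reg_sum n w) - (B - reg_sum n 1) + (reg_sum n w - reg_sum n 1) * 1)%C by ring.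
    apply is_improper_plus; [apply is_improper_minus; apply hurwitz_derivative_integral; [exact Hre | simpl; lra]|].
    apply is_improper_scal, is_improper_Cexp.
Qed.

Theorem corollary1p11 (n : nat) :
  (forall w : C, 0 < Re w ->
     is_exponential_period
       (gen_field [ (fun t : C => t);
                    (fun t : C => Cexp (- t)%C);
                    (fun _ : C => w);
                    (fun t : C => Cexp (- (w * t))%C) ])
       (log_bendersky_gamma n w)) /\
  (forall m : Z, (1 <= m)%Z ->
     is_exponential_period
       (gen_field [ (fun t : C => t);
                    (fun t : C => Cexp (- t)%C) ])
       (log_bendersky_gamma n (RtoC (IZR m)))) /\
  (forall p q : Z, 0 < IZR p / IZR q -> Z.gcd p q = 1%Z -> (1 <= q)%Z ->
     is_exponential_period
       (gen_field [ (fun t : C => t);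
                    (fun t : C => Cexp (- (t / RtoC (IZR q)))%C) ])
       (log_bendersky_gamma n (RtoC (IZR p / IZR q)))).
Proof.
  assert (HZ : forall k : Z, (0 <= k)%Z -> RtoC (IZR k) = RtoC (INR (Z.to_nat k))).
  { intros k Hk. rewrite INR_IZR_INZ, Z2Nat.id by exact Hk. reflexivity. }
  split; [|split].
  - intros w Hw. apply log_bendersky_period; [exact Hw | | | |]; apply gen_field_gen; simpl; tauto.
  - intros m Hm. set (L := [_; _]).
    assert (He : gen_field L (fun t => Cexp (- t))) by (apply gen_field_gen; simpl; tauto).
    apply log_bendersky_period; [simpl; apply (IZR_lt 0); lia | apply gen_field_gen; simpl; tauto | exact He | apply gen_field_IZR |].
    (* For an integer [m] the function [e^(-mt)] is a power of the generator [e^(-t)]. *)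
    apply (gen_field_eq L (fun t => Cexp (- t) ^ Z.to_nat m)%C); [apply gen_field_pow, He|].
    intro t. rewrite <- Cexp_pow, HZ by lia. f_equal. ring.
  - intros p q Hpq _ Hq. set (L := [_; _]).
    assert (Hq0 : 0 < IZR q) by (apply (IZR_lt 0); lia).
    assert (Hqc : RtoC (IZR q) <> 0) by (intro E; apply RtoC_inj in E; lra).
    assert (Hp : (0 <= p)%Z).
    { apply le_IZR. replace (IZR p) with (IZR p / IZR q * IZR q) by (field; lra). nra. }
    assert (Hg : gen_field L (fun t => Cexp (- (t / RtoC (IZR q))))) by (apply gen_field_gen; simpl; tauto).
    (* Natural powers of the generator [e^(-t/q)]: the case [k = q] yields [e^(-t)] and [k = p]
       yields [e^(-wt)]. *)
    assert (He : forall k : Z, (0 <= k)%Z -> gen_field L (fun t => Cexp (- (RtoC (IZR k / IZR q) * t)))).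
    { intros k Hk. apply (gen_field_eq L (fun t => Cexp (- (t / RtoC (IZR q))) ^ Z.to_nat k)%C); [apply gen_field_pow, Hg|].
      intro t. rewrite <- Cexp_pow, <- HZ, RtoC_div by lia || lra. f_equal. field. exact Hqc. }
    apply log_bendersky_period; [exact Hpq | apply gen_field_gen; simpl; tauto | | | apply He, Hp].
    + apply (gen_field_eq L _ _ (He q ltac:(lia))). intro t. rewrite RtoC_div by lra. f_equal. field. exact Hqc.
    + apply (gen_field_eq L (fun _ => RtoC (IZR p) / RtoC (IZR q))%C); [apply gen_field_div; apply gen_field_IZR|].
      intros _. rewrite RtoC_div by lra. reflexivity.
Qed.
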